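(* Let $E \subset \mathbb{R}^2$ be compact and $\varepsilon > 0$. Then the following are equivalent: (i) the complement $\overline{\mathbb{R}^2 \setminus E_\varepsilon}$ is a set with positive reach; (ii) for all $x \in \partial E_\varepsilon$ there exists some radius $r(x)>0$ for which the set $B_{r(x)}(x) \cap \overline{\mathbb{R}^2\setminus E_\varepsilon}$ is connected; (iii) for all chain singularities $x \in \mathcal{C}(\partial E_\varepsilon)$ there exists some radius $r(x)>0$ for which the set $B_{r(x)}(x) \cap \overline{\mathbb{R}^2\setminus E_\varepsilon}$ is connected.
   Context: $B_r(x)$ is the open Euclidean ball and $E_\varepsilon := \overline{\bigcup_{p \in E} B_\varepsilon(p)}$. Reach: for $A\subset\mathbb{R}^d$, $\mathrm{Unp}(A)$ is the set of points $z \in \mathbb{R}^d$ having a unique nearest point in $A$ (i.e. $\{a \in A : \|z-a\| = \inf_{a'\in A}\|z-a'\|\}$ is a singleton). For $y\in A$, $\mathrm{reach}(A,y) := \sup\{r\ge 0 : B_r(y) \subset \mathrm{Unp}(A)\}$, and $\mathrm{reach}\,A := \inf_{y\in A}\mathrm{reach}(A,y)$. $A$ has positive reach if $\mathrm{reach}\,A>0$. Chain singularities: for $x \in \partial E_\varepsilon$ the set of contributors is $\Pi_E(x) = \{y \in \partial E : \|y-x\| = \varepsilon\}$, and $\mathrm{Unp}_\varepsilon(E) := \{x \in \partial E_\varepsilon : \Pi_E(x) \text{ is a singleton}\}$. A point $x \in \partial E_\varepsilon$ is smooth if there is $r>0$ with $\partial E_\varepsilon \cap B_r(x) \subset \mathrm{Unp}_\varepsilon(E)$;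 otherwise it is a singularity, and $S(E_\varepsilon)$ denotes the set of singularities. A vector $\xi \in S^1$ is an outward direction at $x$ if there is a sequence $(x_n) \subset \mathbb{R}^2 \setminus E_\varepsilon$ with $x_n \to x$ and $(x_n - x)/\|x_n - x\| \to \xi$; the set of these is $\Xi_x(E_\varepsilon)$. If $\xi \in \Xi_x(E_\varepsilon)$ and $y \in \Pi_E(x)$ satisfy $\langle y - x, \xi\rangle = 0$, then $\xi$ is an extremal outward direction and $y$ an extremal contributor at $x$; the sets of these are $\Xi_x^{\mathrm{ext}}(E_\varepsilon)$ and $\Pi_E^{\mathrm{ext}}(x)$. Each has one or two elements; write $\Xi_x^{\mathrm{ext}}(E_\varepsilon) = \{\xi_1,\xi_2\}$, allowing $\xi_1=\xi_2$, and similarly for $\Pi_E^{\mathrm{ext}}$. For $v \in S^1$ let $U_r(x,v) := \{z \in B_r(x) : \langle z - x, v\rangle > 0\}$. Say a sequence of singularities $(x_n)$ has asymptotically opposite contributors if $\left\langle \frac{y_n^{(1)}-x_n}{\varepsilon}, \frac{y_n^{(2)}-x_n}{\varepsilon}\right\rangle \to -1$, where $\{y_n^{(1)},y_n^{(2)}\} = \Pi_E^{\mathrm{ext}}(x_n)$ (possibly with equal elements). A singularity $x$ is (with a suitable labelling of $\xi_1,\xi_2$): of type S6 if $\xi_1=\xi_2$ and there is a sequence $(x_n) \subset S(E_\varepsilon)\setminus\{x\}$ with $x_n\to x$ and asymptotically opposite contributors; of type S7 if $\xi_1=-\xi_2$ and for each $i\in\{1,2\}$ there are $\delta_i>0$ and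 a sequence in $U_{\delta_i}(x,\xi_i)\cap S(E_\varepsilon)$ converging to $x$ with asymptotically opposite contributors; of type S8 if $\xi_1=-\xi_2$, $U_{\delta_1}(x,\xi_1)\setminus E_\varepsilon$ is connected for some $\delta_1>0$, and there are $\delta_2>0$ and a sequence in $U_{\delta_2}(x,\xi_2)\cap S(E_\varepsilon)$ converging to $x$ with asymptotically opposite contributors. $\mathcal{C}(\partial E_\varepsilon)$ is the set of $x\in\partial E_\varepsilon$ of type S6, S7 or S8. *)

(* Defs.v *)
From HB Require Import structures.
From mathcomp Require Import all_boot all_order all_algebra.
From mathcomp Require Import all_classical all_reals all_analysis.

Set Implicit Arguments.
Unset Strict Implicit.
Unset Printing Implicit Defensive.

Import Order.TTheory GRing.Theory Num.Theory.
Import numFieldNormedType.Exports.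

Local Open Scope classical_set_scope.
Local Open Scope ring_scope.

Section Euclidean.
Context {R : realType} {d : nat}.
Implicit Types (u v x z : 'rV[R]_d) (A : set 'rV[R]_d).

(* The norm and balls that the library puts on row vectors are those of the sup
   norm, so the Euclidean ones are defined here. The topology ([closure],
   [interior], [compact], [connected], limits) is the library's: it is the
   Euclidean one, see [nbhs_eballP]. *)
Definition edot u v : R := \sum_(i < d) u 0 i * v 0 i.

Definition enorm u : R := Num.sqrt (edot u u).

Definition eball (r : R) x : set 'rV[R]_d := [set z | enorm (z - x) < r].

Definition boundary A : set 'rV[R]_d := closure A `\` A°.

Definition nearest A z : set 'rV[R]_d :=
  [set a | A a /\ enorm (z - a) = inf [set enorm (z - a') | a' in A]].

Definition Unp A : set 'rV[R]_d := [set z | exists a, nearest A z = [set a]].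

(* Extended real: the supremum is +oo when [Unp A] is the whole space. *)
Definition reach_at A y : \bar R :=
  ereal_sup [set r%:E | r in [set r : R | 0 <= r /\ eball r y `<=` Unp A]].

Definition reach A : \bar R := ereal_inf [set reach_at A y | y in A].

Definition positive_reach A : Prop := (0 < reach A)%E.

Definition offset A (eps : R) : set 'rV[R]_d :=
  closure (\bigcup_(p in A) eball eps p).

Lemma nbhs_eballP x A :
  nbhs x A <-> exists2 r : R, 0 < r & eball r x `<=` A.
Proof.
have coord u i : `|u 0 i| <= enorm u.
  rewrite -sqrtr_sqr ler_wsqrtr// /edot (bigD1 i)//= -expr2 lerDl.
  by apply: sumr_ge0 => j _; rewrite -expr2 sqr_ge0.
split.
- move=> /nbhs_ballP[e /= e0 eA]; exists e => // z xz; apply: eA.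
  split=> // i j; rewrite ord1 /ball /= distrC.
  by have := coord (z - x) j; rewrite !mxE => /le_lt_trans; apply.
- move=> [r r0 rA]; apply/nbhs_ballP.
  have D0 : (0 : R) < d.+1%:R by [].
  exists (r / d.+1%:R); first by rewrite /= divr_gt0.
  move=> z xz; apply: rA; rewrite /eball /=.
  have -> : r = Num.sqrt (r ^+ 2) by rewrite sqrtr_sqr gtr0_norm.
  rewrite ltr_sqrt ?exprn_gt0//.
  apply: (@le_lt_trans _ _ (\sum_(i < d) (r / d.+1%:R) ^+ 2)).
    apply: ler_sum => i _; rewrite -expr2 -[leLHS]real_normK ?num_real//.
    rewrite lerXn2r ?nnegrE ?(divr_ge0 (ltW r0)) ?ler0n// ltW//.
    by have /= := xz.2 ord0 i; rewrite /ball /= distrC !mxE.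
  rewrite sumr_const card_ord expr_div_n -mulrnAr -[X in _ * X]mulr_natl.
  rewrite gtr_pMr ?exprn_gt0// ltr_pdivrMr ?exprn_gt0// mul1r.
  by rewrite -natrX ltr_nat (@leq_trans d.+1)// leq_pmull.
Qed.

End Euclidean.

Section ChainSingularities.
Context {R : realType}.
Variables (E : set 'rV[R]_2) (eps : R).
Implicit Types (x xi : 'rV[R]_2).

Local Notation Eeps := (offset E eps).

Definition contributors x : set 'rV[R]_2 :=
  [set y | boundary E y /\ enorm (y - x) = eps].

Definition Unp_eps : set 'rV[R]_2 :=
  [set x | boundary Eeps x /\ exists y, contributors x = [set y]].

Definition smooth_point x : Prop :=
  boundary Eeps x /\
  exists2 r : R, 0 < r & boundary Eeps `&` eball r x `<=` Unp_eps.

Definition singularities : set 'rV[R]_2 :=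
  [set x | boundary Eeps x /\ ~ smooth_point x].

Definition outward x : set 'rV[R]_2 :=
  [set xi | enorm xi = 1 /\
    exists u : nat -> 'rV[R]_2,
      [/\ forall n, (~` Eeps) (u n),
          u @ \oo --> x &
          (fun n => (enorm (u n - x))^-1 *: (u n - x)) @ \oo --> xi]].

Definition ext_outward x : set 'rV[R]_2 :=
  [set xi | outward x xi /\ exists2 y, contributors x y & edot (y - x) xi = 0].

Definition ext_contributors x : set 'rV[R]_2 :=
  [set y | contributors x y /\ exists2 xi, outward x xi & edot (y - x) xi = 0].

Definition half_ball (r : R) x v : set 'rV[R]_2 :=
  [set z | eball r x z /\ 0 < edot (z - x) v].

(* [[set y1 n; y2 n]] is a singleton when [y1 n = y2 n]. *)
Definition asymptotically_opposite (u : nat -> 'rV[R]_2) : Prop :=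
  exists y1 y2 : nat -> 'rV[R]_2,
    (forall n, ext_contributors (u n) = [set y1 n; y2 n]) /\
    (fun n => edot (eps^-1 *: (y1 n - u n)) (eps^-1 *: (y2 n - u n)))
      @ \oo --> (-1 : R).

Definition chain_in (A : set 'rV[R]_2) x : Prop :=
  exists u : nat -> 'rV[R]_2,
    [/\ forall n, (A `&` singularities) (u n),
        u @ \oo --> x &
        asymptotically_opposite u].

Definition type_S6 x : Prop :=
  singularities x /\
  exists xi1 xi2, [/\ ext_outward x = [set xi1; xi2],
    xi1 = xi2 & chain_in (~` [set x]) x].

Definition type_S7 x : Prop :=
  singularities x /\
  exists xi1 xi2, [/\ ext_outward x = [set xi1; xi2],
    xi1 = - xi2,
    exists2 delta1 : R, 0 < delta1 & chain_in (half_ball delta1 x xi1) x &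
    exists2 delta2 : R, 0 < delta2 & chain_in (half_ball delta2 x xi2) x].

Definition type_S8 x : Prop :=
  singularities x /\
  exists xi1 xi2, [/\ ext_outward x = [set xi1; xi2],
    xi1 = - xi2,
    exists2 delta1 : R, 0 < delta1 &
      connected (half_ball delta1 x xi1 `\` Eeps) &
    exists2 delta2 : R, 0 < delta2 & chain_in (half_ball delta2 x xi2) x].

Definition chain_singularities : set 'rV[R]_2 :=
  [set x | boundary Eeps x /\ [\/ type_S6 x, type_S7 x | type_S8 x]].

End ChainSingularities.

(* Main.v *)
(* Write U for the complement of the offset and A for its closure; a direction obtuse to all
   contributors at a point of A leads into U.

   If A has reach at least t, then for x in A and y in A near x the nearest-point projection maps
   the segment from x to y to a path in A which, by Federer's inequality, stays within |y - x| of x.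

   If A does not have positive reach, there are points z converging to some x with two nearest
   points a, b in A. At such b the contributors nearly span a half circle, so b is a
   singularity with almost opposite contributors, and x has contributors x + eps v and x - eps v:
   near x, A lies in the thin lune between two tangent balls. Comparing a - b with the tangent of A
   at b shows that the lune is blocked at some radius below |b - x|. Blocked radii accrue at x on
   one side, so small pieces of A are separated from x and no ball about x meets A in a connected
   set. The points b form the chain required for the types S6, S7 and S8; on the other side of x,
   either such points also occur (S7), or no radius is blocked and U has connected slices (S8). *)

Require Import Defs.
From mathcomp Require Import all_boot all_order all_algebra.
From mathcomp Require Import all_classical all_reals all_analysis.
From mathcomp Require Import ring lra.

Set Implicit Arguments.
Unset Strict Implicit.
Unset Printing Implicit Defensive.

Import Order.TTheory GRing.Theory Num.Theory.
Import numFieldNormedType.Exports.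

Local Open Scope classical_set_scope.
Local Open Scope ring_scope.

(** * Inner products, norms and orthonormal frames in the plane *)

Section PlaneGeometry.
Context {R : realType}.
Implicit Types (e u v w x y z : 'rV[R]_2) (a b r : R) (A : set 'rV[R]_2).

(** What drives the converse is a mismatch between two second-order bounds at a foot b of z, where a
    is another foot and D = a - b. The ball of radius eps about a contributor b + eps c gives <D, c>
    <= |D|^2 / (2 eps), whereas equidistance gives <D, z - b> = |D|^2 / 2. When |z - b| is small
    against eps, a correction of D of order |D|^2 can therefore spoil the first product without
    spoiling the sign of the second: the corrected vector is obtuse to every contributor yet acute
    to z - b, so that moving b along it enters the complement and approaches z, which a foot
    forbids. Only a fan of contributors that leaves no room for such a correction survives; this
    forces the near half circle, and the same mechanism forbids a tangent direction at b too close
    to D. Angles are never measured: everything is expressed by coordinates in an orthonormal frame,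
    and the numerical constants are flatness margins. *)

Lemma edot2 u v : edot u v = u 0 0 * v 0 0 + u 0 1 * v 0 1.
Proof.
by rewrite /edot big_ord_recl big_ord1; congr (_ + u 0 _ * v 0 _); apply/val_inj.
Qed.

Lemma edotC u v : edot u v = edot v u.
Proof. by rewrite !edot2; ring. Qed.

Lemma edotDl u v w : edot (u + v) w = edot u w + edot v w.
Proof. by rewrite !edot2 !mxE; ring. Qed.

Lemma edotBl u v w : edot (u - v) w = edot u w - edot v w.
Proof. by rewrite !edot2 !mxE; ring. Qed.

Lemma edotNl u w : edot (- u) w = - edot u w.
Proof. by rewrite !edot2 !mxE; ring. Qed.

Lemma edotZl a u w : edot (a *: u) w = a * edot u w.
Proof. by rewrite !edot2 !mxE; ring. Qed.

Lemma edot0l u : edot 0 u = 0.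
Proof. by rewrite !edot2 !mxE; ring. Qed.

Lemma edotDr u v w : edot w (u + v) = edot w u + edot w v.
Proof. by rewrite !edot2 !mxE; ring. Qed.

Lemma edotBr u v w : edot w (u - v) = edot w u - edot w v.
Proof. by rewrite !edot2 !mxE; ring. Qed.

Lemma edotNr u w : edot w (- u) = - edot w u.
Proof. by rewrite !edot2 !mxE; ring. Qed.

Lemma edotZr a u w : edot w (a *: u) = a * edot w u.
Proof. by rewrite !edot2 !mxE; ring. Qed.

Lemma edot0r u : edot u 0 = 0.
Proof. by rewrite !edot2 !mxE; ring. Qed.

Definition edotE := (edotDl, edotBl, edotNl, edotZl, edotDr, edotBr, edotNr,
  edotZr, edot0l, edot0r).

Lemma edot_ge0 u : 0 <= edot u u.
Proof. by rewrite edot2; nra. Qed.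

Lemma enorm_ge0 u : 0 <= enorm u.
Proof. exact: sqrtr_ge0. Qed.

Lemma sqr_enorm u : enorm u ^+ 2 = edot u u.
Proof. by rewrite sqr_sqrtr // edot_ge0. Qed.

Lemma enorm_unit u : (enorm u = 1) <-> (edot u u = 1).
Proof.
split=> h; first by rewrite -sqr_enorm h expr1n.
by rewrite /enorm h sqrtr1.
Qed.

Lemma edot_eq0 u : edot u u = 0 -> u = 0.
Proof.
rewrite edot2 => h; have [h0 h1] : u 0 0 = 0 /\ u 0 1 = 0 by split; nra.
apply/rowP => i; rewrite !mxE.
case: i => -[|[|//]] i; [rewrite -[RHS]h0|rewrite -[RHS]h1];
  by congr (u 0 _); apply/val_inj.
Qed.

Lemma enorm0 : enorm (0 : 'rV[R]_2) = 0.
Proof. by rewrite /enorm edot0l sqrtr0. Qed.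

Lemma enorm0_eq0 u : enorm u = 0 -> u = 0.
Proof. by move=> h; apply: edot_eq0; rewrite -sqr_enorm h expr0n. Qed.

Lemma enorm_gt0 u : u <> 0 -> 0 < enorm u.
Proof.
by move=> u0; rewrite lt_neqAle enorm_ge0 andbT eq_sym; apply/eqP => /enorm0_eq0.
Qed.

Lemma enormN u : enorm (- u) = enorm u.
Proof. by rewrite /enorm !edotE opprK. Qed.

Lemma enormBC u v : enorm (u - v) = enorm (v - u).
Proof. by rewrite -enormN opprB. Qed.

Lemma enormZ a u : enorm (a *: u) = `|a| * enorm u.
Proof. by rewrite /enorm !edotE mulrA -expr2 sqrtrM ?sqr_ge0// sqrtr_sqr. Qed.

Lemma edot_sqr_le u v : edot u v ^+ 2 <= edot u u * edot v v.
Proof. by rewrite !edot2; have := sqr_ge0 (u 0 0 * v 0 1 - u 0 1 * v 0 0); nra. Qed.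

Lemma edot_le u v : edot u v <= enorm u * enorm v.
Proof.
have h := edot_sqr_le u v; rewrite -!sqr_enorm -exprMn in h.
have := mulr_ge0 (enorm_ge0 u) (enorm_ge0 v); nra.
Qed.

Lemma enormD u v : enorm (u + v) <= enorm u + enorm v.
Proof.
have := edot_le u v; have := enorm_ge0 u; have := enorm_ge0 v.
have := enorm_ge0 (u + v).
have : enorm (u + v) ^+ 2 = enorm u ^+ 2 + enorm v ^+ 2 + 2 * edot u v.
  by rewrite !sqr_enorm !edotE (edotC v u); ring.
nra.
Qed.

Lemma enormB_le w u v : enorm (u - v) <= enorm (u - w) + enorm (w - v).
Proof. have -> : u - v = (u - w) + (w - v) by apply/rowP => i; rewrite !mxE; ring.
exact: enormD. Qed.

Lemma enorm_sqr_lt u v : (enorm u < enorm v) = (edot u u < edot v v).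
Proof. by rewrite -!sqr_enorm ltr_pXn2r// ?nnegrE ?enorm_ge0. Qed.

Lemma enorm_sqr_le u v : (enorm u <= enorm v) = (edot u u <= edot v v).
Proof. by rewrite -!sqr_enorm ler_pXn2r// ?nnegrE ?enorm_ge0. Qed.

Lemma enorm_lt_sqr u r : 0 <= r -> (enorm u < r) = (edot u u < r ^+ 2).
Proof. by move=> r0; rewrite -sqr_enorm ltr_pXn2r// ?nnegrE ?enorm_ge0. Qed.

Lemma enorm_le_sqr u r : 0 <= r -> (enorm u <= r) = (edot u u <= r ^+ 2).
Proof. by move=> r0; rewrite -sqr_enorm ler_pXn2r// ?nnegrE ?enorm_ge0. Qed.

Lemma enorm_normr_le u v : enorm v = 1 -> `|edot u v| <= enorm u.
Proof.
move=> v1; rewrite ler_norml; have := edot_le u v; have := edot_le (- u) v.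
by rewrite enormN v1 !edotE; lra.
Qed.

Definition orthoframe e v := [/\ edot e e = 1, edot v v = 1 & edot e v = 0].

Definition rot90 u : 'rV[R]_2 := \row_i (if i == 0 then - u 0 1 else u 0 0).

Lemma orthoframe_rot90 e : edot e e = 1 -> orthoframe e (rot90 e).
Proof. by rewrite /orthoframe !edot2 !mxE /=; split; lra. Qed.

Lemma orthoframeNr e v : orthoframe e v -> orthoframe e (- v).
Proof. by case=> ? ? ?; split=> //; rewrite !edotE; lra. Qed.

Lemma orthoframeNl e v : orthoframe e v -> orthoframe (- e) v.
Proof. by case=> ? ? ?; split=> //; rewrite !edotE; lra. Qed.

(** Parseval's identity. With e and v as the rows of a 2 by 2 matrix, orthonormal rows give the
    orthonormal columns [k1], [k2], [k3]. *)
Lemma edot_frame e v u w : orthoframe e v ->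
  edot u w = edot u e * edot w e + edot u v * edot w v.
Proof.
move=> [] ; rewrite !edot2.
move: (e 0 0) (e 0 1) (v 0 0) (v 0 1) => a b c d h1 h2 h3.
have h3' : (a * c) ^+ 2 = (b * d) ^+ 2 by rewrite -(sqrrN (b * d)); congr (_ ^+ 2); lra.
have k1 : a ^+ 2 + c ^+ 2 = 1.
  have : (a * c) ^+ 2 = (1 - a ^+ 2) * (1 - c ^+ 2).
    by rewrite h3' exprMn; congr (_ * _); lra.
  by rewrite exprMn; lra.
have k2 : b ^+ 2 + d ^+ 2 = 1 by lra.
have k3 : a * b + c * d = 0.
  apply/eqP; rewrite -sqrf_eq0; apply/eqP.
  have -> : (a * b + c * d) ^+ 2
    = a ^+ 2 * b ^+ 2 + c ^+ 2 * d ^+ 2 + 2 * ((a * c) * (b * d)) by ring.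
  have -> : b * d = - (a * c) by lra.
  have -> : b ^+ 2 = c ^+ 2 by lra.
  by have -> : d ^+ 2 = a ^+ 2 by [lra]; ring.
move: (u 0 0) (u 0 1) (w 0 0) (w 0 1) => u0 u1 w0 w1.
transitivity (u0 * w0 * (a ^+ 2 + c ^+ 2) + u1 * w1 * (b ^+ 2 + d ^+ 2)
  + (u0 * w1 + u1 * w0) * (a * b + c * d)); first by rewrite k1 k2 k3; ring.
by ring.
Qed.

Lemma frame_inj e v u w : orthoframe e v ->
  edot u e = edot w e -> edot u v = edot w v -> u = w.
Proof.
move=> fr he hv; apply/eqP; rewrite -subr_eq0; apply/eqP/edot_eq0.
by rewrite (edot_frame _ _ fr) !edotE he hv !subrr !mulr0 addr0.
Qed.

End PlaneGeometry.

(** * Topology of the plane in terms of the Euclidean norm; compactness *)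

Section PlaneTopology.
Context {R : realType}.
Implicit Types (x y z : 'rV[R]_2) (r : R) (A K : set 'rV[R]_2).

Lemma nbhs_enormP x A :
  nbhs x A <-> exists2 r, 0 < r & forall z, enorm (z - x) < r -> A z.
Proof. exact: nbhs_eballP. Qed.

Lemma closure_enormP A z :
  closure A z <-> forall r, 0 < r -> exists2 a, A a & enorm (a - z) < r.
Proof.
split=> [Az r r0|h B /nbhs_enormP[r r0 rB]].
  by have [|a [Aa az]] := Az (eball r z); [apply/nbhs_enormP; exists r|exists a].
by have [a Aa az] := h r r0; exists a; split=> //; apply: rB.
Qed.

Lemma open_enormP A : open A <->
  forall z, A z -> exists2 r, 0 < r & forall y, enorm (y - z) < r -> A y.
Proof.
rewrite openE; split=> h z Az; first exact/nbhs_enormP/(h z Az).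
exact/nbhs_enormP/(h z Az).
Qed.

Lemma closed_enormP A : closed A <->
  forall z, (forall r, 0 < r -> exists2 a, A a & enorm (a - z) < r) -> A z.
Proof. by split=> h z Az; apply: h; apply/closure_enormP. Qed.

Lemma cvg_enormP (u : nat -> 'rV[R]_2) x : u @ \oo --> x <->
  forall r, 0 < r -> exists N, forall n, (N <= n)%N -> enorm (u n - x) < r.
Proof.
split=> [h r r0|h B /nbhs_enormP[r r0 rB]].
  have /h[N _ hN] : nbhs x (eball r x) by apply/nbhs_enormP; exists r.
  by exists N.
by have [N hN] := h r r0; exists N => // n /= Nn; apply/rB/hN.
Qed.

Lemma continuous_enorm (f : 'rV[R]_2 -> R) :
  (forall x r, 0 < r -> exists2 d, 0 < d &
     forall y, enorm (y - x) < d -> `|f x - f y| < r) -> continuous f.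
Proof.
move=> h x; have xF := @nbhs_filter _ x.
apply/cvgrPdist_lt => r r0; have [d d0 hd] := h x r r0.
by apply/nbhs_enormP; exists d.
Qed.

Lemma compact_enorm A M : closed A -> (forall a, A a -> enorm a <= M) -> compact A.
Proof.
move=> cA bA; apply: bounded_closed_compact => //.
exists M; split; first exact: num_real.
move=> N MN a Aa /=; apply: le_trans (ltW MN); apply: le_trans (bA a Aa).
rewrite /Num.norm /= mx_normrE; apply: bigmax_le; first exact: enorm_ge0.
move=> [i j] _ /=; rewrite ord1 -sqrtr_sqr ler_wsqrtr// edot2.
have [->|->] : j = 0 \/ j = 1.
  by case: j => -[|[|//]] k; [left|right]; apply/val_inj.
by rewrite expr2 lerDl -expr2 sqr_ge0.
by rewrite expr2 lerDr -expr2 sqr_ge0.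
Qed.

Lemma compact_bounded_enorm K : compact K ->
  exists2 M, 0 < M & forall a, K a -> enorm a <= M.
Proof.
move=> /compact_bounded [M [_ hM]].
have [N N0 MN] : exists2 N, 0 < N & M < N.
  by exists (`|M| + 1); have := ler_norm M; have := normr_ge0 M; lra.
exists (2 * N); first by lra.
move=> a Ka; have := hM N MN a Ka.
rewrite /Num.norm /= mx_normrE => h.
have hc j : `|a 0 j| <= N.
  by apply: le_trans h; exact: (le_bigmax _ (fun ij => `|a ij.1 ij.2|) (0, j)).
rewrite enorm_le_sqr ?edot2; last by lra.
have sq j : a 0 j * a 0 j <= N ^+ 2.
  by rewrite -expr2 -real_normK ?num_real// ler_pXn2r ?nnegrE// ltW.
have t0 := sqr_ge0 N; rewrite exprMn -natrX.
by apply: le_trans (lerD (sq 0) (sq 1)) _; lra.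
Qed.

Lemma compact_seq_cluster K (u : nat -> 'rV[R]_2) : compact K ->
  (forall n, K (u n)) ->
  exists2 x, K x & forall r N, 0 < r -> exists2 n, (N <= n)%N & enorm (u n - x) < r.
Proof.
move=> cK Ku; have [|x [Kx clx]] := cK (u @ \oo) _; first by exists 0%N => // n _; apply: Ku.
exists x => // r N r0.
have [] := clx (u @` [set n | (N <= n)%N]) (eball r x).
- by exists N => // n /= Nn; exists n.
- by apply/nbhs_enormP; exists r.
by move=> _ [[n Nn <-] h]; exists n.
Qed.

Lemma ex_invSn_lt r : 0 < r -> exists N, forall n, (N <= n)%N -> n.+1%:R^-1 < r.
Proof.
move=> r0; have [N _ hN] : \forall n \near \oo, n.+1%:R^-1 < r.
  exact: near_infty_natSinv_lt (PosNum r0).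
by exists N => n Nn; apply: hN.
Qed.

(** The form in which compactness is mostly used: [P r] is a property with tolerance r, and points
    satisfying it with arbitrarily small tolerance cluster at x. No subsequence has to be extracted,
    and [P] need not be monotone in r. *)
Lemma compact_cluster K (P : R -> 'rV[R]_2 -> Prop) : compact K ->
  (forall r, 0 < r -> exists2 p, K p & P r p) ->
  exists2 x, K x & forall r, 0 < r ->
    exists e p, [/\ 0 < e < r, K p, P e p & enorm (p - x) < r].
Proof.
move=> cK h.
have /choice[u hu] : forall n : nat, exists p, K p /\ P n.+1%:R^-1 p.
  move=> n; have [|p Kp Pp] := h n.+1%:R^-1; first by rewrite invr_gt0.
  by exists p.
have [n|x Kx hx] := @compact_seq_cluster K u cK; first by case: (hu n).
exists x => // r r0; have [N hN] := ex_invSn_lt r0.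
have [n Nn ?] := hx r N r0; exists n.+1%:R^-1, (u n); have [? ?] := hu n.
by split=> //; rewrite invr_gt0 ltr0Sn hN.
Qed.

End PlaneTopology.

(** * Nearest points and the growth of the distance function *)

Section NearestPoints.
Context {R : realType}.
Implicit Types (a b p q x y z : 'rV[R]_2) (r s t : R) (A : set 'rV[R]_2).

Definition foot A z a := A a /\ forall p, A p -> enorm (z - a) <= enorm (z - p).

Lemma has_inf_enorm A z a : A a -> has_inf [set enorm (z - p) | p in A].
Proof.
move=> Aa; split; first by exists (enorm (z - a)), a.
by exists 0 => _ [p _ <-]; exact: enorm_ge0.
Qed.

Lemma nearestP A z a : nearest A z a <-> foot A z a.
Proof.
split=> [[Aa za]|[Aa za]]; split=> //.
  move=> p Ap; rewrite za; apply: ge_inf; last by exists p.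
  by case: (has_inf_enorm z Aa).
apply/le_anti/andP; split; last first.
  by apply: ge_inf; [case: (has_inf_enorm z Aa)|exists a].
apply: lb_le_inf; first by case: (has_inf_enorm z Aa).
by move=> _ [p Ap <-]; apply: za.
Qed.

Lemma ex_foot A z : closed A -> A !=set0 -> exists a, foot A z a.
Proof.
move=> cA [p0 Ap0].
pose K := A `&` [set p | enorm (z - p) <= enorm (z - p0)].
have cK : compact K.
  apply: (@compact_enorm _ _ (enorm z + enorm (z - p0))).
    apply/closed_enormP => y hy; split.
      apply: ((closed_enormP A).1 cA) => r r0.
      by have [p [? _] ?] := hy r r0; exists p.
    rewrite /= leNgt; apply/negP => lt.
    have [|p [_ /= hp] hpy] := hy (enorm (z - y) - enorm (z - p0)).
      by rewrite subr_gt0.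
    by have := enormB_le p z y; lra.
  move=> p [_ /= hp]; have := enormB_le z 0 p; have := enormBC p z.
  by rewrite -(enormN p) !sub0r enormN enormN; lra.
have [||a] := @compact_EVT_min _ _ (fun p => enorm (z - p)) K _ cK.
- by exists p0; split=> /=.
- apply/continuous_subspaceT/continuous_enorm => y r r0; exists r => // y' hy.
  rewrite ltr_norml; have := enormB_le y z y'; have := enormB_le y' z y.
  by have := enormBC y y'; lra.
rewrite inE => -[Aa /= ha] hmin; exists a; split=> // p Ap.
case: (lerP (enorm (z - p)) (enorm (z - p0))) => h.
  by apply: hmin; rewrite inE; split.
exact: le_trans ha (ltW h).
Qed.

Lemma UnpP A z : closed A -> A !=set0 ->
  (Unp A z <-> forall a b, foot A z a -> foot A z b -> a = b).
Proof.
move=> cA A0; split=> [[c hc] a b /nearestP|h].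
  by rewrite hc => -> /nearestP; rewrite hc => ->.
have [a fa] := ex_foot z cA A0; exists a; apply/seteqP; split=> b.
  by move=> /nearestP fb; apply: h.
by move=> ->; apply/nearestP.
Qed.

(** Any real t strictly below the reach is below some admissible radius at every point of A; an
    infinite reach allows t = 1. *)
Lemma positive_reachP A : positive_reach A <->
  exists2 t, 0 < t & forall y, A y -> eball t y `<=` Unp A.
Proof.
split=> [h|[t t0 h]]; last first.
  apply: (@lt_le_trans _ _ t%:E); first by rewrite lte_fin.
  apply/le_ereal_inf_tmp => _ [y Ay <-]; apply: ereal_sup_ubound.
  by exists t => //; split; [apply: ltW|apply: h].
have [t t0 ht] : exists2 t : R, 0 < t & (t%:E < reach A)%E.
  move: h; rewrite /positive_reach; case: (reach A) => [r|_|]//.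
    by rewrite lte_fin => r0; exists (r / 2); rewrite ?lte_fin; lra.
  by exists 1 => //; rewrite ltey.
exists t => // y Ay.
have /ereal_sup_gt[_ [r [r0 hr] <-]] : (t%:E < reach_at A y)%E.
  by apply: lt_le_trans ht _; apply: ereal_inf_lbound; exists y.
by rewrite lte_fin => tr z zy; apply: hr; apply: lt_trans tr.
Qed.

(** Continuity of the projection where the foot is unique: otherwise feet of points tending to y
    would cluster at a foot of y at distance at least r from q. *)
Lemma foot_cvg A y q : closed A -> foot A y q ->
  (forall a, foot A y a -> a = q) -> forall r, 0 < r ->
  exists2 d, 0 < d & forall y' a, enorm (y' - y) < d -> foot A y' a -> enorm (a - q) < r.
Proof.
move=> cA [Aq fq] uq r r0; apply: contrapT => hn.
pose M := enorm (y - q).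
(* The bound M + 2 holds because |a - y| <= |y' - q| + |y' - y| and |y' - y| < 1. *)
have [||x [Ax [_ hx]] cl] := @compact_cluster _
    (A `&` [set a | enorm (a - y) <= M + 2 * 1 /\ r <= enorm (a - q)])
    (fun e a => exists2 y', enorm (y' - y) < e & foot A y' a).
- apply: (@compact_enorm _ _ (enorm y + M + 2)).
    apply/closed_enormP => z hz; split.
      apply: ((closed_enormP A).1 cA) => e e0.
      by have [p [? _] ?] := hz e e0; exists p.
    split; rewrite leNgt; apply/negP => lt.
      have [|p [_ /= [hp _]] hpz] := hz (enorm (z - y) - (M + 2 * 1)).
        by rewrite subr_gt0.
      by have := enormB_le p z y; have := enormBC p z; lra.
    have [|p [_ /= [_ hp]] hpz] := hz (r - enorm (z - q)); first by rewrite subr_gt0.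
    by have := enormB_le z p q; lra.
  move=> p [_ /= [hp _]]; have := enormB_le y p 0.
  by rewrite !subr0; lra.
- move=> e e0; apply: contrapT => hne; apply: hn.
  exists (Order.min e 1); first by rewrite lt_min e0 ltr01.
  move=> y' a; rewrite lt_min => /andP[ye y1] fa; rewrite ltNge; apply/negP => ra.
  apply: hne; exists a; last by exists y'.
  case: fa => Aa fa; split=> //; split=> //.
  have := fa q Aq; have := enormB_le y' a y; have := enormB_le y y' q.
  by have := enormBC a y'; rewrite /M; lra.
have xq : x = q.
  apply: uq; split=> // p Ap; rewrite leNgt; apply/negP => lt.
  have [|e [a [/andP[e0 er] Ka [y' yy' [_ fa]] ax]]] := cl ((enorm (y - x) - enorm (y - p)) / 3).
    by rewrite divr_gt0// subr_gt0.
  have := fa p Ap; have := enormB_le y y' p; have := enormB_le a y x.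
  by have := enormB_le y' y a; have := enormBC y y'; lra.
by move: hx; rewrite xq subrr enorm0; lra.
Qed.

Definition infdist A y := inf [set enorm (y - a) | a in A].

Lemma foot_infdist A y a : foot A y a -> infdist A y = enorm (y - a).
Proof. by move=> /nearestP[_ ->]. Qed.

Lemma infdist_le A y a : A a -> infdist A y <= enorm (y - a).
Proof.
by move=> Aa; apply: ge_inf; [case: (has_inf_enorm y Aa)|exists a].
Qed.

Lemma infdist_lip A y y' : closed A -> A !=set0 ->
  infdist A y <= infdist A y' + enorm (y - y').
Proof.
move=> cA A0; have [a fa] := ex_foot y' cA A0.
rewrite (foot_infdist fa) addrC; apply: le_trans (enormB_le y' y a).
by apply: infdist_le; case: fa.
Qed.

(** The distance function has slope 1 in the direction away from a unique foot: by [foot_cvg] the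
    foot a of the displaced point stays near q, so moving along y - q is almost moving straight away
    from a. *)
Lemma infdist_grows A y q t : closed A -> foot A y q ->
  (forall a, foot A y a -> a = q) -> y <> q -> 0 <= t < 1 ->
  exists2 h0, 0 < h0 & forall h, 0 < h < h0 ->
    infdist A y + t * h < infdist A (y + (h / enorm (y - q)) *: (y - q)).
Proof.
move=> cA fq uq yq /andP[t0 t1]; set s := enorm (y - q).
have s0 : 0 < s by apply: enorm_gt0 => /eqP; rewrite subr_eq0 => /eqP.
(* A tolerance r on |a - q| must satisfy t (s + r) < s - r, which is [k3] below. *)
have r0 : 0 < s * (1 - t) / 4 by rewrite divr_gt0// mulr_gt0// subr_gt0.
have [d d0 hd] := foot_cvg cA fq uq r0.
exists d => // h /andP[h0 hd'].
have [a fa] : exists a, foot A (y + (h / s) *: (y - q)) a.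
  by apply: ex_foot => //; exists q; case: fq.
have ha : enorm (a - q) < s * (1 - t) / 4.
  apply: hd fa; rewrite addrAC subrr add0r enormZ -/s ger0_norm ?divr_ge0 ?ltW//.
  by rewrite divfK ?gt_eqF.
rewrite (foot_infdist fa) (foot_infdist fq) -/s.
set n := enorm (y - a); set m := enorm (_ - a).
have ns : s <= n by case: fq => _; apply; case: fa.
have nr : n <= s + s * (1 - t) / 4.
  by have := enormB_le q y a; have := enormBC a q; rewrite -/n -/s; lra.
have mn : n ^+ 2 + (h / s) * edot (y - q) (y - a) <= m * n.
  have := edot_le (y + (h / s) *: (y - q) - a) (y - a); rewrite -/m -/n.
  by rewrite sqr_enorm !edotE; lra.
have k : edot (y - q) (y - a) >= s ^+ 2 - s * (s * (1 - t) / 4).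
  have -> : y - a = (y - q) - (a - q) by apply/rowP => i; rewrite !mxE; ring.
  rewrite edotBr -sqr_enorm -/s.
  have := edot_le (y - q) (a - q); rewrite -/s => h1.
  have : s * enorm (a - q) <= s * (s * (1 - t) / 4) by rewrite ler_pM2l// ltW.
  lra.
have k2 : h * (s - s * (1 - t) / 4) <= (h / s) * edot (y - q) (y - a).
  rewrite [leRHS]mulrAC -[leRHS]mulrA ler_pM2l//.
  by rewrite ler_pdivlMr//; lra.
have k3 : t * n < s - s * (1 - t) / 4.
  have : t * n <= t * (s + s * (1 - t) / 4) by rewrite ler_wpM2l.
  have : 0 < s * (1 - t) by rewrite mulr_gt0// subr_gt0.
  have : s * (1 - t) * t <= s * (1 - t).
    by rewrite ler_piMr ?ltW// mulr_gt0// subr_gt0.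
  lra.
have k4 : h * (t * n) < h * (s - s * (1 - t) / 4) by rewrite ltr_pM2l.
have n0 : 0 < n by lra.
suff : n + t * h < m by lra.
rewrite -(ltr_pM2r n0); lra.
Qed.

End NearestPoints.

(** * Federer's inequality for sets of positive reach *)

Section PositiveReach.
Context {R : realType}.
Implicit Types (a b p q x y z : 'rV[R]_2) (r s t : R) (A : set 'rV[R]_2).

(* After Federer: by [infdist_grows], a maximizer of infdist A y - t |y - p| over the ball of
   radius L about p lies on its boundary; then let t tend to 1. *)
Lemma foot_ray A p q (L : R) : closed A -> foot A p q -> p <> q -> 0 <= L ->
  (forall y, enorm (y - p) <= L -> forall a b, foot A y a -> foot A y b -> a = b) ->
  foot A (p + (L / enorm (p - q)) *: (p - q)) q.
Proof.
move=> cA fq pq L0 uL; set s := enorm (p - q).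
have s0 : 0 < s by apply: enorm_gt0 => /eqP; rewrite subr_eq0 => /eqP.
have A0 : A !=set0 by exists q; case: fq.
have dp : infdist A p = s by rewrite (foot_infdist fq).
pose B := [set y | enorm (y - p) <= L].
have cB : compact B.
  apply: (@compact_enorm _ _ (L + enorm p)).
    apply/closed_enormP => z hz; rewrite /B /= leNgt; apply/negP => lt.
    have [|a] := hz (enorm (z - p) - L); first by rewrite subr_gt0.
    by rewrite /B /=; have := enormB_le a z p; have := enormBC a z; lra.
  by move=> a; rewrite /B /=; have := enormB_le p a 0; rewrite !subr0; lra.
have far t : 0 <= t < 1 ->
    exists y, enorm (y - p) = L /\ s + t * L <= infdist A y.
  move=> t01; pose F y := infdist A y - t * enorm (y - p).
  have [||y] := @compact_EVT_max _ _ F B _ cB.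
  - by exists p; rewrite /B /= subrr enorm0.
  - apply/continuous_subspaceT/continuous_enorm => y r r0.
    exists (r / 2) => [|y' hy]; first by lra.
    rewrite ltr_norml /F.
    have h1 := infdist_lip y y' cA A0; have h2 := infdist_lip y' y cA A0.
    have h3 := enormB_le y y' p; have h4 := enormB_le y' y p.
    have h5 := enormBC y y'.
    have h6 : t * enorm (y' - p) <= t * (enorm (y' - y) + enorm (y - p)).
      by rewrite ler_wpM2l//; case/andP: t01.
    have h7 : t * enorm (y - p) <= t * (enorm (y - y') + enorm (y' - p)).
      by rewrite ler_wpM2l//; case/andP: t01.
    have h8 : t * enorm (y' - y) <= enorm (y' - y).
      by rewrite ler_piMl ?enorm_ge0// ltW//; case/andP: t01.
    by rewrite h5 in h1 h7; lra.
  rewrite inE => By max; exists y.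
  have Fp : s <= F y.
    have := max p; rewrite inE /F /B /= subrr enorm0 dp mulr0 subr0; exact.
  have ypL : enorm (y - p) = L; last by rewrite -ypL; split=> //; rewrite /F in Fp; lra.
  apply/eqP; rewrite eq_le By /= leNgt; apply/negP => lt.
  have t0 : 0 <= t * enorm (y - p) by rewrite mulr_ge0 ?enorm_ge0//; case/andP: t01.
  have [a fa] := ex_foot y cA A0.
  have ya : y <> a.
    move=> ya; move: Fp; rewrite /F (foot_infdist fa) ya subrr enorm0 -ya; lra.
  have [|h0 h00 hh] := infdist_grows cA fa _ ya t01.
    by move=> b fb; apply: uL fb fa.
  pose h := Order.min (h0 / 2) (L - enorm (y - p)).
  have hpos : 0 < h by rewrite lt_min; apply/andP; split; lra.
  have hle : h <= h0 / 2 by rewrite ge_min lexx.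
  have hle2 : h <= L - enorm (y - p) by rewrite ge_min lexx orbT.
  have /hh g : 0 < h < h0 by lra.
  set y' := y + _ in g.
  have yy' : enorm (y' - y) = h.
    rewrite /y' addrC addKr enormZ ger0_norm ?divr_ge0 ?enorm_ge0 ?ltW//.
    by rewrite divfK// gt_eqF// enorm_gt0// => /eqP; rewrite subr_eq0 => /eqP.
  have tri := enormB_le y y' p.
  have : F y' <= F y by apply: max; rewrite inE /B /=; lra.
  have : t * enorm (y' - p) <= t * (h + enorm (y - p)).
    by rewrite ler_wpM2l -?yy'//; case/andP: t01.
  by rewrite /F; lra.
have [|y By cl] := @compact_cluster _ B
    (fun e y => enorm (y - p) = L /\ s + (1 - e) * L <= infdist A y) cB.
  move=> r r0; have [y [hy1 hy2]] : exists y, enorm (y - p) = L /\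
      s + (1 - Order.min r 1) * L <= infdist A y.
    by apply: far; rewrite subr_ge0 ge_min lexx orbT ltrBlDr ltrDl lt_min r0 ltr01.
  exists y; first by rewrite /B /= hy1.
  split=> //; apply: le_trans hy2; rewrite lerD2l ler_wpM2r// lerD2l lerN2.
  by rewrite ge_min lexx.
have dy : s + L <= infdist A y.
  rewrite leNgt; apply/negP => lt.
  have e0 : 0 < (s + L - infdist A y) / (L + 2) by rewrite divr_gt0 ?subr_gt0//; lra.
  have [e [y' [/andP[e1 e2] _ [_ h1] h2]]] := cl _ e0.
  have h3 := infdist_lip y' y cA A0.
  have : (s + L - infdist A y) / (L + 2) * (L + 2) = s + L - infdist A y.
    by rewrite divfK// gt_eqF//; lra.
  have : e * L <= (s + L - infdist A y) / (L + 2) * L by rewrite ler_wpM2r// ltW.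
  lra.
have yq : enorm (y - q) = s + L.
  have h1 := enormB_le p y q; have := infdist_le y (fq.1 : A q).
  by rewrite /B /= in By; rewrite -/s in h1; lra.
have yp : enorm (y - p) = L.
  have h1 := enormB_le p y q; rewrite /B /= in By; rewrite -/s in h1.
  by apply/eqP; rewrite eq_le By /=; lra.
suff -> : p + (L / s) *: (p - q) = y.
  by split; [case: fq|move=> a Aa; rewrite yq; apply: le_trans dy (infdist_le _ Aa)].
(* Equality holds in the triangle inequality for y - q = (y - p) + (p - q), hence in Cauchy-Schwarz,
   and y - p is parallel to p - q. *)
have k : edot (y - p) (p - q) = L * s.
  have : enorm (y - q) ^+ 2 = enorm (y - p) ^+ 2 + enorm (p - q) ^+ 2
      + 2 * edot (y - p) (p - q).
    by rewrite !sqr_enorm !edot2 !mxE; ring.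
  by rewrite yq yp -/s; lra.
suff : s *: (y - p) - L *: (p - q) = 0.
  move/eqP; rewrite subr_eq0 => /eqP h; rewrite mulrC -scalerA -h scalerA.
  by rewrite mulVf ?gt_eqF// scale1r addrC subrK.
apply: edot_eq0; rewrite !edotBl !edotBr !edotZl !edotZr k (edotC (p - q)) k.
by rewrite -!sqr_enorm yp -/s; ring.
Qed.

Lemma foot_edot A z q a : foot A z q -> A a ->
  2 * edot (z - q) (a - q) <= enorm (a - q) ^+ 2.
Proof.
move=> [_ fq] Aa; have := fq a Aa; rewrite enorm_sqr_le sqr_enorm.
have -> : edot (z - a) (z - a) = edot (z - q) (z - q) + edot (a - q) (a - q)
   - 2 * edot (z - q) (a - q) by rewrite !edot2 !mxE; ring.
lra.
Qed.

(** By [foot_ray] the point at distance t / 2 from q on the ray from q through p still has foot q,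
    and [foot_edot] is applied there. Taking t / 2 keeps the closed ball needed by [foot_ray] inside
    the open ball of radius t. *)
Lemma federer_ineq A (t : R) p q a : closed A -> 0 < t ->
  (forall y, A y -> eball t y `<=` Unp A) ->
  foot A p q -> enorm (p - q) <= t / 2 -> A a ->
  t * edot (p - q) (a - q) <= enorm (p - q) * enorm (a - q) ^+ 2.
Proof.
move=> cA t0 ht fq ps Aa.
have [<-|/eqP pq] := eqVneq p q.
  by rewrite subrr enorm0 edot0l mulr0 mul0r.
have s0 : 0 < enorm (p - q) by apply: enorm_gt0 => /eqP; rewrite subr_eq0 => /eqP.
set s := enorm (p - q) in ps s0 *.
have [|y yL|] := @foot_ray A p q (t / 2 - s) cA fq pq; first by lra.
  apply/(UnpP y cA); first by exists q; case: fq.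
  apply: (ht q); first by case: fq.
  by rewrite /eball /=; have := enormB_le p y q; rewrite -/s; lra.
rewrite -/s => Aq h.
have /foot_edot - /(_ a Aa) : foot A (p + ((t / 2 - s) / s) *: (p - q)) q by split.
have -> : p + ((t / 2 - s) / s) *: (p - q) - q = (t / 2 / s) *: (p - q).
  by apply/rowP => i; rewrite !mxE; field; rewrite gt_eqF.
rewrite edotZl => k; rewrite mulrC.
have := ler_wpM2l (ltW s0) k.
have -> : s * (2 * (t / 2 / s * edot (p - q) (a - q))) = edot (p - q) (a - q) * t.
  by field; rewrite gt_eqF.
by [].
Qed.

End PositiveReach.

(** * Connected balls in sets of positive reach *)

Section ReachConnected.
Context {R : realType}.
Implicit Types (a b p q x y z : 'rV[R]_2) (r s t : R) (A : set 'rV[R]_2).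

Lemma lipschitz_within (D : set R) (f : R -> 'rV[R]_2) (k : R) :
  (forall c c', D c -> D c' -> enorm (f c - f c') <= k * `|c - c'|) ->
  {within D, continuous f}.
Proof.
move=> h; apply/subspace_continuousP => c Dc B /nbhs_enormP[r r0 rB].
have k0 : 0 < `|k| + 1 by rewrite ltr_pwDr.
suff : nbhs c [set c' | D c' -> B (f c')] by [].
apply/nbhs_ballP; exists (r / (`|k| + 1)); first by rewrite /= divr_gt0.
move=> c' /=; rewrite /ball /= distrC ltr_pdivlMr// mulrC => cc' Dc'.
apply/rB/(le_lt_trans (h _ _ Dc' Dc))/(le_lt_trans _ cc').
by rewrite ler_wpM2r//; have := ler_norm k; lra.
Qed.

(** Adding Federer's inequalities at q and at q' gives t n^2 - t <p - p', q - q'> <= (t / 2) n^2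
    with n = |q - q'|. *)
Lemma foot_lip A (t : R) p p' q q' : closed A -> 0 < t ->
  (forall y, A y -> eball t y `<=` Unp A) ->
  foot A p q -> foot A p' q' -> enorm (p - q) <= t / 4 -> enorm (p' - q') <= t / 4 ->
  enorm (q - q') <= 2 * enorm (p - p').
Proof.
move=> cA t0 ht fq fq' pq pq'.
have h1 : t * edot (p - q) (q' - q) <= enorm (p - q) * enorm (q' - q) ^+ 2.
  by apply: (federer_ineq cA t0 ht fq); [lra|case: fq'].
have h2 : t * edot (p' - q') (q - q') <= enorm (p' - q') * enorm (q - q') ^+ 2.
  by apply: (federer_ineq cA t0 ht fq'); [lra|case: fq].
rewrite (enormBC q' q) in h1.
set n := enorm (q - q') in h1 h2 *.
have n0 : 0 <= n by apply: enorm_ge0.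
have e : edot (p - q) (q' - q) + edot (p' - q') (q - q')
    = n ^+ 2 - edot (p - p') (q - q') by rewrite sqr_enorm !edot2 !mxE; ring.
have cs := edot_le (p - p') (q - q'); rewrite -/n in cs.
have k1 : enorm (p - q) * n ^+ 2 <= t / 4 * n ^+ 2 by rewrite ler_wpM2r ?sqr_ge0.
have k2 : enorm (p' - q') * n ^+ 2 <= t / 4 * n ^+ 2 by rewrite ler_wpM2r ?sqr_ge0.
have k3 : t * n ^+ 2 <= t * (2 * (enorm (p - p') * n)).
  have := ler_wpM2l (ltW t0) cs.
  have : t * (edot (p - q) (q' - q) + edot (p' - q') (q - q'))
     = t * n ^+ 2 - t * edot (p - p') (q - q') by rewrite e; ring.
  lra.
rewrite ler_pM2l// in k3.
case: (ltrP 0 n) => [n1|n1]; last by have := enorm_ge0 (p - p'); lra.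
by rewrite -(ler_pM2r n1); lra.
Qed.

Lemma positive_reach_connected A x : closed A -> positive_reach A -> A x ->
  exists2 r, 0 < r & connected (eball r x `&` A).
Proof.
move=> cA /positive_reachP[t t0 ht] Ax; exists (t / 4); first by rewrite divr_gt0.
have A0 : A !=set0 by exists x.
have /choice[pi fpi] : forall z, exists a, foot A z a by move=> z; apply: ex_foot.
pose sg y (c : R) := x + c *: (y - x).
have sgx y c : enorm (sg y c - x) = `|c| * enorm (y - x).
  by rewrite /sg addrC addKr enormZ.
have sgB y c c' : enorm (sg y c - sg y c') = `|c - c'| * enorm (y - x).
  rewrite -enormZ; congr enorm; apply/rowP => i; rewrite !mxE; ring.
have fix_pi z : A z -> pi z = z.
  move=> Az; have := (fpi z).2 z Az; rewrite subrr enorm0 => h.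
  have /eqP : z - pi z = 0 by apply: enorm0_eq0; have := enorm_ge0 (z - pi z); lra.
  by rewrite subr_eq0 => /eqP.
have near y c : enorm (y - x) < t / 4 -> 0 <= c <= 1 ->
    enorm (sg y c - pi (sg y c)) <= t / 4.
  move=> yx /andP[c0 c1]; have := (fpi (sg y c)).2 x Ax.
  rewrite sgx ger0_norm// => h; apply: le_trans h _.
  have : c * enorm (y - x) <= enorm (y - x) by rewrite ler_piMl ?enorm_ge0.
  lra.
pose C y := [set pi (sg y c) | c in `[0, 1]%classic].
have CC y : enorm (y - x) < t / 4 -> connected (C y).
  move=> yx; apply: connected_continuous_connected.
    by apply/connected_intervalP/interval_is_interval.
  apply: (@lipschitz_within _ _ (2 * enorm (y - x))) => c c'.
  rewrite /= !in_itv /= => c01 c01'.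
  apply: (le_trans (foot_lip cA t0 ht (fpi _) (fpi _) (near y c yx c01) (near y c' yx c01'))).
  by rewrite sgB mulrA [leRHS]mulrAC.
have Cin y c : enorm (y - x) < t / 4 -> A y -> 0 <= c <= 1 ->
    enorm (pi (sg y c) - x) <= enorm (y - x).
  move=> yx Ay /andP[c0 c1]; set p := sg y c; set q := pi p.
  have pq : enorm (p - q) <= t / 4 by apply: near; rewrite ?c0.
  have h1 : t * edot (p - q) (x - q) <= enorm (p - q) * enorm (x - q) ^+ 2.
    by apply: (federer_ineq cA t0 ht (fpi p)) => //; rewrite -/q; lra.
  have h2 : t * edot (p - q) (y - q) <= enorm (p - q) * enorm (y - q) ^+ 2.
    by apply: (federer_ineq cA t0 ht (fpi p)) => //; rewrite -/q; lra.
  set s := enorm (p - q) in pq h1 h2; set D := enorm (y - x) in yx *.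
  have s0 : 0 <= s := enorm_ge0 _; have D0 : 0 <= D := enorm_ge0 _.
  (* Since p = (1 - c) x + c y, the weights 1 - c and c turn [h1] and [h2] into a bound on s alone;
     [e2] is Stewart's theorem. The term s^2 on the right is then absorbed by s <= t / 4. *)
  have e1 : (1 - c) * edot (p - q) (x - q) + c * edot (p - q) (y - q) = s ^+ 2.
    by rewrite sqr_enorm /p /sg !edot2 !mxE; ring.
  have e2 : (1 - c) * enorm (x - q) ^+ 2 + c * enorm (y - q) ^+ 2
      = s ^+ 2 + c * (1 - c) * D ^+ 2.
    by rewrite !sqr_enorm /p /sg !edot2 !mxE; ring.
  have k : t * s ^+ 2 <= s * (s ^+ 2 + c * (1 - c) * D ^+ 2).
    rewrite -e2 -[in leLHS]e1; have c1' : 0 <= 1 - c by lra.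
    by have := ler_wpM2l c1' h1; have := ler_wpM2l c0 h2; lra.
  have cD0 : 0 <= c * (1 - c) * D ^+ 2 by rewrite !mulr_ge0 ?sqr_ge0//; lra.
  have k1 : 3 / 4 * t * s <= c * (1 - c) * D ^+ 2.
    have [s1|s1] := ltrP 0 s; last first.
      by apply: le_trans cD0; rewrite -oppr_ge0 -mulrN mulr_ge0//; lra.
    have k' : t * s <= s ^+ 2 + c * (1 - c) * D ^+ 2.
      by rewrite -(ler_pM2l s1); rewrite mulrCA -expr2.
    by have := ler_wpM2l s0 pq; rewrite expr2 in k'; lra.
  (* This yields |q - x| <= s + |p - x| <= (1 - c) D + c D. *)
  have k2 : s <= (1 - c) * D.
    have : 3 / 4 * t * s <= 3 / 4 * t * ((1 - c) * D).
      apply: le_trans k1 _.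
      have z0 : 0 <= (1 - c) * D by rewrite mulr_ge0//; lra.
      rewrite (_ : c * (1 - c) * D ^+ 2 = (c * D) * ((1 - c) * D)); last by ring.
      apply: (ler_wpM2r z0).
      have : c * D <= D by rewrite ler_piMl.
      lra.
    by rewrite ler_pM2l//; lra.
  have := enormB_le p q x; rewrite (enormBC q p) -/s [enorm (p - x)]sgx ger0_norm//.
  by rewrite -/D; lra.
have sg1 y : sg y 1 = y by rewrite /sg scale1r addrC subrK.
have sg0 y : sg y 0 = x by rewrite /sg scale0r addr0.
have -> : eball (t / 4) x `&` A = \bigcup_(y in eball (t / 4) x `&` A) C y.
  apply/seteqP; split=> [y [yx Ay]|z [y [yx Ay] [c /=]]].
    exists y => //; exists 1; last by rewrite sg1 fix_pi.
    by rewrite /= in_itv /= ler01 lexx.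
  rewrite in_itv /= => c01 <-; split; last by case: (fpi (sg y c)).
  by rewrite /eball /=; exact: le_lt_trans (Cin _ _ yx Ay c01) yx.
apply: bigcup_connected => [|y [yx _]]; last exact: CC.
exists x => y _; exists 0; last by rewrite sg0 fix_pi.
by rewrite /= in_itv /= lexx ler01.
Qed.

End ReachConnected.

(** * The offset, the closure of its complement, and contributors *)

Section Offset.
Context {R : realType}.
Variables (E : set 'rV[R]_2) (eps : R).
Hypotheses (cptE : compact E) (eps_gt0 : 0 < eps).
Implicit Types (a b c h p q u v w x y z : 'rV[R]_2) (r s t : R).

Definition outer : set 'rV[R]_2 := ~` offset E eps.

Definition outer_closure : set 'rV[R]_2 := closure outer.

Local Notation U := outer.
Local Notation A := outer_closure.

Lemma offsetP z : offset E eps z <-> exists2 y, E y & enorm (z - y) <= eps.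
Proof.
split=> [/closure_enormP h|[y Ey zy]].
  have [r r0|y Ey cl] := @compact_cluster _ E (fun r y => enorm (z - y) < eps + r) cptE.
    have [a [y Ey ay] az] := h r r0; exists y => //.
    by have := enormB_le a z y; have := enormBC a z; rewrite /eball /= in ay; lra.
  exists y => //; rewrite leNgt; apply/negP => lt.
  have [|e [p [/andP[_ e1] Ep zp py]]] := cl ((enorm (z - y) - eps) / 2).
    by rewrite divr_gt0// subr_gt0.
  by have := enormB_le p z y; lra.
apply/closure_enormP => r r0.
pose d := Order.min (1 / 2) (r / (2 * eps)).
have d0 : 0 < d by rewrite lt_min !divr_gt0 ?mulr_gt0.
have d1 : d <= 1 / 2 by rewrite ge_min lexx.
have d2 : d * eps <= r / 2.
  have : d <= r / (2 * eps) by rewrite ge_min lexx orbT.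
  by rewrite ler_pdivlMr ?mulr_gt0//; lra.
have zy0 := enorm_ge0 (z - y).
exists (z - d *: (z - y)).
  exists y => //; rewrite /eball /=.
  have -> : z - d *: (z - y) - y = (1 - d) *: (z - y).
    by apply/rowP => i; rewrite !mxE; ring.
  rewrite enormZ ger0_norm; last by lra.
  have : (1 - d) * enorm (z - y) <= (1 - d) * eps by rewrite ler_wpM2l//; lra.
  by have : 0 < d * eps by [rewrite mulr_gt0]; lra.
have -> : z - d *: (z - y) - z = - (d *: (z - y)) by rewrite addrC addKr.
rewrite enormN enormZ ger0_norm ?ltW//.
by have := ler_wpM2l (ltW d0) zy; lra.
Qed.

Lemma outerP z : U z <-> forall y, E y -> eps < enorm (z - y).
Proof.
split=> [Uz y Ey|h /offsetP[y Ey]]; last by have := h y Ey; lra.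
by rewrite ltNge; apply/negP => zy; apply/Uz/offsetP; exists y.
Qed.

Lemma not_outerP z : ~ U z <-> exists2 y, E y & enorm (z - y) <= eps.
Proof.
by rewrite -offsetP; split=> [|oz]; [apply: contrapT|apply].
Qed.

Lemma subset_outer_closure : U `<=` A.
Proof. exact: subset_closure. Qed.

Lemma outer_closure_ge p y : A p -> E y -> eps <= enorm (p - y).
Proof.
move=> /closure_enormP Ap Ey; rewrite leNgt; apply/negP => lt.
have [|a /outerP Ua ap] := Ap (eps - enorm (p - y)); first by rewrite subr_gt0.
by have := Ua y Ey; have := enormB_le p a y; lra.
Qed.

Lemma open_outer : open U.
Proof. by apply/closed_openC/closed_closure. Qed.

Lemma boundary_offsetP x : boundary (offset E eps) x <-> A x /\ ~ U x.
Proof.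
split=> [[ox ix]|[/closure_enormP Ax Ux]].
  split; last first.
    by move=> Ux; apply: Ux; apply: (@closed_closure _ (\bigcup_(p in E) eball eps p)).
  apply/closure_enormP => r r0; apply: contrapT => hn; apply: ix.
  apply/nbhs_enormP; exists r => // z zx; apply: contrapT => oz.
  by apply: hn; exists z.
split; first by apply: subset_closure; apply: contrapT.
move=> /nbhs_enormP[r r0 hr]; have [a Ua ax] := Ax r r0.
exact/Ua/hr.
Qed.

(** Contributors as unit directions. Membership in E replaces membership in its boundary; by
    [contributorsP] this is the same for b in A. *)
Definition dirs b : set 'rV[R]_2 := [set c | edot c c = 1 /\ E (b + eps *: c)].

Lemma dirs_of b y : A b -> E y -> enorm (b - y) <= eps ->
  dirs b (eps^-1 *: (y - b)) /\ y = b + eps *: (eps^-1 *: (y - b)).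
Proof.
move=> Ab Ey by_; have e : y = b + eps *: (eps^-1 *: (y - b)).
  by rewrite scalerA divff ?gt_eqF// scale1r addrC subrK.
split=> //; split; last by rewrite -e.
have := outer_closure_ge Ab Ey => h.
have {h by_}h : enorm (y - b) = eps by rewrite enormBC; lra.
by rewrite edotZl edotZr -sqr_enorm h; field; rewrite gt_eqF.
Qed.

Lemma dirs_neq0 b : A b -> ~ U b -> exists c, dirs b c.
Proof.
move=> Ab /not_outerP[y Ey by_]; exists (eps^-1 *: (y - b)).
by case: (dirs_of Ab Ey by_).
Qed.

Lemma dirs_dist b c : dirs b c -> enorm (b - (b + eps *: c)) = eps.
Proof.
move=> [/enorm_unit c1 _].
by rewrite opprD addrA subrr sub0r enormN enormZ c1 mulr1 gtr0_norm.
Qed.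

Lemma dirs_not_outer b c : dirs b c -> ~ U b.
Proof.
by move=> bc; apply/not_outerP; exists (b + eps *: c); [case: bc|rewrite dirs_dist].
Qed.

(** A avoids the open ball of radius eps about b + eps c, so it can rise towards c only to second
    order. *)
Lemma dirs_edot b c p : dirs b c -> A p -> 2 * eps * edot (p - b) c <= edot (p - b) (p - b).
Proof.
move=> [c1 Ec] Ap; have := outer_closure_ge Ap Ec.
rewrite -(@ler_pXn2r _ 2) ?nnegrE ?enorm_ge0 ?(ltW eps_gt0)// sqr_enorm.
have -> : edot (p - (b + eps *: c)) (p - (b + eps *: c))
    = edot (p - b) (p - b) - 2 * eps * edot (p - b) c + eps * eps * edot c c.
  by rewrite !edot2 !mxE; ring.
rewrite c1; lra.
Qed.

(** A point of E at distance eps from b is not interior to E, since E would otherwise contain points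
    closer to b than eps. *)
Lemma contributorsP b y : A b ->
  contributors E eps b y <-> exists2 c, dirs b c & y = b + eps *: c.
Proof.
move=> Ab; have cE : closed E by apply: compact_closed => //; exact: norm_hausdorff.
split=> [[[clE _] yb]|[c bc ->]].
  have Ey : E y by apply: cE.
  have [] := dirs_of Ab Ey; first by rewrite enormBC yb.
  by move=> h1 h2; exists (eps^-1 *: (y - b)).
split; last by rewrite enormBC dirs_dist.
split; first by apply: subset_closure; case: bc.
move=> /nbhs_enormP[r r0 hr].
have [c1 _] := bc; have nc : enorm c = 1 by apply/enorm_unit.
pose d := Order.min (r / 2) (eps / 2).
have d0 : 0 < d by rewrite lt_min !divr_gt0.
have d1 : d <= eps / 2 by rewrite ge_min lexx orbT.
have d2 : d <= r / 2 by rewrite ge_min lexx.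
have /(outer_closure_ge Ab) : E (b + (eps - d) *: c).
  apply: hr; have -> : b + (eps - d) *: c - (b + eps *: c) = - d *: c.
    by apply/rowP => i; rewrite !mxE; ring.
  by rewrite enormZ nc normrN mulr1 gtr0_norm//; lra.
rewrite opprD addrA subrr sub0r enormN enormZ nc mulr1 ger0_norm; lra.
Qed.

(** Upper semicontinuity of the set of contributors. *)
Lemma near_contributors (O : set 'rV[R]_2) x : open O ->
  (forall y, E y -> enorm (x - y) <= eps -> O y) ->
  exists2 d, 0 < d & forall z y, enorm (z - x) < d -> E y -> enorm (z - y) <= eps -> O y.
Proof.
move=> oO hO; apply: contrapT => hn.
have [r r0|y Ey cl] := @compact_cluster _ E
    (fun r y => ~ O y /\ enorm (x - y) < eps + r) cptE.
  apply: contrapT => hr; apply: hn; exists r => // z y zx Ey zy.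
  apply: contrapT => Oy; apply: hr; exists y => //; split=> //.
  by have := enormB_le z x y; have := enormBC x z; lra.
have Oy : O y.
  apply: hO => //; rewrite leNgt; apply/negP => lt.
  have [|e [p [/andP[_ e1] Ep [_ xp] py]]] := cl ((enorm (x - y) - eps) / 2).
    by rewrite divr_gt0// subr_gt0.
  by have := enormB_le p x y; lra.
have [r r0 hr] := (open_enormP O).1 oO y Oy.
by have [e [p [_ _ [Op _] py]]] := cl r r0; apply/Op/hr.
Qed.

(** By [near_contributors] the only points of E that could cover b + t h satisfy <h, y - b> < 0, and
    from those the motion along h moves away. *)
Lemma outer_push b h : A b -> (forall c, dirs b c -> edot h c < 0) ->
  exists2 t0, 0 < t0 & forall t, 0 < t < t0 -> U (b + t *: h).
Proof.
move=> Ab hc; pose O : set 'rV[R]_2 := [set y | edot h (y - b) < 0].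
have [||d d0 hd] := @near_contributors O b.
- apply/open_enormP => z; rewrite /O /= => hz.
  have n0 : 0 < enorm h + 1 by have := enorm_ge0 h; lra.
  exists (- edot h (z - b) / (enorm h + 1)); first by rewrite divr_gt0// oppr_gt0.
  move=> y; rewrite ltr_pdivlMr// => yz; have := edot_le h (y - z).
  have := enorm_ge0 (y - z); rewrite !edotE in hz yz *; lra.
- move=> y Ey by_; have [c1 ->] := dirs_of Ab Ey by_.
  by rewrite /O /= addrC addKr edotZr pmulr_rlt0//; apply: hc.
have n0 : 0 < enorm h + 1 by have := enorm_ge0 h; lra.
exists (d / (enorm h + 1)) => [|t /andP[t0 td]]; first by rewrite divr_gt0.
apply/outerP => y Ey; rewrite ltNge; apply/negP => zy.
have hy : edot h (y - b) < 0.
  apply: (hd (b + t *: h)) => //.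
  rewrite addrC addKr enormZ gtr0_norm//; rewrite ltr_pdivlMr// in td; lra.
have by_ := outer_closure_ge Ab Ey.
suff : edot (b - y) (b - y) < edot (b + t *: h - y) (b + t *: h - y).
  by rewrite -enorm_sqr_lt; lra.
have -> : edot (b + t *: h - y) (b + t *: h - y)
   = edot (b - y) (b - y) + t * (t * edot h h - 2 * edot h (y - b)).
  by rewrite !edot2 !mxE; ring.
rewrite ltrDl mulr_gt0//; have := mulr_ge0 (ltW t0) (edot_ge0 h); lra.
Qed.

End Offset.

(** * Points with two feet, and the contributors at the feet *)

Section DoubleFeet.
Context {R : realType}.
Variables (E : set 'rV[R]_2) (eps : R).
Hypotheses (cptE : compact E) (eps_gt0 : 0 < eps).
Implicit Types (a b c h p q u v w x y z : 'rV[R]_2) (r s t : R).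

Local Notation U := (outer E eps).
Local Notation A := (outer_closure E eps).
Local Notation dirs := (dirs E eps).

Definition double_foot z a b := [/\ foot A z a, foot A z b & a <> b].

Lemma double_foot_edot z a b : double_foot z a b ->
  2 * edot (z - b) (a - b) = edot (a - b) (a - b).
Proof.
move=> [[Aa fa] [Ab fb] _]; have h1 := fa b Ab; have h2 := fb a Aa.
have : enorm (z - a) ^+ 2 = enorm (z - b) ^+ 2.
  by congr (_ ^+ 2); apply/eqP; rewrite eq_le h1.
by rewrite !sqr_enorm !edot2 !mxE; lra.
Qed.

Lemma double_foot_neq z a b : double_foot z a b -> 0 < edot (a - b) (a - b).
Proof.
move=> [_ _ ab]; rewrite -sqr_enorm exprn_gt0// enorm_gt0//.
by move/eqP; rewrite subr_eq0 => /eqP.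
Qed.

(** If h were acute to z - b, a short step from b along h would stay in A by [outer_push] and come
    closer to z. *)
Lemma foot_push z b h : foot A z b -> (forall c, dirs b c -> edot h c < 0) ->
  edot h (z - b) <= 0.
Proof.
move=> [Ab fb] hc; have [t0 t00 ht] := outer_push cptE eps_gt0 Ab hc.
rewrite leNgt; apply/negP => hz.
have n0 : 0 < edot h h + 1 by have := edot_ge0 h; lra.
pose t := Order.min (t0 / 2) (edot h (z - b) / (edot h h + 1)).
have tpos : 0 < t by rewrite lt_min !divr_gt0.
have t1 : t <= t0 / 2 by rewrite ge_min lexx.
have t2 : t * (edot h h + 1) <= edot h (z - b).
  by rewrite -ler_pdivlMr// ge_min lexx orbT.
have /fb : A (b + t *: h) by apply/subset_outer_closure/ht; lra.
rewrite enorm_sqr_le leNgt => /negP; apply.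
have -> : edot (z - (b + t *: h)) (z - (b + t *: h))
    = edot (z - b) (z - b) - t * (2 * edot h (z - b) - t * edot h h).
  by rewrite !edot2 !mxE; ring.
rewrite ltrBlDr ltrDl mulr_gt0//; lra.
Qed.

Lemma near_dirs_edot x u (k : R) : A x -> (forall c, dirs x c -> edot c u <= 0) ->
  edot u u = 1 -> 0 < k ->
  exists2 d, 0 < d & forall b c, enorm (b - x) < d -> dirs b c -> edot c u < k.
Proof.
move=> Ax hu u1 k0.
have nu : enorm u = 1 by apply/enorm_unit.
pose O : set 'rV[R]_2 := [set y | edot (y - x) u < k * eps / 2].
have [||d d0 hd] := @near_contributors _ E eps cptE O x.
- apply/open_enormP => z; rewrite /O /= => hz.
  exists (k * eps / 2 - edot (z - x) u); first by rewrite subr_gt0.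
  move=> y yz; have := edot_le (y - z) u; rewrite nu !edotE in hz yz *; lra.
- move=> y Ey xy; have [c1 ->] := dirs_of cptE eps_gt0 Ax Ey xy.
  rewrite /O /= addrC addKr edotZl; have := hu _ c1 => /(ler_wpM2l (ltW eps_gt0)).
  by have : 0 < k * eps by [rewrite mulr_gt0]; lra.
exists (Order.min d (k * eps / 2)).
  by rewrite lt_min d0 divr_gt0 ?mulr_gt0.
move=> b c; rewrite lt_min => /andP[bd bk] bc.
have : O (b + eps *: c).
  apply: (hd b) => //; first by case: bc.
  by rewrite (dirs_dist eps_gt0 bc).
rewrite /O /=; have := edot_le (x - b) u; rewrite nu enormBC mulr1 => h1.
rewrite !edotE in h1 * => h2; rewrite -(ltr_pM2l eps_gt0); lra.
Qed.

(** If c1 <= -1/2, the term d / 2 * c1 outweighs c0 < d / 8. Otherwise c1^2 <= 1 - d gives |c0| > d,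
    and c0 < d / 8 decides the sign. *)
Lemma half_plane_edot (d c0 c1 : R) : 0 < d <= 1 / 2 -> c0 ^+ 2 + c1 ^+ 2 = 1 ->
  c0 < d / 8 -> c1 <= 1 - d -> c0 + d / 2 * c1 <= - (d / 8).
Proof.
move=> /andP[d0 d1] h h0 h1.
have [k|k] := lerP c1 (- (1 / 2)); first by nra.
have : c0 <= - d; last by nra.
rewrite leNgt; apply/negP => k0.
have k1 : c0 ^+ 2 < d ^+ 2 by nra.
have k2 : c1 ^+ 2 <= 1 - d by nra.
nra.
Qed.

Lemma double_foot_dirs x eta v (d : R) : A x ->
  (forall c, dirs x c -> edot c eta <= 0) -> orthoframe eta v -> 0 < d <= 1 / 2 ->
  exists2 r, 0 < r & forall z a b, double_foot z a b -> enorm (z - x) < r ->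
    exists2 c, dirs b c & 1 - d < edot c v.
Proof.
move=> Ax hx fr /andP[d0 d1]; have [e1 v1 ev] := fr.
have [|r r0 hr] := near_dirs_edot (k := d / 8) Ax hx e1; first by lra.
exists (Order.min (r / 2) (d * eps / 32)).
  by rewrite lt_min !divr_gt0// mulr_gt0.
move=> z a b zab; rewrite lt_min => /andP[zx1 zx2].
apply: contrapT => hn.
have Dgt := double_foot_neq zab; have wD := double_foot_edot zab.
have [[Aa _] fb _] := zab; have [Ab hb] := fb.
have wz := hb x Ax.
set D := a - b in Dgt wD.
have bx : enorm (b - x) < r by have := enormB_le z b x; have := enormBC b z; lra.
(* If no contributor of b is close to v, then u is obtuse to all of them, and so is
   a - b + s u with s of order |a - b|^2; for small |z - b| this contradicts [foot_push]. *)
pose u := eta + (d / 2) *: v.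
have uc c : dirs b c -> edot u c <= - (d / 8).
  move=> bc; have [c1 _] := bc; rewrite /u edotDl edotZl (edotC eta) (edotC v).
  apply: half_plane_edot; first by rewrite d0.
  - by rewrite -c1 (edot_frame c c fr) !expr2.
  - exact: hr bx bc.
  - by rewrite leNgt; apply/negP => k; apply: hn; exists c.
(* The weight 8 |D|^2 turns the bound -d/8 of [uc] into -d |D|^2, against at most d |D|^2 / 2 from d
   eps <D, c>. The product with z - b is at least |D|^2 (d eps / 2 - 16 |z - b|), which is positive
   for |z - b| < d eps / 32. *)
have : edot ((d * eps) *: D + (8 * edot D D) *: u) (z - b) <= 0.
  apply: (foot_push fb) => c bc.
  rewrite edotDl !edotZl; have := dirs_edot cptE eps_gt0 bc Aa; rewrite -/D.
  move=> /(ler_wpM2l (ltW d0)); have := ler_wpM2l (ltW Dgt) (uc c bc).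
  by have : 0 < d * edot D D by [rewrite mulr_gt0]; lra.
rewrite edotDl !edotZl (edotC D) => k.
have wu : - (2 * enorm (z - b)) <= edot u (z - b).
  have := edot_le (- eta) (z - b); have := edot_le (- v) (z - b).
  rewrite !enormN (enorm_unit v).2// (enorm_unit eta).2// !mul1r.
  rewrite /u edotDl edotZl !edotNl => k1 k2.
  have : d / 2 * - edot v (z - b) <= d / 2 * enorm (z - b) by rewrite ler_wpM2l//; lra.
  have : d / 2 * enorm (z - b) <= enorm (z - b) by rewrite ler_piMl ?enorm_ge0//; lra.
  lra.
have wu' := ler_wpM2l (ltW Dgt) wu.
have wD' : d * eps * edot (z - b) D = d * eps / 2 * edot D D by rewrite -wD; field.
rewrite wD' in k.
have : edot D D * enorm (z - b) < edot D D * (d * eps / 32) by rewrite ltr_pM2l//; lra.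
lra.
Qed.

Lemma dirs_limit x v : (forall r, 0 < r -> exists b c,
    [/\ dirs b c, enorm (b - x) < r & 1 - r < edot c v]) -> edot v v = 1 -> dirs x v.
Proof.
move=> h v1; split=> //.
have cE : closed E by apply: compact_closed => //; exact: norm_hausdorff.
apply: ((closed_enormP E).1 cE) => r r0.
pose s := r / (2 * eps).
have s0 : 0 < s by rewrite divr_gt0// mulr_gt0.
have [|b [c [[c1 Ec] bx cv]]] := h (Order.min (r / 2) (s ^+ 2 / 2)).
  by rewrite lt_min !divr_gt0// exprn_gt0.
exists (b + eps *: c) => //.
have bx' : enorm (b - x) < r / 2 by apply: lt_le_trans bx _; rewrite ge_min lexx.
have cv' : 1 - s ^+ 2 / 2 < edot c v.
  by apply: le_lt_trans cv; rewrite lerD2l lerN2 ge_min lexx orbT.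
have cv2 : enorm (c - v) < s.
  by rewrite (enorm_lt_sqr _ (ltW s0)) !edotE c1 v1 (edotC v); lra.
have -> : b + eps *: c - (x + eps *: v) = (b - x) + eps *: (c - v).
  by apply/rowP => i; rewrite !mxE; ring.
apply: le_lt_trans (enormD _ _) _; rewrite enormZ gtr0_norm//.
have : eps * enorm (c - v) < eps * s by rewrite ltr_pM2l.
have -> : eps * s = r / 2 by rewrite /s; field; rewrite gt_eqF.
lra.
Qed.

(** The vector e' is a tangent direction of A at b, a limit of normalized differences p - b. The
    last clause says that a second-order bound on A along g becomes a first-order constraint on
    e'. *)
Lemma tangent_dir b e (mu : R) :
  (forall r, 0 < r -> exists p, [/\ A p, 0 < enorm (p - b) < r &
     edot (p - b) e <= mu * enorm (p - b)]) ->
  exists e', [/\ edot e' e' = 1, edot e' e <= mu &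
    forall g K, (forall p, A p -> edot (p - b) g <= K * edot (p - b) (p - b)) ->
      edot e' g <= 0].
Proof.
move=> h.
pose B : set 'rV[R]_2 := [set q | enorm q <= 1].
have cB : compact B.
  apply: (@compact_enorm _ _ 1) => //; apply/closed_enormP => z hz.
  rewrite /B /= leNgt; apply/negP => lt.
  have [|a /= ha haz] := hz (enorm z - 1); first by rewrite subr_gt0.
  have := enormB_le a z 0; rewrite !subr0 enormBC; rewrite /B /= in ha; lra.
have [r r0|e' Be' cl] := @compact_cluster _ B (fun r q => exists p, [/\ A p,
    0 < enorm (p - b) < r, edot (p - b) e <= mu * enorm (p - b) &
    p - b = enorm (p - b) *: q]) cB.
  have [p [Ap /andP[p0 pr] pe]] := h r r0.
  exists ((enorm (p - b))^-1 *: (p - b)).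
    by rewrite /B /= enormZ ger0_norm ?invr_ge0 ?enorm_ge0// mulVf// gt_eqF.
  by exists p; rewrite p0 pr scalerA divff ?gt_eqF// scale1r.
have near r : 0 < r -> exists p q, [/\ A p, 0 < enorm (p - b) < r,
    edot q q = 1 /\ edot q e <= mu, p - b = enorm (p - b) *: q & enorm (q - e') < r].
  move=> r0; have [s [q [/andP[s0 sr] Bq [p [Ap /andP[p0 ps] pe pq]] qe']]] := cl r r0.
  exists p, q; rewrite p0 (lt_trans ps sr); split=> //; split.
    apply/enorm_unit; apply: (mulfI (lt0r_neq0 p0)).
    by rewrite mulr1 [in RHS]pq enormZ gtr0_norm.
  by rewrite -(ler_pM2l p0) -edotZl -pq mulrC.
exists e'; split.
- apply/enorm_unit/eqP; rewrite eq_le; apply/andP; split; first exact: Be'.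
  rewrite leNgt; apply/negP => lt.
  have [|p [q [_ _ [/enorm_unit q1 _] _ qe']]] := near (1 - enorm e').
    by rewrite subr_gt0.
  by have := enormB_le e' q 0; rewrite !subr0; lra.
- rewrite leNgt; apply/negP => lt.
  have n0 : 0 < enorm e + 1 by have := enorm_ge0 e; lra.
  have [|p [q [_ _ [_ qe] _ qe']]] := near ((edot e' e - mu) / (enorm e + 1)).
    by rewrite divr_gt0// subr_gt0.
  have := edot_le (e' - q) e; rewrite enormBC edotBl.
  rewrite ltr_pdivlMr// in qe'; have := enorm_ge0 (q - e'); lra.
- move=> g K hg; rewrite leNgt; apply/negP => lt.
  have n0 : 0 < `|K| + enorm g + 1.
    by have := enorm_ge0 g; have := normr_ge0 K; lra.
  pose r := edot e' g / (`|K| + enorm g + 1).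
  have r0 : 0 < r by rewrite divr_gt0.
  have rE : r * `|K| + r * enorm g + r = edot e' g by rewrite /r; field; rewrite gt_eqF.
  have [p [q [Ap /andP[p0 pr] _ pq qe']]] := near r r0.
  have qg : edot q g <= r * `|K|.
    have := hg p Ap; rewrite -sqr_enorm [X in edot X _]pq edotZl => k.
    have : edot q g <= K * enorm (p - b).
      by rewrite -(ler_pM2l p0); apply: (le_trans k); rewrite expr2 mulrCA.
    move/le_trans; apply; apply: (@le_trans _ _ (`|K| * enorm (p - b))).
      by rewrite ler_wpM2r ?ler_norm// ltW.
    by rewrite mulrC ler_wpM2r ?normr_ge0// ltW.
  have := edot_le (e' - q) g; rewrite enormBC edotBl.
  have : enorm (q - e') * enorm g <= r * enorm g.
    by rewrite ler_wpM2r ?enorm_ge0// ltW.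
  lra.
Qed.

End DoubleFeet.

(** * The lune at x and its blocked radii *)

Section Gaps.
Context {R : realType}.
Variables (E : set 'rV[R]_2) (eps : R).
Hypotheses (cptE : compact E) (eps_gt0 : 0 < eps).
Implicit Types (a b c h p q u v w x y z e : 'rV[R]_2) (r s t : R).

Local Notation U := (outer E eps).
Local Notation A := (outer_closure E eps).
Local Notation dirs := (dirs E eps).
Local Notation double_foot := (double_foot E eps).

Lemma edot_lune x v p : dirs x v -> dirs x (- v) -> A p ->
  2 * eps * `|edot (p - x) v| <= enorm (p - x) ^+ 2.
Proof.
move=> hv hv' Ap; have := dirs_edot cptE eps_gt0 hv Ap.
have := dirs_edot cptE eps_gt0 hv' Ap; rewrite edotNr sqr_enorm.
by case: (ger0P (edot (p - x) v)); lra.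
Qed.

(** For n = |p - x| <= eps / 8 the bound n^2 / (2 eps) of [edot_lune] is at most n / 16, so p - x is
    nearly parallel to e. *)
Lemma lune_cone x e v p : orthoframe e v -> dirs x v -> dirs x (- v) -> A p ->
  enorm (p - x) <= eps / 8 -> 4 * `|edot (p - x) v| <= `|edot (p - x) e|.
Proof.
move=> fr hv hv' Ap px; have := edot_lune hv hv' Ap.
have := edot_frame (p - x) (p - x) fr; rewrite -sqr_enorm.
set n := enorm _ in px *; set g := edot _ v; set f := edot _ e => h1 h2.
have n0 : 0 <= n := enorm_ge0 _.
have h3 : 16 * `|g| <= n.
  have : 2 * eps * `|g| <= 2 * eps * (n / 16).
    by apply: (le_trans h2); rewrite expr2; have := ler_wpM2l n0 px; lra.
  by rewrite ler_pM2l ?mulr_gt0//; lra.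
have g2 : `|g| ^+ 2 = g * g by rewrite real_normK ?num_real// expr2.
have f2 : `|f| ^+ 2 = f * f by rewrite real_normK ?num_real// expr2.
rewrite -(@ler_pXn2r _ 2) ?nnegrE ?mulr_ge0//.
have : (16 * `|g|) ^+ 2 <= n ^+ 2 by rewrite ler_pXn2r ?nnegrE ?mulr_ge0.
rewrite !exprMn f2 g2 h1; have := sqr_ge0 g; rewrite expr2; lra.
Qed.

(** On the line through x along v the two balls about x + eps v and x - eps v reach out to distance
    2 eps. Near x, each point of A other than x thus lies strictly on one of the two sides. *)
Lemma lune_neq0 x e v p : orthoframe e v -> dirs x v -> dirs x (- v) -> A p ->
  p <> x -> enorm (p - x) < eps -> edot (p - x) e <> 0.
Proof.
move=> fr hv hv' Ap px pe e0; have := edot_lune hv hv' Ap.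
have := edot_frame (p - x) (p - x) fr; rewrite -sqr_enorm e0 mul0r add0r -expr2.
set n := enorm _ in pe *; set g := edot _ v => h1 h2.
have n0 : 0 < n by apply: enorm_gt0 => /eqP; rewrite subr_eq0 => /eqP.
have gn : `|g| = n.
  by apply/eqP; rewrite -(@eqrXn2 _ 2) ?normr_ge0 ?ltW// real_normK ?num_real// h1.
have : n * (2 * eps) <= n * n by rewrite gn expr2 mulrC in h2.
rewrite ler_pM2l//; lra.
Qed.

(** The constant 1/128 makes |v - c| <= 1/8, and |p - b| <= eps / 4 makes <p - b, c> <= |p - b| / 8;
    together they give 1/4. *)
Lemma flat_near b c v p : dirs b c -> edot v v = 1 -> 1 - 1 / 128 <= edot c v ->
  A p -> enorm (p - b) <= eps / 4 -> 4 * edot (p - b) v <= enorm (p - b).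
Proof.
move=> bc v1 cv Ap pb; have := dirs_edot cptE eps_gt0 bc Ap; rewrite -sqr_enorm.
have := edot_le (p - b) (v - c).
have : enorm (v - c) <= 1 / 8.
  by rewrite enorm_le_sqr// !edotE v1 (edotC v); case: bc => -> _; lra.
set n := enorm (p - b) in pb *; rewrite edotBr => h1 h2 h3.
have n0 : 0 <= n := enorm_ge0 _.
have h4 : edot (p - b) c <= n / 8.
  rewrite -(@ler_pM2l _ (2 * eps)) ?mulr_gt0//.
  by apply: (le_trans h3); rewrite expr2; have := ler_wpM2l n0 pb; lra.
have := ler_wpM2l n0 h1; lra.
Qed.

Lemma flat_norm_near b c c' v p : dirs b c -> dirs b c' -> edot v v = 1 ->
  1 - 1 / 128 <= edot c v -> edot c' v <= - (1 - 1 / 128) ->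
  A p -> enorm (p - b) <= eps / 4 -> 4 * `|edot (p - b) v| <= enorm (p - b).
Proof.
move=> bc bc' v1 cv cv' Ap pb; have := flat_near bc v1 cv Ap pb.
have : 4 * edot (p - b) (- v) <= enorm (p - b).
  by apply: (flat_near bc') => //; rewrite ?edotE; lra.
by rewrite edotNr; case: (ger0P (edot (p - b) v)); lra.
Qed.

(** Here (d0, d1) is p - b and (b0, b1) is b - x in the frame e, v; the last hypothesis says |p - x|
    <= |b - x|. Flatness gives |d0| >= sqrt(15/16) n, and d0 <= n / 16 excludes the forward
    direction. *)
Lemma flat_backward (n d0 d1 b0 b1 : R) : 0 <= n -> n ^+ 2 = d0 * d0 + d1 * d1 ->
  4 * `|d1| <= n -> 0 < b0 -> 4 * `|b1| <= b0 ->
  2 * (b0 * d0 + b1 * d1) + n ^+ 2 <= 0 -> d0 <= - (24 / 25) * n.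
Proof.
move=> n0 nE hd b00 hb h.
have h1 : - (`|b1| * `|d1|) <= b1 * d1 by rewrite -normrM lerNl -normrN ler_norm.
have h2 : `|b1| * `|d1| <= b0 / 4 * (n / 4).
  by apply: ler_pM => //; rewrite ?normr_ge0//; lra.
have h3 : d0 <= n / 16.
  rewrite -(ler_pM2l b00); have := sqr_ge0 n; lra.
have h4 : d1 * d1 <= n / 4 * (n / 4).
  by rewrite -expr2 -real_normK ?num_real// expr2; apply: ler_pM => //; lra.
rewrite leNgt; apply/negP => k; nra.
Qed.

(** Here (b0, b1) is p - x, (d0, d1) is p - b, x0 = |p - x| and y0 = |b - x|. As p - b points
    backwards, the distance to x grows at a definite rate from p to b, so the difference of the
    radii controls |p - b|. *)
Lemma flat_close (n d0 d1 b0 b1 x0 y0 : R) : 0 <= n -> 4 * `|d1| <= n ->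
  0 < b0 -> 4 * `|b1| <= b0 -> d0 <= - (24 / 25) * n ->
  (* The condition y0 <= 2 x0 keeps b0 comparable to y0. *)
  0 < y0 -> y0 <= 2 * x0 -> x0 < y0 -> x0 ^+ 2 = b0 * b0 + b1 * b1 ->
  y0 ^+ 2 - x0 ^+ 2 = - (2 * (b0 * d0 + b1 * d1)) + n ^+ 2 -> n <= 8 * (y0 - x0).
Proof.
move=> n0 hd b00 hb h y00 yx xy xE h'.
have h1 : b1 * d1 <= `|b1| * `|d1| by rewrite -normrM ler_norm.
have h2 : `|b1| * `|d1| <= b0 / 4 * (n / 4).
  by apply: ler_pM => //; rewrite ?normr_ge0//; lra.
have h3 : b0 * d0 <= b0 * (- (24 / 25) * n) by rewrite ler_pM2l.
have h4 : b1 * b1 <= b0 / 4 * (b0 / 4).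
  by rewrite -expr2 -real_normK ?num_real// expr2; apply: ler_pM => //; lra.
have h5 : x0 <= 2 * b0.
  by rewrite leNgt; apply/negP => k; nra.
have h6 : b0 * n <= y0 ^+ 2 - x0 ^+ 2.
  by have := sqr_ge0 n; have : 0 <= b0 * n by [rewrite mulr_ge0// ltW]; lra.
have h7 : y0 ^+ 2 - x0 ^+ 2 <= 2 * y0 * (y0 - x0).
  have -> : y0 ^+ 2 - x0 ^+ 2 = (y0 + x0) * (y0 - x0) by ring.
  by rewrite ler_wpM2r//; lra.
have h8 : y0 / 4 * n <= y0 / 4 * (8 * (y0 - x0)).
  have : y0 / 4 * n <= b0 * n by rewrite ler_wpM2r//; lra.
  lra.
by rewrite ler_pM2l in h8; lra.
Qed.

(* With D = a - b, the direction eps D - |D|^2 n' would make an obtuse angle with all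
   contributors at b and an acute one with z - b, against [foot_push]. *)
Lemma double_foot_tangent z a b e' n' : double_foot z a b -> enorm (z - b) < eps / 2 ->
  orthoframe e' n' -> edot (z - b) e' <= 0 -> (forall c, dirs b c -> edot c e' <= 0) ->
  0 <= edot (a - b) n' -> 0 < edot (a - b) e' -> edot (a - b) n' <= edot (a - b) e' ->
  False.
Proof.
move=> zab zb fr we' ce' d1 d0 d01.
have D0 := double_foot_neq zab; have wD := double_foot_edot zab.
have [[Aa _] fb _] := zab.
set D := a - b in D0 wD d0 d1 d01.
have [e1 n1 _] := fr.
have w1 : edot (z - b) n' < eps / 2.
  apply: le_lt_trans zb; have := edot_le (z - b) n'.
  by rewrite (enorm_unit n').2// mulr1.
have wDf : edot D D / 2 <= edot (z - b) n' * edot D n'.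
  rewrite (edot_frame (z - b) D fr) in wD.
  by have := ler_wpM2r (ltW d0) we'; lra.
have d1' : edot D D < eps * edot D n'.
  have d1p : 0 < edot D n'.
    by rewrite lt_neqAle d1 andbT eq_sym; apply/eqP => d1'; move: wDf; rewrite d1'; lra.
  have : edot (z - b) n' * edot D n' < eps / 2 * edot D n' by rewrite ltr_pM2r.
  lra.
(* If <c, n'> > 1/2, [dirs_edot] makes the product with c negative. If 0 <= <c, n'> <= 1/2, then <c,
   e'> <= -4/5, which outweighs the n' part because <D, n'> <= <D, e'>. *)
have : edot (eps *: D - edot D D *: n') (z - b) <= 0.
  apply: (foot_push cptE eps_gt0 fb) => c bc; rewrite edotBl !edotZl.
  have := dirs_edot cptE eps_gt0 bc Aa; rewrite -/D => h1.
  have c0 := ce' c bc; have [c1 _] := bc; rewrite (edot_frame c c fr) in c1.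
  rewrite (edotC n').
  have [k|k] := ltrP (1 / 2) (edot c n').
    have : edot D D * (1 / 2) < edot D D * edot c n' by rewrite ltr_pM2l.
    lra.
  have -> : eps * edot D c - edot D D * edot c n'
      = eps * edot D e' * edot c e' + (eps * edot D n' - edot D D) * edot c n'.
    by rewrite (edot_frame D c fr); ring.
  set c0' := edot c e' in c0 c1 *; set c1' := edot c n' in c1 k *.
  have k1 : 0 < eps * edot D n' - edot D D by lra.
  have k2 : 0 < eps * edot D e' by rewrite mulr_gt0.
  have [k3|k3] := ltrP c1' 0.
    have := mulr_ge0 (ltW k2) (_ : 0 <= - c0'); rewrite oppr_ge0 => /(_ c0).
    have : (eps * edot D n' - edot D D) * - c1' > 0 by rewrite mulr_gt0// oppr_gt0.
    lra.
  have k4 : c0' <= - (4 / 5) by nra.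
  have := ler_wpM2l (ltW k2) k4; have := ler_wpM2l (ltW k1) k.
  have := ler_wpM2l (ltW eps_gt0) d01; lra.
rewrite edotBl !edotZl (edotC D) (edotC n').
have : edot D D * edot (z - b) n' < edot D D * (eps / 2) by rewrite ltr_pM2l.
have : eps * (2 * edot (z - b) D) = eps * edot D D by rewrite wD.
lra.
Qed.

(** The triple 7, 24, 25 bounds the transverse parts by 7/25, and (24/25)^2 - (7/25)^2 = 527/625 >
    4/5. *)
Lemma close_dirs (D0 D1 u0 u1 n : R) : 0 < n -> D0 * D0 + D1 * D1 = n ^+ 2 ->
  u0 * u0 + u1 * u1 = 1 -> D0 <= - (24 / 25) * n -> u0 <= - (24 / 25) ->
  4 / 5 * n <= D0 * u0 + D1 * u1.
Proof.
move=> n0 hD hu D00 u00.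
have h1 : (24 / 25) * n * (24 / 25) <= - D0 * - u0.
  by apply: ler_pM; lra.
have h2 : D1 ^+ 2 <= (7 / 25 * n) ^+ 2 by nra.
have h3 : u1 ^+ 2 <= (7 / 25) ^+ 2 by nra.
have h2' : `|D1| <= 7 / 25 * n.
  by rewrite -(@ler_pXn2r _ 2) ?nnegrE ?real_normK ?num_real//; lra.
have h3' : `|u1| <= 7 / 25.
  by rewrite -(@ler_pXn2r _ 2) ?nnegrE ?real_normK ?num_real//; lra.
have h4 : - (D1 * u1) <= `|D1| * `|u1| by rewrite -normrM -normrN ler_norm.
have h5 : `|D1| * `|u1| <= 7 / 25 * n * (7 / 25) by apply: ler_pM.
lra.
Qed.

(* Otherwise points of A on the circles about x below b converge to b, and produce a tangent
   direction e' of A at b that is close to the direction of a - b. *)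
Lemma gap x e v z a b c c' : orthoframe e v -> A x -> dirs x v -> dirs x (- v) ->
  double_foot z a b -> enorm (z - b) < eps / 2 -> enorm (b - x) <= eps / 8 ->
  enorm (a - x) <= enorm (b - x) -> 0 < edot (b - x) e ->
  dirs b c -> 1 - 1 / 128 <= edot c v -> dirs b c' -> edot c' v <= - (1 - 1 / 128) ->
  exists2 s, 0 < s < enorm (b - x) &
    forall p, A p -> enorm (p - x) = s -> edot (p - x) e <= 0.
Proof.
move=> fr Ax hv hv' zab zb bx ax be bc cv bc' cv'; have [e1 v1 ev] := fr.
have [[Aa _] fb _] := zab; have [Ab _] := fb.
apply: contrapT => hn.
set N := enorm (b - x) in bx ax hn.
have N0 : 0 < N.
  apply: enorm_gt0 => h; move: be; rewrite h edot0l ltxx; exact.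
have cone p : A p -> enorm (p - x) <= N ->
    4 * `|edot (p - b) v| <= enorm (p - b) /\ edot (p - b) e <= - (24 / 25) * enorm (p - b).
  move=> Ap px.
  have h : 4 * `|edot (p - b) v| <= enorm (p - b).
    apply: (flat_norm_near bc bc') => //.
    by have := enormB_le x p b; have := enormBC x b; rewrite -/N; lra.
  split=> //.
  apply: (@flat_backward _ _ (edot (p - b) v) (edot (b - x) e) (edot (b - x) v)) => //.
  - exact: enorm_ge0.
  - by rewrite sqr_enorm (edot_frame _ _ fr).
  - by have := lune_cone fr hv hv' Ab bx; rewrite [X in _ <= X]gtr0_norm.
  - have : enorm (p - x) ^+ 2 <= N ^+ 2.
      by rewrite ler_pXn2r ?nnegrE ?enorm_ge0.
    have -> : enorm (p - x) ^+ 2 = N ^+ 2 + 2 * edot (b - x) (p - b) + enorm (p - b) ^+ 2.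
      by rewrite !sqr_enorm !edot2 !mxE; ring.
    by rewrite (edot_frame (b - x) (p - b) fr); lra.
have tang r : 0 < r -> exists p, [/\ A p, 0 < enorm (p - b) < r &
    edot (p - b) e <= - (24 / 25) * enorm (p - b)].
  (* On the circle of radius N - t, [flat_close] gives |p - b| <= 8 t <= r / 2; its hypothesis y0 <=
     2 x0 asks for t <= N / 2. *)
  move=> r0; pose t := Order.min (N / 2) (r / 16).
  have t0 : 0 < t by rewrite lt_min !divr_gt0.
  have t1 : t <= N / 2 by rewrite ge_min lexx.
  have t2 : t <= r / 16 by rewrite ge_min lexx orbT.
  have [p [Ap px pe]] : exists p, [/\ A p, enorm (p - x) = N - t & 0 < edot (p - x) e].
    apply: contrapT => hp; apply: hn; exists (N - t); first by lra.
    by move=> p Ap px; rewrite leNgt; apply/negP => pe; apply: hp; exists p.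
  have pxN : enorm (p - x) <= N by lra.
  have [h1 h2] := cone p Ap pxN; exists p; split=> //; apply/andP; split.
    apply: enorm_gt0 => /eqP; rewrite subr_eq0 => /eqP pb.
    by move: px; rewrite pb -/N; lra.
  have : enorm (p - b) <= 8 * (N - enorm (p - x)); last by lra.
  apply: (@flat_close _ (edot (p - b) e) (edot (p - b) v) (edot (p - x) e)
    (edot (p - x) v)) => //; rewrite ?enorm_ge0//.
  - have pxe : enorm (p - x) <= eps / 8 by lra.
    by have := lune_cone fr hv hv' Ap pxe; rewrite [X in _ <= X]gtr0_norm.
  - by rewrite px; lra.
  - by rewrite px; lra.
  - by rewrite sqr_enorm (edot_frame _ _ fr).
  - by rewrite -(edot_frame _ _ fr) !sqr_enorm !edot2 !mxE; ring.
have [e' [e'1 e'e hg]] := tangent_dir tang.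
(* A is bounded to second order along z - b by [foot_edot], and along the contributors by
   [dirs_edot]. *)
have we' : edot e' (z - b) <= 0.
  by apply: (hg _ (1 / 2)) => p Ap; have := foot_edot fb Ap;
    rewrite sqr_enorm (edotC (p - b)); lra.
have ce' q : dirs b q -> edot q e' <= 0.
  move=> bq; rewrite edotC; apply: (hg _ ((2 * eps)^-1)) => p Ap.
  by rewrite ler_pdivlMl ?mulr_gt0//; exact: (dirs_edot cptE eps_gt0 bq Ap).
have [Dv De] := cone a Aa ax.
set D := a - b in Dv De.
have D2 := double_foot_neq zab; rewrite -/D in D2.
have n0 : 0 < enorm D.
  by apply: enorm_gt0 => D0; move: D2; rewrite D0 edot0l ltxx.
have d0 : 4 / 5 * enorm D <= edot D e'.
  rewrite (edot_frame D e' fr); apply: close_dirs => //.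
    by rewrite sqr_enorm -(edot_frame D D fr).
  by rewrite -(edot_frame e' e' fr).
have [n' fr' d1] : exists2 n' : 'rV[R]_2, orthoframe e' n' & 0 <= edot D n'.
  have fr' := orthoframe_rot90 e'1; have [h|h] := lerP 0 (edot D (rot90 e')).
    by exists (rot90 e').
  by exists (- rot90 e'); [apply: orthoframeNr|rewrite edotNr; lra].
apply: (double_foot_tangent zab zb fr') => //; first by rewrite edotC.
  by apply: lt_le_trans d0; rewrite mulr_gt0.
(* From <D, e'> >= 4/5 |D| it follows that <D, n'> <= 3/5 |D|. *)
have := sqr_enorm D; rewrite (edot_frame D D fr') -/D.
by move: (edot D e') (edot D n') (enorm D) d0 d1 n0 => f g n; nra.
Qed.

(** The half annulus between the two blocked radii is relatively clopen in A: its open form [P] and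
    its closed form [Q] agree there, by the blocked radii and [lune_neq0]. It contains b but not
    x. *)
Lemma gaps_disconnected x e v b (s1 s2 r : R) : orthoframe e v -> A x -> dirs x v ->
  dirs x (- v) -> A b -> 0 < edot (b - x) e -> enorm (b - x) < r ->
  0 < s1 < enorm (b - x) -> enorm (b - x) < s2 < eps ->
  (forall p, A p -> enorm (p - x) = s1 -> edot (p - x) e <= 0) ->
  (forall p, A p -> enorm (p - x) = s2 -> edot (p - x) e <= 0) ->
  ~ connected (eball r x `&` A).
Proof.
move=> fr Ax hv hv' Ab be br /andP[s10 s1b] /andP[bs2 s2e] g1 g2 cn.
pose P : set 'rV[R]_2 := [set p | s1 < enorm (p - x) < s2 /\ 0 < edot (p - x) e].
pose Q : set 'rV[R]_2 := [set p | s1 <= enorm (p - x) <= s2 /\ 0 <= edot (p - x) e].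
have oP : open P.
  apply/open_enormP => y [/andP[y1 y2] ye].
  exists (Order.min (Order.min (enorm (y - x) - s1) (s2 - enorm (y - x))) (edot (y - x) e)).
    by rewrite !lt_min !subr_gt0 y1 y2.
  move=> q; rewrite !lt_min => /andP[/andP[q1 q2] q3].
  have h1 := enormB_le q y x; have h2 := enormB_le y q x; have h3 := enormBC y q.
  split; first by apply/andP; split; lra.
  have := edot_le (y - q) e; have [/enorm_unit -> _ _] := fr; rewrite mulr1 h3.
  have -> : y - q = (y - x) - (q - x) by apply/rowP => i; rewrite !mxE; ring.
  by rewrite [X in X <= _]edotBl; lra.
have cQ : closed Q.
  apply/closed_enormP => y hy.
  have n1 : enorm e = 1 by case: fr => /enorm_unit.
  split.
    apply/andP; split; rewrite leNgt; apply/negP => lt.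
      have [|q [/andP[q1 q2] _] qy] := hy (s1 - enorm (y - x)); first by rewrite subr_gt0.
      by have := enormB_le y q x; lra.
    have [|q [/andP[q1 q2] _] qy] := hy (enorm (y - x) - s2); first by rewrite subr_gt0.
    by have := enormB_le q y x; have := enormBC q y; lra.
  rewrite leNgt; apply/negP => lt.
  have [|q [_ qe] qy] := hy (- edot (y - x) e); first by rewrite oppr_gt0.
  have := edot_le (q - y) e; rewrite n1 mulr1.
  have -> : q - y = (q - x) - (y - x) by apply/rowP => i; rewrite !mxE; ring.
  rewrite [X in X <= _]edotBl.
  have -> : q - x - (y - x) = q - y by apply/rowP => i; rewrite !mxE; ring.
  lra.
have PQ p : A p -> Q p -> P p.
  move=> Ap [/andP[q1 q2] qe].
  have pe : edot (p - x) e <> 0.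
    apply: (lune_neq0 fr hv hv' Ap); last by lra.
    by move=> px; move: q1; rewrite px subrr enorm0; lra.
  have pe' : 0 < edot (p - x) e by rewrite lt_neqAle qe andbT eq_sym; apply/eqP.
  split=> //; rewrite !lt_neqAle q1 q2 !andbT; apply/andP; split; apply/eqP => h.
    by have := g1 p Ap (esym h); lra.
  by have := g2 p Ap h; lra.
have Pb : P b by split=> //; rewrite s1b.
have : eball r x `&` A `&` P = eball r x `&` A.
  apply: cn.
  - by exists b.
  - by exists P.
  - exists Q => //; apply/seteqP; split=> p [[pr Ap] pP]; split=> //; last exact: PQ.
    by case: pP => /andP[/ltW q1 /ltW q2] /ltW qe; split=> //; rewrite q1.
move=> /seteqP[_] /(_ x)[|_ [/andP[]]].
  by split=> //; rewrite /eball /= subrr enorm0; have := enorm_ge0 (b - x); lra.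
by rewrite subrr enorm0; lra.
Qed.

End Gaps.

(** * Outward directions, and the angular order on a half circle *)

Section Chains.
Context {R : realType}.
Variables (E : set 'rV[R]_2) (eps : R).
Hypotheses (cptE : compact E) (eps_gt0 : 0 < eps).
Implicit Types (a b c h p q u v w x y z e : 'rV[R]_2) (r s t : R).

Local Notation U := (outer E eps).
Local Notation A := (outer_closure E eps).
Local Notation dirs := (dirs E eps).
Local Notation outward := (outward E eps).

Lemma outwardP x xi : outward x xi <-> edot xi xi = 1 /\
  forall r, 0 < r -> exists p, [/\ U p, enorm (p - x) < r &
    enorm ((enorm (p - x))^-1 *: (p - x) - xi) < r].
Proof.
split=> [[/enorm_unit xi1 [u [Uu /cvg_enormP ux /cvg_enormP uxi]]]|[xi1 h]].
  split=> // r r0; have [N1 h1] := ux r r0; have [N2 h2] := uxi r r0.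
  exists (u (maxn N1 N2)); split; first exact: Uu.
    by apply: h1; rewrite leq_maxl.
  by apply: h2; rewrite leq_maxr.
have /choice[u hu] : forall n : nat, exists p, [/\ U p, enorm (p - x) < n.+1%:R^-1 &
    enorm ((enorm (p - x))^-1 *: (p - x) - xi) < n.+1%:R^-1].
  by move=> n; apply: h; rewrite invr_gt0.
split; first exact/enorm_unit.
exists u; split.
- by move=> n; case: (hu n).
- apply/cvg_enormP => r r0; have [N hN] := ex_invSn_lt r0.
  by exists N => n Nn; have [_ h1 _] := hu n; apply: lt_trans h1 (hN n Nn).
- apply/cvg_enormP => r r0; have [N hN] := ex_invSn_lt r0.
  by exists N => n Nn; have [_ _ h1] := hu n; apply: lt_trans h1 (hN n Nn).
Qed.

Lemma outward_edot b xi c : outward b xi -> dirs b c -> edot c xi <= 0.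
Proof.
move=> /outwardP[xi1 h] bc; have [/enorm_unit c1 Ec] := bc.
rewrite leNgt; apply/negP => lt.
have k0 : 0 < (2 * eps)^-1 + 1 by rewrite ltr_wpDl// invr_ge0 mulr_ge0// ltW.
have [|p [Up pb pxi]] := h (edot c xi / ((2 * eps)^-1 + 1)); first by rewrite divr_gt0.
set r := edot c xi / _ in pb pxi.
have rE : r * (2 * eps)^-1 + r = edot c xi.
  by rewrite /r -[X in _ + X]mulr1 -mulrDr divfK// gt_eqF.
have n0 : 0 < enorm (p - b).
  apply: enorm_gt0 => /eqP; rewrite subr_eq0 => /eqP pb'.
  by apply: (dirs_not_outer cptE eps_gt0 bc); rewrite -pb'.
set q := _ *: _ in pxi.
have qc : edot q c <= r * (2 * eps)^-1.
  have h1 := dirs_edot cptE eps_gt0 bc (subset_outer_closure Up).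
  rewrite /q edotZl ler_pdivlMr ?mulr_gt0//.
  apply: le_trans (ltW pb); rewrite -(ler_pM2l n0).
  have -> : enorm (p - b) * ((enorm (p - b))^-1 * edot (p - b) c * (2 * eps))
     = 2 * eps * edot (p - b) c by field; rewrite gt_eqF.
  by rewrite -expr2 sqr_enorm.
have := edot_le (xi - q) c; rewrite c1 mulr1 enormBC edotBl (edotC xi); lra.
Qed.

Lemma compact_unit_circle : compact [set q : 'rV[R]_2 | edot q q = 1].
Proof.
apply: (@compact_enorm _ _ 1) => [|q /= /enorm_unit ->//].
apply/closed_enormP => z hz /=; apply/enorm_unit/eqP; rewrite eq_le.
apply/andP; split; rewrite leNgt; apply/negP => lt.
  have [|a /enorm_unit a1 az] := hz (enorm z - 1); first by rewrite subr_gt0.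
  by have := enormB_le a z 0; rewrite !subr0 enormBC; lra.
have [|a /enorm_unit a1 az] := hz (1 - enorm z); first by rewrite subr_gt0.
by have := enormB_le z a 0; rewrite !subr0; lra.
Qed.

Lemma ex_outward b : A b -> ~ U b -> exists xi, outward b xi.
Proof.
move=> /closure_enormP Ab Ub.
have [r r0|xi xi1 cl] := @compact_cluster _ [set q : 'rV[R]_2 | edot q q = 1]
    (fun r q => exists p, [/\ U p, enorm (p - b) < r & (enorm (p - b))^-1 *: (p - b) = q])
    compact_unit_circle.
  have [p Up pb] := Ab r r0; exists ((enorm (p - b))^-1 *: (p - b)); last by exists p.
  rewrite /= edotZl edotZr -sqr_enorm; field; rewrite gt_eqF//.
  apply: enorm_gt0 => /eqP; rewrite subr_eq0 => /eqP pb'.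
  by apply: Ub; rewrite -pb'.
exists xi; apply/outwardP; split=> // r r0.
have [s [q [/andP[_ sr] _ [p [Up pb pq]] qxi]]] := cl r r0.
by exists p; rewrite pq; split=> //; apply: lt_trans pb sr.
Qed.

(** A weakly obtuse direction xi is the limit of the strictly obtuse xi + t g, to which [outer_push]
    applies. *)
Lemma outward_push b xi g : A b -> edot xi xi = 1 ->
  (forall c, dirs b c -> edot xi c <= 0) -> (forall c, dirs b c -> edot g c < 0) ->
  outward b xi.
Proof.
move=> Ab xi1 hxi hg; apply/outwardP; split=> // r r0.
have n0 : 0 < enorm g + 1 by have := enorm_ge0 g; lra.
(* Normalizing w and replacing w by xi each cost at most t |g| <= r / 3; the bound 1/2 keeps w away
   from 0. *)
pose t := Order.min (1 / 2) (r / 3) / (enorm g + 1).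
have t0 : 0 < t by rewrite divr_gt0// lt_min !divr_gt0.
have tE : t * enorm g + t = Order.min (1 / 2) (r / 3).
  by rewrite /t; field; rewrite gt_eqF.
have m1 : Order.min (1 / 2) (r / 3) <= 1 / 2 by rewrite ge_min lexx.
have m2 : Order.min (1 / 2) (r / 3) <= r / 3 by rewrite ge_min lexx orbT.
have g0 := enorm_ge0 g; have tg0 : 0 <= t * enorm g by rewrite mulr_ge0// ltW.
pose w := xi + t *: g.
have hw c : dirs b c -> edot w c < 0.
  move=> bc; rewrite /w edotDl edotZl; have := hxi c bc.
  have : t * edot g c < 0 by rewrite pmulr_rlt0//; apply: hg.
  lra.
have wxi : enorm (w - xi) = t * enorm g.
  by rewrite /w addrC addKr enormZ gtr0_norm.
have nxi : enorm xi = 1 by apply/enorm_unit.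
have w1 : enorm w <= 1 + t * enorm g.
  by have := enormB_le xi w 0; rewrite !subr0; lra.
have w2 : 1 - t * enorm g <= enorm w.
  by have := enormB_le w xi 0; rewrite !subr0 enormBC; lra.
have wpos : 0 < enorm w by lra.
have [s0 s00 hs] := outer_push cptE eps_gt0 Ab hw.
pose s := Order.min (s0 / 2) (r / (2 * enorm w)).
have spos : 0 < s by rewrite lt_min !divr_gt0// mulr_gt0.
have s1 : s <= s0 / 2 by rewrite ge_min lexx.
have s2 : s * enorm w <= r / 2.
  have : s <= r / (2 * enorm w) by rewrite ge_min lexx orbT.
  by rewrite ler_pdivlMr ?mulr_gt0//; lra.
exists (b + s *: w); rewrite [b + _]addrC addrK enormZ gtr0_norm//.
split; [by rewrite addrC; apply: hs; lra|by lra|].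
have -> : (s * enorm w)^-1 *: (s *: w) - xi = ((enorm w)^-1 - 1) *: w + (w - xi).
  by apply/rowP => i; rewrite !mxE; field; rewrite !gt_eqF.
apply: le_lt_trans (enormD _ _) _; rewrite enormZ wxi.
have -> : `|(enorm w)^-1 - 1| * enorm w = `|1 - enorm w|.
  rewrite -[X in _ * X](gtr0_norm wpos) -normrM; congr `| _ |.
  by field; rewrite gt_eqF.
have : `|1 - enorm w| <= t * enorm g by rewrite ler_norml; apply/andP; split; lra.
lra.
Qed.

Lemma compact_dirs b : compact (dirs b).
Proof.
have cE : closed E by apply: compact_closed => //; exact: norm_hausdorff.
apply: (@compact_enorm _ _ 1) => [|q [/enorm_unit ->]//].
apply/closed_enormP => z hz; split.
  apply: ((closed_enormP _).1 (compact_closed (@norm_hausdorff _ _) compact_unit_circle)).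
  by move=> r r0; have [a [? _] ?] := hz r r0; exists a.
apply: ((closed_enormP E).1 cE) => r r0.
have [|a [_ Ea] az] := hz (r / eps); first by rewrite divr_gt0.
exists (b + eps *: a) => //.
have -> : b + eps *: a - (b + eps *: z) = eps *: (a - z).
  by apply/rowP => i; rewrite !mxE; ring.
by rewrite enormZ gtr0_norm// mulrC -ltr_pdivlMr.
Qed.

Lemma ex_max_edot b v : A b -> ~ U b ->
  exists2 c, dirs b c & forall c', dirs b c' -> edot c' v <= edot c v.
Proof.
move=> Ab Ub; have [c0 bc0] := dirs_neq0 cptE eps_gt0 Ab Ub.
have [||c] := @compact_EVT_max _ _ (fun c => edot c v) _ _ (@compact_dirs b).
- by exists c0.
- apply/continuous_subspaceT/continuous_enorm => x r r0.
  have n0 : 0 < enorm v + 1 by have := enorm_ge0 v; lra.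
  exists (r / (enorm v + 1)) => [|y]; first by rewrite divr_gt0.
  rewrite ltr_pdivlMr// => yx; rewrite ltr_norml /=.
  have := edot_le (y - x) v; have := edot_le (x - y) v.
  rewrite !edotBl (enormBC x y).
  by have := enorm_ge0 (y - x); lra.
rewrite inE => bc hc; exists c => // c' bc'.
by apply: hc; rewrite inE.
Qed.

(** On the half circle f <= 0 the coordinate g is monotone in the angle, so its order decides the
    sign of the cross product. *)
Lemma half_circle_cross (f g f1 g1 : R) : f <= 0 -> f1 <= 0 ->
  f * f + g * g = 1 -> f1 * f1 + g1 * g1 = 1 -> g <= g1 -> g1 * f <= f1 * g.
Proof.
move=> f0 f10 h h1 gg.
have [k|k] := lerP 0 g.
  have : f1 * f1 <= f * f by nra.
  move=> k1; have k2 : f <= f1 by nra.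
  have : g1 * f <= g * f by rewrite ler_wnM2r.
  have : g * f <= g * f1 by rewrite ler_wpM2l.
  lra.
have [k'|k'] := lerP 0 g1.
  have : g1 * f <= 0 by rewrite mulr_ge0_le0.
  have : 0 <= f1 * g by rewrite mulr_le0// ltW.
  lra.
have : f * f <= f1 * f1 by nra.
move=> k1; have k2 : f1 <= f by nra.
have : g1 * f <= g1 * f1 by rewrite ler_wnM2l// ltW.
have : g1 * f1 <= g * f1 by rewrite ler_wnM2r.
lra.
Qed.

(** Since f f' >= 0, one of g, g' is at least 1 - k and the other at most -(1 - k); so are then g1
    and g2. The factor 4 comes from 1 - 2 (1 - k)^2 <= -1 + 4 k. *)
Lemma half_circle_spread (k f f' g g' f1 g1 f2 g2 : R) :
  f <= 0 -> f' <= 0 -> f * f + g * g = 1 -> f' * f' + g' * g' = 1 ->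
  f1 * f1 + g1 * g1 = 1 -> f2 * f2 + g2 * g2 = 1 ->
  g <= g1 -> g' <= g1 -> g2 <= g -> g2 <= g' ->
  f * f' + g * g' <= -1 + k -> f1 * f2 + g1 * g2 <= -1 + 4 * k.
Proof.
move=> f0 f0' h h' h1 h2 a1 a2 a3 a4 hk.
have ff : 0 <= f * f' by rewrite mulr_le0.
have d12 : f1 * f2 + g1 * g2 <= 1.
  by have := sqr_ge0 (f1 - f2); have := sqr_ge0 (g1 - g2); lra.
have [k1|k1] := lerP 1 k; first by lra.
have k0 : 0 <= k by nra.
have [G1 G2] : 1 - k <= g1 /\ g2 <= - (1 - k).
  have [p|p] := lerP 0 g.
    have q : g' <= 0 by nra.
    have : g <= 1 by nra.
    have : -1 <= g' by nra.
    by split; nra.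
  have q : 0 <= g' by nra.
  have : -1 <= g by nra.
  have : g' <= 1 by nra.
  by split; nra.
have F1 : f1 * f1 <= 1 - (1 - k) * (1 - k) by nra.
have F2 : f2 * f2 <= 1 - (1 - k) * (1 - k) by nra.
have F : f1 * f2 <= 1 - (1 - k) * (1 - k) by have := sqr_ge0 (f1 - f2); lra.
have G : g1 * g2 <= - ((1 - k) * (1 - k)).
  by rewrite -lerN2 opprK -mulrN; apply: ler_pM; lra.
have := sqr_ge0 k; lra.
Qed.

End Chains.

(** * The extremal contributors of a boundary point *)

Section ExtremalContributors.
Context {R : realType}.
Variables (E : set 'rV[R]_2) (eps : R).
Hypotheses (cptE : compact E) (eps_gt0 : 0 < eps).
Implicit Types (a b c h p q u v w x y z e : 'rV[R]_2) (r s t : R).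

Local Notation U := (outer E eps).
Local Notation A := (outer_closure E eps).
Local Notation dirs := (dirs E eps).
Local Notation outward := (outward E eps).

Lemma half_circle_antipodal (f1 g1 f2 g2 : R) : f1 <= 0 -> f2 <= 0 ->
  f1 * f1 + g1 * g1 = 1 -> f2 * f2 + g2 * g2 = 1 -> g2 <= g1 ->
  f1 * f2 + g1 * g2 = -1 -> [/\ f1 = 0, f2 = 0, g1 = 1 & g2 = -1].
Proof.
move=> f10 f20 u1 u2 g12 d.
have sq : (f1 + f2) ^+ 2 + (g1 + g2) ^+ 2 = 0.
  have -> : (f1 + f2) ^+ 2 + (g1 + g2) ^+ 2 = (f1 * f1 + g1 * g1) + (f2 * f2 + g2 * g2)
      + 2 * (f1 * f2 + g1 * g2) by ring.
  by rewrite u1 u2 d; ring.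
have fs : f1 + f2 = 0.
  apply/eqP; rewrite -sqrf_eq0 eq_le sqr_ge0 andbT.
  by have := sqr_ge0 (g1 + g2); lra.
have gs : g1 + g2 = 0.
  by apply/eqP; rewrite -sqrf_eq0; rewrite fs expr0n /= add0r in sq; apply/eqP.
have f1E : f1 = 0 by lra.
have g1E : g1 = 1 by rewrite f1E in u1; nra.
by split; lra.
Qed.

Lemma unit_parallel (f1 g1 f2 g2 : R) :
  f1 * f1 + g1 * g1 = 1 -> f2 * f2 + g2 * g2 = 1 -> f1 * g2 - g1 * f2 = 0 ->
  0 < 1 + (f1 * f2 + g1 * g2) -> f1 = f2 /\ g1 = g2.
Proof.
move=> u1 u2 X0 d.
have dE : f1 * f2 + g1 * g2 = 1.
  have sq : (f1 * f2 + g1 * g2) ^+ 2 = 1.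
    transitivity ((f1 * f1 + g1 * g1) * (f2 * f2 + g2 * g2) - (f1 * g2 - g1 * f2) ^+ 2).
      by ring.
    by rewrite u1 u2 X0 expr0n /= subr0 mulr1.
  by nra.
have sq : (f1 - f2) ^+ 2 + (g1 - g2) ^+ 2 = 0.
  transitivity ((f1 * f1 + g1 * g1) + (f2 * f2 + g2 * g2) - 2 * (f1 * f2 + g1 * g2)).
    by ring.
  by rewrite u1 u2 dE; ring.
have f12 : f1 - f2 = 0.
  apply/eqP; rewrite -sqrf_eq0 eq_le sqr_ge0 andbT.
  by have := sqr_ge0 (g1 - g2); lra.
have g12 : g1 - g2 = 0.
  by apply/eqP; rewrite -sqrf_eq0; rewrite f12 expr0n /= add0r in sq; apply/eqP.
by split; apply/eqP; rewrite -subr_eq0; apply/eqP.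
Qed.

Definition ext_dirs b := [set c | dirs b c /\ exists2 xi, outward b xi & edot c xi = 0].

(* Seen from an outward direction, the contributors lie on a closed half circle; the two
   outermost ones are the extremal ones. *)
Lemma ext_dirsP b : A b -> ~ U b -> exists c1 c2, [/\ dirs b c1, dirs b c2,
  ext_dirs b = [set c1; c2] &
  forall c c' (k : R), dirs b c -> dirs b c' -> edot c c' <= -1 + k ->
    edot c1 c2 <= -1 + 4 * k].
Proof.
move=> Ab Ub; have [x0 ox0] := ex_outward Ab Ub.
have x01 : edot x0 x0 = 1 by case/outwardP: ox0.
have fr := orthoframe_rot90 x01; set v := rot90 x0 in fr.
have [c1 bc1 max] := ex_max_edot cptE eps_gt0 v Ab Ub.
have [c2 bc2 min'] := ex_max_edot cptE eps_gt0 (- v) Ab Ub.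
have min c : dirs b c -> edot c2 v <= edot c v.
  by move=> /min'; rewrite !edotNr lerN2.
have hf c : dirs b c -> edot c x0 <= 0 := outward_edot cptE eps_gt0 ox0.
have hu c : dirs b c -> edot c x0 * edot c x0 + edot c v * edot c v = 1.
  by move=> [c11 _]; rewrite -(edot_frame c c fr).
have spread c c' (k : R) : dirs b c -> dirs b c' -> edot c c' <= -1 + k ->
    edot c1 c2 <= -1 + 4 * k.
  move=> bc bc'; rewrite (edot_frame c c' fr) (edot_frame c1 c2 fr).
  by apply: half_circle_spread; rewrite ?hu ?hf ?max ?min.
exists c1, c2; split=> //.
set f1 := edot c1 x0; set g1 := edot c1 v; set f2 := edot c2 x0; set g2 := edot c2 v.
have f1le := hf c1 bc1; have f2le := hf c2 bc2.
have u1 := hu c1 bc1; have u2 := hu c2 bc2; have g12 := min c1 bc1.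
rewrite -/f1 -/g1 -/f2 -/g2 in f1le f2le u1 u2 g12.
have inj c c' : edot c x0 = edot c' x0 -> edot c v = edot c' v -> c = c'.
  by move=> h1 h2; apply: (frame_inj fr).
have [_ v1 _] := fr.
(* The antipodal case is separate because there c1 + c2, used below to push b into U, vanishes. The
   outward directions are then among x0 and - x0. *)
have [d|d] := eqVneq (edot c1 c2) (-1).
  have [f10 f20 g1E g2E] : [/\ f1 = 0, f2 = 0, g1 = 1 & g2 = -1].
    apply: half_circle_antipodal f1le f2le u1 u2 g12 _.
    by rewrite -(edot_frame c1 c2 fr).
  apply/seteqP; split=> [c [bc [xi oxi cxi]]|c].
    have xiv : edot xi v = 0.
      have h1 := outward_edot cptE eps_gt0 oxi bc1.
      have h2 := outward_edot cptE eps_gt0 oxi bc2.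
      move: h1 h2; rewrite !(edot_frame _ xi fr) -/f1 -/f2 -/g1 -/g2 f10 f20 g1E g2E; lra.
    have xi1 : edot xi xi = 1 by case/outwardP: oxi.
    have c0 : edot c x0 = 0.
      rewrite (edot_frame c xi fr) xiv in cxi; rewrite (edot_frame xi xi fr) xiv in xi1.
      have m0 : edot xi x0 != 0 by apply/eqP => h; rewrite h in xi1; lra.
      by apply: (mulIf m0); rewrite mul0r; lra.
    have := hu c bc; rewrite c0 mul0r add0r => cv.
    have : (edot c v - 1) * (edot c v + 1) = 0.
      by transitivity (edot c v * edot c v - 1); [ring|rewrite cv subrr].
    move/eqP; rewrite mulf_eq0 => /orP[] /eqP k; [left|right]; apply: inj.
    - by rewrite -/f1 f10.
    - by rewrite -/g1 g1E; lra.
    - by rewrite -/f2 f20.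
    - by rewrite -/g2 g2E; lra.
  by case=> ->; split=> //; exists x0.
have dot_gt : 0 < 1 + edot c1 c2.
  rewrite lt_neqAle eq_sym; apply/andP; split.
    by rewrite addrC addr_eq0.
  have : 0 <= edot (c1 + c2) (c1 + c2) := edot_ge0 _.
  rewrite edotDl !edotDr (edotC c2 c1); case: bc1 => -> _; case: bc2 => -> _; lra.
(* Cramer's rule: X c = al c * c1 + be c * c2, with cross products as coefficients. Their signs put
   every contributor in the convex cone spanned by c1 and c2. *)
pose X := f1 * g2 - g1 * f2.
pose al c := edot c x0 * g2 - edot c v * f2.
pose be c := f1 * edot c v - g1 * edot c x0.
have al0 c : dirs b c -> 0 <= al c.
  move=> bc; rewrite subr_ge0; apply: half_circle_cross => //; [exact: hf|exact: hu|exact: min].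
have be0 c : dirs b c -> 0 <= be c.
  move=> bc; rewrite subr_ge0; apply: half_circle_cross => //; [exact: hf|exact: hu|exact: max].
have X0 : 0 <= X by exact: (al0 c1 bc1).
have comb c w : X * edot c w = al c * edot c1 w + be c * edot c2 w.
  by rewrite !(edot_frame _ w fr) -/f1 -/f2 -/g1 -/g2 /X /al /be; ring.
have degenerate : X = 0 -> forall c, dirs b c -> c = c1.
  move=> X0' c bc.
  have [f12' g12'] : f1 = f2 /\ g1 = g2.
    by apply: unit_parallel u1 u2 X0' _; rewrite -(edot_frame c1 c2 fr).
  have cv : edot c v = g1.
    by apply/eqP; rewrite eq_le max// {1}g12' min.
  apply: inj => //.
  have := hu c bc; rewrite cv; have := hf c bc; rewrite -/f1 -u1 => h1 h2.
  nra.
have push c : dirs b c -> edot (- (c1 + c2)) c < 0.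
  move=> bc; rewrite edotNl oppr_lt0 edotDl.
  have [X1|X1] := ltrP 0 X; last first.
    have X00 : X = 0 by lra.
    rewrite (degenerate X00 c bc) (degenerate X00 c2 bc2).
    by case: bc1 => -> _.
  have cc1 := comb c c1; have cc2 := comb c c2.
  have k : X * (edot c1 c + edot c2 c) = (al c + be c) * (1 + edot c1 c2).
    rewrite (edotC c1) (edotC c2) mulrDr cc1 cc2 (edotC c2 c1).
    by case: bc1 => -> _; case: bc2 => -> _; ring.
  rewrite -(pmulr_rgt0 _ X1) k mulr_gt0//.
  rewrite lt_neqAle addr_ge0 ?al0 ?be0// andbT eq_sym; apply/eqP => s0.
  have a0 : al c = 0 by have := al0 c bc; have := be0 c bc; lra.
  have b0 : be c = 0 by have := al0 c bc; have := be0 c bc; lra.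
  have := comb c c; rewrite a0 b0 !mul0r addr0.
  by case: bc => -> _; rewrite mulr1; lra.
(* Quarter turns of c1 and c2, oriented so that <xi1, c> = - be c and <xi2, c> = - al c. *)
pose xi1 := g1 *: x0 - f1 *: v.
pose xi2 := - g2 *: x0 + f2 *: v.
have e10 : edot x0 v = 0 by case: fr.
have oxi1 : outward b xi1.
  apply: (outward_push cptE eps_gt0 (g := - (c1 + c2)) Ab) => [|c bc|//].
    by rewrite !edotE (edotC v x0) e10 x01 v1; lra.
  have := be0 c bc; rewrite /be /xi1 !edotE (edotC x0) (edotC v); lra.
have oxi2 : outward b xi2.
  apply: (outward_push cptE eps_gt0 (g := - (c1 + c2)) Ab) => [|c bc|//].
    by rewrite !edotE (edotC v x0) e10 x01 v1; lra.
  have := al0 c bc; rewrite /al /xi2 !edotE (edotC x0) (edotC v); lra.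
apply/seteqP; split=> [c [bc [xi oxi cxi]]|c]; last first.
  case=> ->; split=> //.
    by exists xi1 => //; rewrite /xi1 !edotE -/f1 -/g1; ring.
  by exists xi2 => //; rewrite /xi2 !edotE -/f2 -/g2; ring.
have [X1|X1] := ltrP 0 X; last by left; apply: degenerate => //; lra.
have p1 := outward_edot cptE eps_gt0 oxi bc1.
have p2 := outward_edot cptE eps_gt0 oxi bc2.
have := comb c xi; rewrite cxi mulr0 => cb.
have xi1' : edot xi xi = 1 by case/outwardP: oxi.
have unit_eq c0 (m : R) : dirs b c -> edot c0 c0 = 1 -> 0 <= m ->
    (forall w, X * edot c w = m * edot c0 w) -> c = c0.
  move=> [cc _] c01 m0 hm.
  have XE : X ^+ 2 = m ^+ 2.
    have e1 := hm c; have e2 := hm c0; rewrite cc c01 !mulr1 in e1 e2.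
    have h1 : X * X = X * (m * edot c0 c) by rewrite -e1.
    have h2 : m * (X * edot c0 c) = m * m by rewrite (edotC c0 c) e2.
    by rewrite !expr2 h1 -h2; ring.
  have Xm : X = m by apply/eqP; rewrite -(@eqrXn2 _ 2)// XE.
  by apply: inj; apply: (mulfI (lt0r_neq0 X1)); rewrite hm Xm.
have a0 := al0 c bc; have b0 := be0 c bc.
(* If a coefficient vanishes, c is c1 or c2. If both are positive, xi is orthogonal to c1 and to c2,
   which are independent as X > 0, so xi would vanish. *)
have [a1|a1] := ltrP 0 (al c); last first.
  right; apply: (unit_eq c2 (be c)) => //; first by case: bc2.
  by move=> w; rewrite comb (_ : al c = 0) ?mul0r ?add0r//; lra.
have [b1|b1] := ltrP 0 (be c); last first.
  left; apply: (unit_eq c1 (al c)) => //; first by case: bc1.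
  by move=> w; rewrite comb (_ : be c = 0) ?mul0r ?addr0//; lra.
have q1 : edot c1 xi = 0 by nra.
have q2 : edot c2 xi = 0 by nra.
rewrite !(edot_frame _ xi fr) -/f1 -/g1 -/f2 -/g2 in q1 q2.
have m0 : edot xi x0 = 0.
  apply: (mulfI (lt0r_neq0 X1)); rewrite mulr0.
  transitivity (g2 * (f1 * edot xi x0 + g1 * edot xi v)
    - g1 * (f2 * edot xi x0 + g2 * edot xi v)); first by rewrite /X; ring.
  by rewrite q1 q2; ring.
have n0 : edot xi v = 0.
  apply: (mulfI (lt0r_neq0 X1)); rewrite mulr0.
  transitivity (f1 * (f2 * edot xi x0 + g2 * edot xi v)
    - f2 * (f1 * edot xi x0 + g1 * edot xi v)); first by rewrite /X; ring.
  by rewrite q1 q2; ring.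
by move: xi1'; rewrite (edot_frame xi xi fr) m0 n0; lra.
Qed.

End ExtremalContributors.

(** * Chains from nearly opposite contributors *)

Section ChainConstruction.
Context {R : realType}.
Variables (E : set 'rV[R]_2) (eps : R).
Hypotheses (cptE : compact E) (eps_gt0 : 0 < eps).
Implicit Types (a b c h p q u v w x y z e : 'rV[R]_2) (r s t : R).

Local Notation U := (outer E eps).
Local Notation A := (outer_closure E eps).
Local Notation dirs := (dirs E eps).

Lemma two_dirs_singularity b c c' : A b -> dirs b c -> dirs b c' -> c <> c' ->
  singularities E eps b.
Proof.
move=> Ab bc bc' cc'; split.
  by apply/boundary_offsetP; split=> //; exact: (dirs_not_outer cptE eps_gt0 bc).
move=> [bb [r r0 hr]].
have [|_ [y hy]] := hr b.
  by split=> //; rewrite /eball /= subrr enorm0.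
have : [set y] (b + eps *: c) by rewrite -hy; apply/contributorsP => //; exists c.
have : [set y] (b + eps *: c') by rewrite -hy; apply/contributorsP => //; exists c'.
move=> /= <- /addrI /(congr1 (fun w => eps^-1 *: w)).
by rewrite !scalerA mulVf ?gt_eqF// !scale1r.
Qed.

Lemma ext_contributors_dirs b c1 c2 : A b -> ext_dirs E eps b = [set c1; c2] ->
  ext_contributors E eps b = [set b + eps *: c1; b + eps *: c2].
Proof.
move=> Ab h; have ext c : dirs b c -> forall xi,
    edot (b + eps *: c - b) xi = 0 <-> edot c xi = 0.
  move=> bc xi; rewrite addrC addKr edotZl; split=> [|->]; last by rewrite mulr0.
  by move/eqP; rewrite mulf_eq0 gt_eqF//= => /eqP.
have sub c : ext_dirs E eps b c -> ext_contributors E eps b (b + eps *: c).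
  move=> [bc [xi oxi cxi]]; split; first by apply/contributorsP => //; exists c.
  by exists xi => //; apply/ext.
apply/seteqP; split=> [y [/(contributorsP cptE eps_gt0 _ Ab)[c bc ->] [xi oxi]]|y].
  move=> /(ext c bc xi) cxi.
  have : ext_dirs E eps b c by split=> //; exists xi.
  by rewrite h => -[->|->]; [left|right].
by case=> ->; apply: sub; rewrite h; [left|right].
Qed.

(** The nearly opposite contributors need not be extremal; [ext_dirsP] replaces them by the extremal
    ones at the cost of a factor 4. *)
Lemma chain_inI (S : set 'rV[R]_2) x :
  (forall r, 0 < r -> exists b c c', [/\ A b, S b, enorm (b - x) < r, dirs b c &
     dirs b c' /\ edot c c' <= -1 + r]) -> chain_in E eps S x.
Proof.
move=> h.
have /choice[f hf] : forall n : nat, exists f : 'rV[R]_2 * 'rV[R]_2 * 'rV[R]_2,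
    [/\ S f.1.1, singularities E eps f.1.1, enorm (f.1.1 - x) < n.+1%:R^-1,
      ext_contributors E eps f.1.1 = [set f.1.1 + eps *: f.1.2; f.1.1 + eps *: f.2] &
      -1 <= edot f.1.2 f.2 <= -1 + 4 * n.+1%:R^-1].
  move=> n; have [|b [c [c' [Ab Sb bx bc [bc' cc']]]]] := h n.+1%:R^-1.
    by rewrite invr_gt0.
  have Ub := dirs_not_outer cptE eps_gt0 bc.
  have [c1 [c2 [bc1 bc2 hext hk]]] := ext_dirsP cptE eps_gt0 Ab Ub.
  exists (b, c1, c2); split=> //=.
  - apply: (two_dirs_singularity Ab bc bc') => e; move: cc'; rewrite -e bc.1.
    have n1 : n.+1%:R^-1 <= 1 :> R by rewrite invf_le1// ler1n.
    by move: (n.+1%:R^-1) n1 => i n1 ?; lra.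
  - exact: ext_contributors_dirs.
  - rewrite (hk c c')// andbT; have := edot_ge0 (c1 + c2).
    rewrite edotDl !edotDr (edotC c2 c1).
    by case: bc1 => -> _; case: bc2 => -> _; lra.
exists (fun n => (f n).1.1); split.
- by move=> n; have [] := hf n.
- apply/cvg_enormP => r r0; have [N hN] := ex_invSn_lt r0.
  by exists N => n Nn; have [_ _ h1 _ _] := hf n; apply: lt_trans h1 (hN n Nn).
- exists (fun n => (f n).1.1 + eps *: (f n).1.2), (fun n => (f n).1.1 + eps *: (f n).2).
  split; first by move=> n; have [] := hf n.
  apply/cvgrPdist_lt => r r0.
  have [|N hN] := @ex_invSn_lt R (r / 4); first by rewrite divr_gt0.
  exists N => // n /= Nn; have [_ _ _ _ /andP[h1 h2]] := hf n.
  rewrite ![_.1.1 + _]addrC !addrK !scalerA mulVf ?gt_eqF// !scale1r.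
  rewrite ltr_norml; move: (hN n Nn) h1 h2; move: (n.+1%:R^-1) (edot _ _) => i d h3 h1 h2.
  by apply/andP; split; lra.
Qed.

(* On the side e of x, the balls about two contributors of b nearly close the passage between
   the balls about x + eps v and x - eps v. *)
Definition pinched x v e (r : R) b := [/\ A b, enorm (b - x) < r, 0 < edot (b - x) e &
  exists c c', [/\ dirs b c, dirs b c', 1 - r < edot c v & edot c' v < -1 + r]].

(** By the parallelogram law, 2 + 2 <c, c'> = |c + c'|^2 is at most 2 |c - v|^2 + 2 |c' + v|^2. *)
Lemma nearly_opposite c c' v (r : R) : edot c c = 1 -> edot c' c' = 1 -> edot v v = 1 ->
  1 - r < edot c v -> edot c' v < -1 + r -> edot c c' <= -1 + 4 * r.
Proof.
move=> c1 c1' v1 cv cv'.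
have h1 : edot (c - v) (c - v) < 2 * r.
  by rewrite edotBl !edotBr c1 v1 (edotC v); lra.
have h2 : edot (c' + v) (c' + v) < 2 * r.
  by rewrite edotDl !edotDr c1' v1 (edotC v); lra.
have h3 : edot (c + c') (c + c') = 2 * edot (c - v) (c - v) + 2 * edot (c' + v) (c' + v)
    - edot ((c - v) - (c' + v)) ((c - v) - (c' + v)).
  by rewrite !edot2 !mxE; ring.
have := edot_ge0 ((c - v) - (c' + v)).
have : edot (c + c') (c + c') = 2 + 2 * edot c c'.
  by rewrite edotDl !edotDr c1 c1' (edotC c'); ring.
lra.
Qed.

Lemma pinched_chain x v e (S : set 'rV[R]_2) : edot v v = 1 ->
  (forall r, 0 < r -> exists2 b, pinched x v e r b & S b) -> chain_in E eps S x.
Proof.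
move=> v1 h; apply: chain_inI => r r0.
have [|b [Ab bx be [c [c' [bc bc' cv cv']]]] Sb] := h (r / 4); first by rewrite divr_gt0.
exists b, c, c'; split=> //; first by lra.
split=> //; have := nearly_opposite _ _ v1 cv cv'.
by move/(_ bc.1 bc'.1); lra.
Qed.

End ChainConstruction.

(** * Circular arcs about x inside the lune *)

Section Lune.
Context {R : realType}.
Variables (E : set 'rV[R]_2) (eps : R).
Hypotheses (cptE : compact E) (eps_gt0 : 0 < eps).
Implicit Types (a b c h p q u v w x y z e : 'rV[R]_2) (r s t d k : R).

Local Notation U := (outer E eps).
Local Notation A := (outer_closure E eps).
Local Notation dirs := (dirs E eps).

Definition cone x e v : set 'rV[R]_2 := [set z | `|edot (z - x) v| <= edot (z - x) e].

(** The part of the offset due to points of E near x + eps v. The tolerance k is what upper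
    semicontinuity of the contributors can provide, and the weak inequalities make the set
    closed. *)
Definition covered x v k : set 'rV[R]_2 :=
  [set z | exists y, [/\ E y, enorm (y - (x + eps *: v)) <= k & enorm (z - y) <= eps]].

Lemma cone_opp x e v : cone x e (- v) = cone x e v.
Proof. by apply/seteqP; split=> z; rewrite /cone /= edotNr normrN. Qed.

Lemma closed_cone x e v : edot e e = 1 -> edot v v = 1 -> closed (cone x e v).
Proof.
move=> /enorm_unit e1 /enorm_unit v1; apply/closed_enormP => z hz.
rewrite /cone /= leNgt; apply/negP => lt.
have [|a /= ha az] := hz ((`|edot (z - x) v| - edot (z - x) e) / 2).
  by rewrite divr_gt0// subr_gt0.
have h1 := enorm_normr_le (a - z) v1; have h2 := enorm_normr_le (a - z) e1.
rewrite /cone /= in ha.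
have h3 : edot (z - x) v = edot (a - x) v - edot (a - z) v by rewrite !edotE; ring.
have h4 : edot (a - z) e = edot (a - x) e - edot (z - x) e by rewrite !edotE; ring.
have h5 := ler_normB (edot (a - x) v) (edot (a - z) v).
have := ler_norm (edot (a - z) e); rewrite h3 in lt az *; lra.
Qed.

Lemma closed_covered x v k : closed (covered x v k).
Proof.
apply/closed_enormP => z hz.
have [r r0|y Ey cl] := @compact_cluster _ E (fun r y =>
    enorm (y - (x + eps *: v)) <= k /\ enorm (z - y) <= eps + r) cptE.
  have [a [y [Ey yk ay]] az] := hz r r0; exists y => //; split=> //.
  by have := enormB_le a z y; have := enormBC a z; lra.
exists y; split=> //; rewrite leNgt; apply/negP => lt.
  have [|s [p [_ _ [pk _] py]]] := cl (enorm (y - (x + eps *: v)) - k).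
    by rewrite subr_gt0.
  by have := enormB_le p y (x + eps *: v); have := enormBC p y; lra.
have [|s [p [/andP[_ sr] _ [_ pk] py]]] := cl ((enorm (z - y) - eps) / 2).
  by rewrite divr_gt0// subr_gt0.
by have := enormB_le p z y; lra.
Qed.

(** Inside the cone of half-angle 45 degrees, the e-coordinate changes along the circle no faster
    than the v-coordinate, while y - x has v-part at least 3/4 eps and e-part at most eps / 4.
    Moving towards v hence approaches y. *)
Lemma arc_closer x e v y z z' : orthoframe e v ->
  enorm (y - (x + eps *: v)) <= eps / 4 -> cone x e v z -> cone x e v z' ->
  enorm (z - x) = enorm (z' - x) -> edot (z - x) v < edot (z' - x) v ->
  enorm (z - y) <= eps -> enorm (z' - y) < eps.
Proof.
move=> fr yk; rewrite /cone /= => cz cz' zz' lt; apply: lt_le_trans.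
have [/enorm_unit e1 /enorm_unit v1 ev] := fr.
rewrite enorm_sqr_lt.
have h1 := enorm_normr_le (y - (x + eps *: v)) e1.
have h2 := enorm_normr_le (y - (x + eps *: v)) v1.
have y0 : edot (y - (x + eps *: v)) e = edot (y - x) e.
  rewrite opprD addrA [LHS]edotBl edotZl (edotC v e) ev; ring.
have y1 : edot (y - (x + eps *: v)) v = edot (y - x) v - eps.
  by rewrite opprD addrA [LHS]edotBl edotZl; case: fr => _ -> _; ring.
rewrite y0 in h1; rewrite y1 in h2.
have zz2 : edot (z - x) (z - x) = edot (z' - x) (z' - x) by rewrite -!sqr_enorm zz'.
have -> : edot (z' - y) (z' - y) = edot (z' - x) (z' - x) + edot (y - x) (y - x)
    - 2 * edot (z' - x) (y - x) by rewrite !edot2 !mxE; ring.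
have -> : edot (z - y) (z - y) = edot (z - x) (z - x) + edot (y - x) (y - x)
    - 2 * edot (z - x) (y - x) by rewrite !edot2 !mxE; ring.
rewrite !(edot_frame _ (y - x) fr) zz2.
move: zz2; rewrite (edot_frame (z - x) (z - x) fr) (edot_frame (z' - x) (z' - x) fr).
move: cz cz' lt h1 h2; rewrite !ler_norml.
move: (edot (z - x) e) (edot (z - x) v) (edot (z' - x) e) (edot (z' - x) v).
move=> q s q' s' cz cz' ss' h1 h2 E1.
move: h1 h2; move: (edot (y - x) e) (edot (y - x) v) => f g h1 h2.
have qq : 0 < q + q' by lra.
have k1 : (q' - q) * (q' + q) = - (s' - s) * (s' + s) by lra.
have k2 : q' - q <= s' - s.
  rewrite -(ler_pM2r qq) addrC [X in X <= _](_ : _ = - (s' - s) * (s' + s)); last by rewrite -k1; ring.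
  have : (s' - s) * (q + q' + s' + s) >= 0 by rewrite mulr_ge0; lra.
  lra.
have k3 : - (s' - s) <= q' - q.
  rewrite -(ler_pM2r qq) addrC [X in _ <= X](_ : _ = - (s' - s) * (s' + s)); last by rewrite -k1; ring.
  have : (s' - s) * (q + q' - s' - s) >= 0 by rewrite mulr_ge0; lra.
  lra.
have k4 : - ((s' - s) * (eps / 4)) <= (q' - q) * f.
  have : `|(q' - q) * f| <= (s' - s) * (eps / 4).
    rewrite normrM; apply: ler_pM => //; rewrite ler_norml; apply/andP; split; lra.
  by rewrite ler_norml => /andP[].
have k5 : (s' - s) * (3 / 4 * eps) <= (s' - s) * g by rewrite ler_pM2l; lra.
have : 0 < (s' - s) * eps by rewrite mulr_gt0//; lra.
lra.
Qed.

(** The circle of radius r about x, parametrized by the v-coordinate instead of the angle; for |s|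
    <= r / 2 it stays in [cone] and is Lipschitz in s. *)
Definition arcpt x e v r s := x + Num.sqrt (r ^+ 2 - s ^+ 2) *: e + s *: v.

Lemma arcpt_coord x e v r s : orthoframe e v ->
  edot (arcpt x e v r s - x) e = Num.sqrt (r ^+ 2 - s ^+ 2) /\
  edot (arcpt x e v r s - x) v = s.
Proof.
move=> [e1 v1 ev]; have -> : arcpt x e v r s - x = Num.sqrt (r ^+ 2 - s ^+ 2) *: e + s *: v.
  by apply/rowP => i; rewrite !mxE; ring.
by rewrite !edotDl !edotZl e1 v1 (edotC v e) ev; split; ring.
Qed.

Lemma arcpt_norm x e v r s : orthoframe e v -> 0 <= r -> `|s| <= r / 2 ->
  enorm (arcpt x e v r s - x) = r /\ cone x e v (arcpt x e v r s).
Proof.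
move=> fr r0 sr; have [h1 h2] := arcpt_coord x r s fr.
have s2 : 4 * s ^+ 2 <= r ^+ 2.
  have -> : 4 * s ^+ 2 = (2 * `|s|) ^+ 2 by rewrite exprMn real_normK ?num_real//; ring.
  by rewrite ler_pXn2r ?nnegrE ?mulr_ge0//; lra.
have s0 := sqr_ge0 s.
have rs0 : 0 <= r ^+ 2 - s ^+ 2 by lra.
split; last first.
  rewrite /cone /= h1 h2 -sqrtr_sqr ler_sqrt; lra.
apply/eqP; rewrite -(@eqrXn2 _ 2) ?enorm_ge0// sqr_enorm (edot_frame _ _ fr) h1 h2.
by rewrite -!expr2 sqr_sqrtr// subrK.
Qed.

Lemma arcpt_eq x e v z : orthoframe e v -> 0 <= edot (z - x) e ->
  arcpt x e v (enorm (z - x)) (edot (z - x) v) = z.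
Proof.
move=> fr z0; have [h1 h2] := arcpt_coord x (enorm (z - x)) (edot (z - x) v) fr.
apply: (addIr (- x)); apply: (frame_inj fr); rewrite ?h1 ?h2//.
by rewrite sqr_enorm (edot_frame (z - x) _ fr) -!expr2 addrK sqrtr_sqr ger0_norm.
Qed.

Lemma arcpt_lipschitz x e v r s s' : orthoframe e v -> 0 <= r ->
  `|s| <= r / 2 -> `|s'| <= r / 2 ->
  enorm (arcpt x e v r s - arcpt x e v r s') <= 2 * `|s - s'|.
Proof.
move=> fr r0 sr sr'; have [h1 h2] := arcpt_coord x r s fr.
have [h1' h2'] := arcpt_coord x r s' fr.
have [_ c] := arcpt_norm x fr r0 sr; have [_ c'] := arcpt_norm x fr r0 sr'.
have [n _] := arcpt_norm x fr r0 sr; have [n' _] := arcpt_norm x fr r0 sr'.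
rewrite enorm_le_sqr ?mulr_ge0//.
have -> : arcpt x e v r s - arcpt x e v r s' = (arcpt x e v r s - x) - (arcpt x e v r s' - x).
  by apply/rowP => i; rewrite !mxE; ring.
rewrite (edot_frame _ _ fr) ![edot (_ - x - _) _]edotBl h2 h2'.
have E1 : enorm (arcpt x e v r s - x) ^+ 2 = enorm (arcpt x e v r s' - x) ^+ 2.
  by rewrite n n'.
rewrite !sqr_enorm (edot_frame (arcpt x e v r s - x) _ fr) in E1.
rewrite (edot_frame (arcpt x e v r s' - x) (arcpt x e v r s' - x) fr) h2 h2' in E1.
rewrite /cone /= h2 in c; rewrite /cone /= h2' in c'.
rewrite exprMn real_normK ?num_real//.
move: (edot (arcpt x e v r s - x) e) (edot (arcpt x e v r s' - x) e) c c' E1 => q q'.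
rewrite !ler_norml => /andP[c1 c2] /andP[c1' c2'] E1.
have k : (q - q') ^+ 2 <= (s - s') ^+ 2.
  have [qq|qq] := ltrP 0 (q + q'); last first.
    have [-> ->] : q = 0 /\ q' = 0 by split; lra.
    by rewrite subrr expr0n /= sqr_ge0.
  have qq2 : 0 < (q + q') ^+ 2 by rewrite exprn_gt0.
  rewrite -(ler_pM2r qq2) -exprMn.
  have -> : (q - q') * (q + q') = - ((s - s') * (s + s')).
    by transitivity (q * q - q' * q'); [ring|]; transitivity (s' * s' - s * s); [lra|ring].
  rewrite sqrrN exprMn ler_wpM2l ?sqr_ge0//.
  rewrite -[X in X <= _]real_normK ?num_real// ler_pXn2r ?nnegrE ?(ltW qq)//.
  by rewrite ler_norml; apply/andP; split; lra.
by have := sqr_ge0 (s - s'); rewrite expr2 in k; lra.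
Qed.

Lemma connected_arc x e v r t1 t2 : orthoframe e v -> 0 <= r ->
  - (r / 2) <= t1 -> t2 <= r / 2 -> connected [set arcpt x e v r t | t in `[t1, t2]%classic].
Proof.
move=> fr r0 h1 h2; apply: connected_continuous_connected.
  by apply/connected_intervalP/interval_is_interval.
apply: (@lipschitz_within _ _ _ 2) => c c' /=; rewrite !in_itv /= => /andP[? ?] /andP[? ?].
by apply: arcpt_lipschitz => //; rewrite ler_norml; apply/andP; split; lra.
Qed.

Lemma connected_sub_clopen (T : topologicalType) (G W B : set T) : connected G -> G `<=` W ->
  (exists2 C, open C & B = W `&` C) -> (exists2 D, closed D & B = W `&` D) ->
  G `&` B !=set0 -> G `<=` B.
Proof.
move=> cG GW [C oC BC] [D cD BD] GB.
suff <- : G `&` B = G by move=> p [].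
apply: cG => //; [exists C => //; rewrite BC|exists D => //; rewrite BD];
  by rewrite setIA (setIidl GW).
Qed.

(** Points of O are moved radially; x must be excluded because radius 0 is never interior to the set
    of radii. *)
Lemma open_radii x (O : set 'rV[R]_2) : open O -> ~ O x ->
  open [set enorm (u - x) | u in O].
Proof.
move=> oO Ox; rewrite openE => _ [u Ou <-].
have [r r0 hr] := (open_enormP O).1 oO u Ou.
have n0 : 0 < enorm (u - x).
  by apply: enorm_gt0 => /eqP; rewrite subr_eq0 => /eqP ux; apply: Ox; rewrite -ux.
apply/nbhs_ballP; exists (Order.min r (enorm (u - x))); first by rewrite /= lt_min r0.
move=> s; rewrite /ball /= lt_min => /andP[s1 s2].
have s0 : 0 < s by have := ler_norm (enorm (u - x) - s); lra.
exists (x + (s / enorm (u - x)) *: (u - x)).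
  apply: hr.
  have -> : x + (s / enorm (u - x)) *: (u - x) - u = ((s - enorm (u - x)) / enorm (u - x)) *: (u - x).
    by apply/rowP => i; rewrite !mxE; field; rewrite gt_eqF.
  rewrite enormZ normrM (gtr0_norm (x := (enorm (u - x))^-1)) ?invr_gt0//.
  by rewrite divfK ?gt_eqF// distrC.
by rewrite addrAC subrr add0r enormZ gtr0_norm ?divr_gt0// divfK// gt_eqF.
Qed.

End Lune.

(** * The passage through the lune: blocked radii and connected slices *)

Section LunePassage.
Context {R : realType}.
Variables (E : set 'rV[R]_2) (eps : R).
Hypotheses (cptE : compact E) (eps_gt0 : 0 < eps).
Implicit Types (a b c h p q u w y z : 'rV[R]_2) (r s t : R).

Local Notation U := (outer E eps).
Local Notation A := (outer_closure E eps).
Local Notation dirs := (dirs E eps).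
Local Notation covered := (covered E eps).

Variables (x e v : 'rV[R]_2) (d k : R).
Hypotheses (fr : orthoframe e v) (Ax : A x) (hv : dirs x v) (hv' : dirs x (- v)).
Hypotheses (d0 : 0 < d) (d8 : d <= eps / 8) (k0 : 0 <= k) (k4 : k <= eps / 4).
Hypothesis cov : forall z, enorm (z - x) < d -> ~ U z ->
  covered x v k z \/ covered x (- v) k z.

Lemma covered_not_outer w z : covered x w k z -> ~ U z.
Proof. by move=> [y [Ey _ zy]]; apply/not_outerP => //; exists y. Qed.

Lemma outer_cone u : A u -> enorm (u - x) < d -> 0 <= edot (u - x) e -> cone x e v u.
Proof.
move=> Au ud ue; have ud8 : enorm (u - x) <= eps / 8 by apply/ltW/(lt_le_trans ud d8).
have := lune_cone cptE eps_gt0 fr hv hv' Au ud8.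
by rewrite (ger0_norm ue) /cone /=; have := normr_ge0 (edot (u - x) v); lra.
Qed.

(** A point of the same arc further in direction w would, by [arc_closer], be at distance less than
    eps from E, hence outside A. *)
Lemma covered_below w z z' : orthoframe e w -> covered x w k z ->
  cone x e w z -> cone x e w z' -> enorm (z - x) = enorm (z' - x) ->
  A z' -> edot (z' - x) w <= edot (z - x) w.
Proof.
have [sd0 sd8 sk0 sk4] : [/\ 0 < d, d <= eps / 8, 0 <= k & k <= eps / 4] by [].
have se0 : 0 < eps by [].
move=> fw [y [Ey yk zy]] cz cz' zz' Az'; rewrite leNgt; apply/negP => lt.
have yk4 : enorm (y - (x + eps *: w)) <= eps / 4 by lra.
have := arc_closer eps_gt0 fw yk4 cz cz' zz' lt zy.
by have := outer_closure_ge cptE eps_gt0 Az' Ey; lra.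
Qed.

(** [covered_below] from both sides leaves a single v-coordinate for points of A on this arc. *)
Lemma blocked_unique z u : covered x v k z -> covered x (- v) k z -> cone x e v z ->
  A u -> cone x e v u -> enorm (u - x) = enorm (z - x) -> u = z.
Proof.
move=> z1 z2 cz Au cu uz.
have h1 := covered_below fr z1 cz cu (esym uz) Au.
have h2 : edot (u - x) (- v) <= edot (z - x) (- v).
  by apply: covered_below (orthoframeNr fr) z2 _ _ (esym uz) Au; rewrite cone_opp.
rewrite !edotNr in h2; rewrite /cone /= in cz cu.
have ue : 0 <= edot (u - x) e by apply: le_trans cu.
have ze : 0 <= edot (z - x) e by apply: le_trans cz.
rewrite -(arcpt_eq fr ue) -[RHS](arcpt_eq fr ze).
by rewrite uz; congr arcpt; lra.
Qed.

Definition blocked : set 'rV[R]_2 :=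
  [set z | [/\ cone x e v z, covered x v k z & covered x (- v) k z]].

(** At distance r from x and w-coordinate r / 2, the squared distance to x + eps w is r^2 - eps r +
    eps^2. *)
Lemma arc_end_covered w r : orthoframe e w -> dirs x w -> 0 < r < d ->
  covered x w k (arcpt x e w r (r / 2)).
Proof.
have [sd0 sd8 sk0 sk4] : [/\ 0 < d, d <= eps / 8, 0 <= k & k <= eps / 4] by [].
have se0 : 0 < eps by [].
move=> fw [w1 Ew] /andP[r0 rd].
have r0' := ltW r0.
have [|n1 _] := @arcpt_norm _ x e w r (r / 2) fw r0'.
  by rewrite ger0_norm ?divr_ge0.
have [h1 h2] := arcpt_coord x r (r / 2) fw.
exists (x + eps *: w); split=> //; first by rewrite subrr enorm0.
set z := arcpt _ _ _ _ _ in n1 h1 h2 *.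
rewrite (enorm_le_sqr _ (ltW se0)).
have -> : edot (z - (x + eps *: w)) (z - (x + eps *: w))
    = edot (z - x) (z - x) - 2 * eps * edot (z - x) w + eps * eps * edot w w.
  by rewrite !edot2 !mxE; ring.
rewrite -sqr_enorm n1 h2 w1.
have : r * r <= r * eps by rewrite ler_pM2l//; lra.
lra.
Qed.

Lemma arcptN r s : arcpt x e (- v) r s = arcpt x e v r (- s).
Proof. by rewrite /arcpt sqrrN scalerN scaleNr. Qed.

(** The arc is connected and its ends are covered from opposite sides. If it misses U, two closed
    sets cover it and must meet. *)
Lemma open_or_blocked r : 0 < r < d ->
  (exists u, [/\ U u, enorm (u - x) = r & cone x e v u]) \/
  (exists2 z, blocked z & enorm (z - x) = r).
Proof.
have [sd0 sd8 sk0 sk4] : [/\ 0 < d, d <= eps / 8, 0 <= k & k <= eps / 4] by [].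
have se0 : 0 < eps by [].
move=> /andP[r0 rd]; apply: contrapT => /not_orP[hU hB].
have r0' := ltW r0.
pose G := [set arcpt x e v r t | t in `[- (r / 2), r / 2]%classic].
have Gin z : G z -> enorm (z - x) = r /\ cone x e v z.
  move=> [t /=]; rewrite in_itv /= => /andP[t1 t2] <-.
  by apply: arcpt_norm => //; rewrite ler_norml t1.
have Gcov z : G z -> covered x v k z \/ covered x (- v) k z.
  move=> Gz; have [zr cz] := Gin z Gz; apply: cov; first by rewrite zr.
  by move=> Uz; apply: hU; exists z.
have Gnot z : G z -> covered x v k z -> covered x (- v) k z -> False.
  by move=> Gz h1 h2; apply: hB; have [zr cz] := Gin z Gz; exists z.
have rd' : 0 < r < d by rewrite r0.
have Gp : G (arcpt x e v r (r / 2)).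
  by exists (r / 2) => //=; rewrite in_itv /= lexx andbT; lra.
have Gm : G (arcpt x e v r (- (r / 2))).
  by exists (- (r / 2)) => //=; rewrite in_itv /= lexx /=; lra.
have cp := arc_end_covered fr hv rd'.
have cm := arc_end_covered (orthoframeNr fr) hv' rd'; rewrite arcptN in cm.
apply: (Gnot _ Gm _ cm).
suff [] : (G `&` covered x v k) (arcpt x e v r (- (r / 2))) by [].
suff -> : G `&` covered x v k = G by [].
apply: connected_arc fr r0' _ _ _ _ _ _; [exact: lexx|exact: lexx|..].
- by exists (arcpt x e v r (r / 2)).
- exists (~` covered x (- v) k); first by apply: closed_openC; apply: closed_covered.
  apply/seteqP; split=> z [Gz h]; split=> //; first by move=> h'; apply: (Gnot z).
  by case: (Gcov z Gz).
- by exists (covered x v k) => //; apply: closed_covered.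
Qed.

Lemma cone_gt0 u : cone x e v u -> u <> x -> 0 < edot (u - x) e.
Proof.
move=> cu ux; rewrite lt_neqAle eq_sym; apply/andP; split; last exact: le_trans cu.
apply/eqP => q0; apply: ux; move: cu; rewrite /cone /= q0 normr_le0 => /eqP q1.
have := edot_frame (u - x) (u - x) fr; rewrite q0 q1 !mul0r addr0 => /edot_eq0/eqP.
by rewrite subr_eq0 => /eqP.
Qed.

Lemma covered_tilt w z t : edot w w = 1 -> enorm (z - x) < d -> d + k < eps * t -> A z ->
  covered x w k z -> exists2 c, dirs z c & 1 - t < edot c w.
Proof.
move=> w1 zd dkt Az [y [Ey yk zy]]; have nw : enorm w = 1 by apply/enorm_unit.
exists (eps^-1 *: (y - z)); first by case: (dirs_of cptE eps_gt0 Az Ey zy).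
rewrite edotZl -(ltr_pM2l eps_gt0) mulrA divff ?gt_eqF// mul1r.
have h1 := edot_le (x + eps *: w - y) w; have h2 := edot_le (z - x) w.
rewrite nw !mulr1 enormBC in h1; rewrite nw mulr1 in h2.
have : edot (y - z) w = eps - edot (x + eps *: w - y) w - edot (z - x) w.
  by rewrite !edotBl edotDl edotZl w1; ring.
lra.
Qed.

Lemma blocked_pinched z t : blocked z -> A z -> z <> x -> enorm (z - x) < d -> d <= t ->
  d + k < eps * t -> pinched E eps x v e t z.
Proof.
move=> [cz zp zm] Az zx zd dt dkt; have [_ v1 _] := fr.
have v1' : edot (- v) (- v) = 1 by rewrite edotNl edotNr opprK.
have [c zc c1] := covered_tilt v1 zd dkt Az zp.
have [c' zc' c1'] := covered_tilt v1' zd dkt Az zm.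
split; [exact: Az|exact: lt_le_trans dt|exact: cone_gt0|].
exists c, c'; split; [exact: zc|exact: zc'|exact: c1|].
by rewrite -ltrN2 opprD opprK -edotNr.
Qed.

(* The first blocked radius above a free one would be pinched. *)
Lemma all_radii_open t : 0 < t -> outward E eps x e -> d <= t -> d + k < eps * t ->
  (forall b, ~ pinched E eps x v e t b) ->
  forall r, 0 < r < d -> exists u, [/\ U u, enorm (u - x) = r & cone x e v u].
Proof.
have [sd0 sd8 sk0 sk4] : [/\ 0 < d, d <= eps / 8, 0 <= k & k <= eps / 4] by [].
have se0 : 0 < eps by [].
move=> t0 /outwardP[e1 hout] dt dkt npin r /andP[r0 rd].
have rd' : 0 < r < d by rewrite r0.
have [//|[z1 bz1 z1r]] := open_or_blocked rd'; exfalso.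
have ne : enorm e = 1 by apply/enorm_unit.
have [u0 [Uu0 u0r u0e]] : exists u, [/\ U u, 0 < enorm (u - x) < r & 0 <= edot (u - x) e].
  have [|p [Up px pe]] := hout (Order.min r 1); first by rewrite lt_min r0 ltr01.
  have p0 : 0 < enorm (p - x).
    apply: enorm_gt0 => /eqP; rewrite subr_eq0 => /eqP px'.
    by apply: (dirs_not_outer cptE eps_gt0 hv); rewrite -px'.
  have px' : enorm (p - x) < r by apply: lt_le_trans px _; rewrite ge_min lexx.
  exists p; split=> //; first by rewrite p0.
  set q := _ *: (p - x) in pe.
  have q1 : enorm (q - e) < 1 by apply: lt_le_trans pe _; rewrite ge_min lexx orbT.
  have := edot_le (e - q) e; rewrite ne enormBC mulr1 [edot (e - q) e]edotBl e1 => h.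
  have : 0 <= edot q e by lra.
  by rewrite /q edotZl pmulr_rge0 ?invr_gt0.
set r0' := enorm (u0 - x) in u0r; case/andP: u0r => r0'0 r0'r.
have u0d : enorm (u0 - x) < d by rewrite -/r0'; lra.
have cu0 := outer_cone (subset_outer_closure Uu0) u0d u0e.
have [_ v1 _] := fr.
(* A foot of x on [Z] is a blocked point of least radius among those at radius at least r0'. *)
pose Z := blocked `&` [set z | r0' <= enorm (z - x)].
have cZ : closed Z.
  apply: closedI; last first.
    apply/closed_enormP => z hz; rewrite /= leNgt; apply/negP => lt.
    have [|a /= ha az] := hz (r0' - enorm (z - x)); first by rewrite subr_gt0.
    by have := enormB_le z a x; lra.
  have -> : blocked = cone x e v `&` (covered x v k `&` covered x (- v) k).
    by apply/seteqP; split=> z; [case|case=> ? []].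
  by apply: closedI; [exact: closed_cone|apply: closedI; exact: closed_covered].
have [z0 [[[cz0 z0p z0m] /= z0r] z0min]] : exists z0, foot Z x z0.
  by apply: ex_foot => //; exists z1; split=> //=; rewrite z1r ltW.
set r1 := enorm (z0 - x) in z0r.
have r1r : r1 <= r.
  have : enorm (x - z0) <= enorm (x - z1) by apply: z0min; split=> //=; rewrite z1r ltW.
  by rewrite enormBC -/r1 (enormBC x) z1r.
have z0r' : r0' < r1.
  rewrite lt_neqAle z0r andbT; apply/eqP => rr.
  have := blocked_unique z0p z0m cz0 (subset_outer_closure Uu0) cu0 rr.
  by move=> uz; apply: (covered_not_outer z0p); rewrite -uz.
have free s : r0' <= s < r1 -> exists u, [/\ U u, enorm (u - x) = s & cone x e v u].
  move=> /andP[s1 s2]; have [||[z bz zs]] := @open_or_blocked s => //.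
    by apply/andP; split; lra.
  have : enorm (x - z0) <= enorm (x - z) by apply: z0min; split=> //=; rewrite zs.
  by rewrite enormBC -/r1 (enormBC x) zs; lra.
(* Free points at radii increasing to r1 cluster at a point of A on the blocked circle, which is z0
   by [blocked_unique]. This puts z0 in A, as pinching requires. *)
have [||us usB cl] := @compact_cluster _ [set p | enorm p <= enorm x + d]
   (fun s u => [/\ U u, r1 - s <= enorm (u - x), enorm (u - x) <= r1 & cone x e v u]).
- apply: (@compact_enorm _ _ (enorm x + d)) => //; apply/closed_enormP => z hz.
  rewrite /= leNgt; apply/negP => lt.
  have [|a /= ha az] := hz (enorm z - (enorm x + d)); first by rewrite subr_gt0.
  by have := enormB_le a z 0; rewrite !subr0 (enormBC z a); lra.
- move=> s s0; pose s' := Order.max r0' (r1 - s).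
  have s'1 : r0' <= s' by rewrite le_max lexx.
  have s'2 : r1 - s <= s' by rewrite le_max lexx orbT.
  have s'3 : s' < r1 by rewrite gt_max z0r'; lra.
  have [|u [Uu us cu]] := free s'; first by rewrite s'1.
  exists u; first by rewrite /=; have := enormB_le x u 0; rewrite !subr0; lra.
  by rewrite us; split=> //; lra.
have cus : cone x e v us.
  apply: ((closed_enormP _).1 (@closed_cone _ x e v e1 v1)) => s s0.
  by have [? [u [_ _ [_ _ _ ?] ?]]] := cl s s0; exists u.
have Aus : A us.
  apply/closure_enormP => s s0.
  by have [? [u [_ _ [? _ _ _] ?]]] := cl s s0; exists u.
have usr : enorm (us - x) = enorm (z0 - x).
  apply/eqP; rewrite -/r1 eq_le; apply/andP; split; rewrite leNgt; apply/negP => lt.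
    have [|s [u [/andP[_ s1] _ [_ _ h _] uu]]] := cl (enorm (us - x) - r1).
      by rewrite subr_gt0.
    by have := enormB_le u us x; rewrite (enormBC us u); lra.
  have [|s [u [/andP[_ s1] _ [_ h _ _] uu]]] := cl ((r1 - enorm (us - x)) / 2).
    by rewrite divr_gt0// subr_gt0.
  by have := enormB_le us u x; lra.
have us0 := blocked_unique z0p z0m cz0 Aus cus usr.
rewrite {}us0 in Aus cus usr.
have z0d : enorm (z0 - x) < d by apply: le_lt_trans r1r rd.
have z0x : z0 <> x.
  by move=> zx; move: z0r' r0'0; rewrite /r1 zx subrr enorm0 => /lt_trans h /h; rewrite ltxx.
exact: (npin z0 (blocked_pinched (And3 cz0 z0p z0m) Aus z0x z0d dt dkt)).
Qed.

(** Every circle about x of radius below d meets the set in a nonempty arc. A relatively clopen part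
    is therefore a union of whole slices, and its radii form a clopen subset of the interval. *)
Lemma connected_half_ball :
  (forall r, 0 < r < d -> exists u, [/\ U u, enorm (u - x) = r & cone x e v u]) ->
  connected (half_ball d x e `\` offset E eps).
Proof.
have [sd0 sd8 sk0 sk4] : [/\ 0 < d, d <= eps / 8, 0 <= k & k <= eps / 4] by [].
have se0 : 0 < eps by [].
move=> hr; set W := half_ball d x e `\` offset E eps.
have Ux : ~ U x := dirs_not_outer cptE eps_gt0 hv.
have WU u : W u -> [/\ U u, 0 < enorm (u - x) < d, cone x e v u & 0 < edot (u - x) e].
  move=> [[ud ue] uo]; rewrite /eball /= in ud; split; [exact: uo| | |exact: ue].
    rewrite ud andbT; apply: enorm_gt0 => /eqP; rewrite subr_eq0 => /eqP ux.
    by apply: Ux; rewrite -ux.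
  exact: (outer_cone (subset_outer_closure uo) ud (ltW ue)).
have cone_pos u : cone x e v u -> 0 < enorm (u - x) -> 0 < edot (u - x) e.
  by move=> cu u0; apply: cone_gt0 => // ux; rewrite ux subrr enorm0 ltxx in u0.
have oW : open W.
  have [/enorm_unit e1 _ _] := fr.
  apply: openI; last exact: open_outer.
  apply/open_enormP => z [zd ze]; rewrite /eball /= in zd.
  exists (Order.min (d - enorm (z - x)) (edot (z - x) e)).
    by rewrite lt_min subr_gt0 zd.
  move=> y; rewrite lt_min => /andP[y1 y2]; split.
    by rewrite /eball /=; have := enormB_le z y x; lra.
  have := edot_le (z - y) e; rewrite e1 mulr1 enormBC.
  have -> : edot (z - y) e = edot (z - x) e - edot (y - x) e by rewrite !edotE; ring.
  lra.
have slice u u' : W u -> W u' -> enorm (u - x) = enorm (u' - x) ->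
    edot (u - x) v <= edot (u' - x) v ->
    exists G, [/\ connected G, G `<=` W, G u & G u'].
  move=> Wu Wu' uu' ss'.
  have [Uu /andP[u0 ud] cu ue] := WU u Wu; have [Uu' _ cu' ue'] := WU u' Wu'.
  set r := enorm (u - x) in uu' u0 ud.
  have r0 : 0 <= r by exact: ltW.
  have small q : A q -> enorm (q - x) = r -> `|edot (q - x) v| <= r / 2.
    move=> Aq qr; have := edot_lune cptE eps_gt0 hv hv' Aq; rewrite qr => h.
    rewrite -(@ler_pM2l _ (2 * eps)) ?mulr_gt0//; apply: (le_trans h).
    by rewrite expr2 mulrC mulrA mulrAC; rewrite ler_wpM2r//; lra.
  have := small u (subset_outer_closure Uu) erefl.
  have := small u' (subset_outer_closure Uu') (esym uu').
  rewrite !ler_norml => /andP[s3 s4] /andP[s1 s2].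
  exists [set arcpt x e v r t | t in `[edot (u - x) v, edot (u' - x) v]%classic].
  split; first exact: connected_arc.
  - move=> z' [t /=]; rewrite in_itv /= => /andP[t1 t2] <-.
    have tr : `|t| <= r / 2 by rewrite ler_norml; apply/andP; split; lra.
    have [nz cz] := arcpt_norm x fr r0 tr; have [_ hz] := arcpt_coord x r t fr.
    set z := arcpt _ _ _ _ _ in nz cz hz *.
    have zd : enorm (z - x) < d by rewrite nz.
    split; first by split; [exact: zd|apply: cone_pos cz _; rewrite nz].
    (* If z is covered from the v side, [covered_below] leaves u' no room above z, so z = u'; from
       the other side z = u. Both are in U, which is absurd. *)
    have Uz : U z; last exact: Uz.
    apply: contrapT => nUz; case: (cov zd nUz) => cv.
      have zu' : enorm (z - x) = enorm (u' - x) by rewrite nz.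
      have := covered_below fr cv cz cu' zu' (subset_outer_closure Uu').
      rewrite hz => h; have tE : t = edot (u' - x) v by lra.
      apply: (covered_not_outer cv); rewrite /z tE uu' arcpt_eq//; exact: ltW.
    have zu : enorm (z - x) = enorm (u - x) by rewrite nz.
    have : edot (u - x) (- v) <= edot (z - x) (- v).
      apply: covered_below (orthoframeNr fr) cv _ _ zu (subset_outer_closure Uu);
        by rewrite cone_opp.
    rewrite !edotNr hz => h; have tE : t = edot (u - x) v by lra.
    by apply: (covered_not_outer cv); rewrite /z tE arcpt_eq// ltW.
  - exists (edot (u - x) v); first by rewrite /= in_itv /= lexx.
    by rewrite arcpt_eq// ltW.
  - exists (edot (u' - x) v); first by rewrite /= in_itv /= lexx andbT.
    by rewrite uu' arcpt_eq// ltW.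
move=> B B0 [C oC BC] [D cD BD].
have BW u : B u -> W u by rewrite BC => -[].
have oB : open B by rewrite BC; apply: openI.
have BD' : W `\` B = W `&` ~` D.
  by rewrite BD; apply/seteqP; split=> z [Wz h]; split=> //; [move=> Dz; apply: h|case].
have oB' : open (W `\` B) by rewrite BD'; apply: openI => //; apply: closed_openC.
have same u u' : B u -> W u' -> enorm (u - x) = enorm (u' - x) -> B u'.
  move=> Bu Wu' uu'.
  have [G [cG GW Gu Gu']] : exists G, [/\ connected G, G `<=` W, G u & G u'].
    have [h|/ltW h] := lerP (edot (u - x) v) (edot (u' - x) v).
      exact: slice (BW u Bu) Wu' uu' h.
    by have [G [? ? ? ?]] := slice u' u Wu' (BW u Bu) (esym uu') h; exists G.
  apply: (connected_sub_clopen cG GW (ex_intro2 _ _ C oC BC) (ex_intro2 _ _ D cD BD)) => //.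
  by exists u.
pose T := [set enorm (u - x) | u in B].
pose T' := [set enorm (u - x) | u in W `\` B].
have nWx : ~ W x by move=> /WU[].
have oT : open T by apply: open_radii oB _ => /BW.
have oT' : open T' by apply: open_radii oB' _ => -[].
have cI : connected `]0, d[%classic.
  by apply/connected_intervalP/interval_is_interval.
have TI : `]0, d[%classic `&` T = `]0, d[%classic.
  apply: cI.
  - have [u Bu] := B0; exists (enorm (u - x)); split; last by exists u.
    by have [_ h _ _] := WU u (BW u Bu); rewrite /= in_itv /=.
  - by exists T.
  - exists (~` T'); first exact: open_closedC.
    apply/seteqP; split=> s [sI hs]; split=> //.
      by case: hs => u Bu <- [u' [Wu' nBu'] u'u]; apply/nBu'/(same u u').
    move: sI; rewrite /= in_itv /= => sI.
    have [u [Uu us cu]] := hr s sI.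
    have Wu : W u.
      split=> //; case/andP: sI => s0 sd; split; first by rewrite /eball /= us.
      by apply: cone_pos => //; rewrite us.
    by have [Bu|nBu] := pselect (B u); [exists u|case: hs; exists u].
apply/seteqP; split=> u; first exact: BW.
move=> Wu; have [_ ud _ _] := WU u Wu.
have : (`]0, d[%classic `&` T) (enorm (u - x)) by rewrite TI /= in_itv /=.
by move=> [_ [u' Bu' u'u]]; apply: same Bu' Wu u'u.
Qed.

End LunePassage.

(** * Cluster points of double feet are chain singularities *)

Section ChainSingularityExistence.
Context {R : realType}.
Variables (E : set 'rV[R]_2) (eps : R).
Hypotheses (cptE : compact E) (eps_gt0 : 0 < eps).
Implicit Types (a b c h p q u v w x y z e : 'rV[R]_2) (r s t : R).

Local Notation U := (outer E eps).
Local Notation A := (outer_closure E eps).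
Local Notation dirs := (dirs E eps).
Local Notation double_foot := (double_foot E eps).
Local Notation outward := (outward E eps).

Lemma closed_outer_closure : closed A.
Proof. exact: closed_closure. Qed.

Lemma double_foot_sym z a b : double_foot z a b -> double_foot z b a.
Proof. by move=> [fa fb ab]; split=> // /esym. Qed.

(** A point of A is its own only foot, so points with two feet lie in the offset, which is
    compact. *)
Lemma not_positive_reach : ~ positive_reach A -> exists x, [/\ A x, ~ U x &
  forall r, 0 < r -> exists z a b, double_foot z a b /\ enorm (z - x) < r].
Proof.
move=> npr.
have cA := closed_outer_closure.
have bad t : 0 < t -> exists y z a b,
    [/\ A y, enorm (z - y) < t & double_foot z a b].
  move=> t0; apply: contrapT => hn; apply/npr/positive_reachP; exists t => // y Ay z zy.
  apply/UnpP => //; first by exists y.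
  move=> a b fa fb; apply: contrapT => ab; apply: hn.
  by exists y, z, a, b.
have not_outer z a b : double_foot z a b -> ~ U z.
  move=> [[_ fa] [_ fb] ab] /subset_outer_closure Az; apply: ab.
  have eq p : enorm (z - p) <= enorm (z - z) -> p = z.
    rewrite subrr enorm0 => h; have : enorm (z - p) = 0.
      by have := enorm_ge0 (z - p); lra.
    by move/enorm0_eq0/eqP; rewrite subr_eq0 => /eqP.
  by rewrite (eq a (fa z Az)) (eq b (fb z Az)).
have [M M0 hM] := compact_bounded_enorm cptE.
have cO : compact (offset E eps).
  apply: (@compact_enorm _ _ (M + eps)); first exact: closed_closure.
  move=> z /(offsetP cptE eps_gt0)[y Ey zy]; have := hM y Ey.
  by have := enormB_le y z 0; rewrite !subr0; lra.
have [r r0|x Ox cl] := @compact_cluster _ _ (fun r z => exists y a b,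
    [/\ A y, enorm (z - y) < r & double_foot z a b]) cO.
  have [y [z [a [b [Ay zy zab]]]]] := bad r r0; exists z; last by exists y, a, b.
  by apply: contrapT; exact: not_outer zab.
exists x; split; last first.
- move=> r r0; have [s [z [_ _ [y [a [b [_ _ zab]]]] zx]]] := cl r r0.
  by exists z, a, b.
- by move=> Ux; apply: Ux.
apply: ((closed_enormP A).1 cA) => r r0.
have [|s [z [/andP[_ sr] _ [y [a [b [Ay zy _]]]] zx]]] := cl (r / 2).
  by rewrite divr_gt0.
by exists y => //; have := enormB_le z y x; have := enormBC z y; lra.
Qed.

Lemma pinched_le x v e r s b : r <= s -> pinched E eps x v e r b -> pinched E eps x v e s b.
Proof.
move=> rs [Ab bx be [c [c' [bc bc' cv cv']]]]; split=> //; first by lra.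
by exists c, c'; split=> //; lra.
Qed.

Lemma unit_neqN v : edot v v = 1 -> v <> - v.
Proof. by move=> v1 h; have := v1; rewrite {2}h edotNr; lra. Qed.

Section AtClusterPoint.
Variables (x eta v : 'rV[R]_2).
Hypotheses (Ax : A x) (Ux : ~ U x) (oeta : outward x eta) (fr : orthoframe eta v).
Hypothesis bad : forall r, 0 < r -> exists z a b, double_foot z a b /\ enorm (z - x) < r.

(** [double_foot_dirs] serves for v and for - v. It applies to either foot, so b may be the one
    further from x, as [gap] requires. *)
Lemma near_double_foot r : 0 < r -> exists z a b, [/\ double_foot z a b, enorm (z - x) < r,
  enorm (b - x) < r, enorm (a - x) <= enorm (b - x) &
  exists c c', [/\ dirs b c, dirs b c', 1 - r < edot c v & edot c' v < -1 + r]].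
Proof.
move=> r0; have hx c := @outward_edot _ _ _ cptE eps_gt0 x eta c oeta.
pose d := Order.min r (1 / 2).
have d01 : 0 < d <= 1 / 2 by rewrite lt_min r0 ge_min lexx orbT divr_gt0.
have dr : d <= r by rewrite ge_min lexx.
have [r1 r10 h1] := double_foot_dirs cptE eps_gt0 Ax hx fr d01.
have [r2 r20 h2] := double_foot_dirs cptE eps_gt0 Ax hx (orthoframeNr fr) d01.
have [|z [a [b [zab]]]] := bad (r := Order.min (r / 2) (Order.min r1 r2)).
  by rewrite !lt_min r10 r20 divr_gt0.
rewrite !lt_min => /and3P[zr zr1 zr2].
wlog ab : a b zab / enorm (a - x) <= enorm (b - x).
  move=> H; have [|/ltW] := lerP (enorm (a - x)) (enorm (b - x)); first exact: H.
  by apply: H; apply: double_foot_sym.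
have [c bc cv] := h1 z a b zab zr1; have [c' bc' cv'] := h2 z a b zab zr2.
exists z, a, b; split=> //; first by lra.
  have [_ [_ fb] _] := zab; have := fb x Ax; have := enormB_le z b x.
  by rewrite (enormBC b z); lra.
by exists c, c'; split=> //; rewrite ?edotNr in cv'; lra.
Qed.

Lemma cluster_dirs : dirs x v /\ dirs x (- v).
Proof.
have [_ v1 _] := fr.
split; apply: (dirs_limit cptE eps_gt0) => [r r0|] //.
- have [z [a [b [_ _ bx _ [c [c' [bc _ cv _]]]]]]] := near_double_foot r0.
  by exists b, c.
- have [z [a [b [_ _ bx _ [c [c' [_ bc' _ cv']]]]]]] := near_double_foot r0.
  by exists b, c'; split=> //; rewrite edotNr; lra.
- by rewrite edotNl edotNr opprK.
Qed.

(** Stronger than the existence of a pinched point: [gap] also needs the second foot a, whereas for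
    chains the pinched point is enough. *)
Definition good_side e r := exists z a b, [/\ double_foot z a b, enorm (z - x) < r,
  enorm (a - x) <= enorm (b - x) & pinched E eps x v e r b].

Lemma good_side_le e r s : r <= s -> good_side e r -> good_side e s.
Proof.
move=> rs [z [a [b [zab zx ab pb]]]]; exists z, a, b; split=> //; first by lra.
exact: pinched_le pb.
Qed.

(** Being the further of two distinct feet, b differs from x and so lies strictly on one side by
    [lune_neq0]; one of the two sides recurs at all scales. *)
Lemma ex_good_side : (forall r, 0 < r -> good_side eta r) \/
  (forall r, 0 < r -> good_side (- eta) r).
Proof.
have [hv hv'] := cluster_dirs; apply: contrapT => /not_orP[].
move=> /existsNP[r1 /not_implyP[r10 n1]] /existsNP[r2 /not_implyP[r20 n2]].
pose r := Order.min eps (Order.min r1 r2).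
have r0 : 0 < r by rewrite !lt_min eps_gt0 r10.
have re : r <= eps by rewrite ge_min lexx.
have rr1 : r <= r1 by rewrite !ge_min lexx orbT.
have rr2 : r <= r2 by rewrite !ge_min lexx !orbT.
have [z [a [b [zab zx bx ab cc]]]] := near_double_foot r0.
have [_ [Ab _] nab] := zab.
have xb : b <> x.
  move=> bx0; apply: nab; rewrite bx0 subrr enorm0 in ab.
  have /enorm0_eq0/eqP : enorm (a - x) = 0 by have := enorm_ge0 (a - x); lra.
  by rewrite subr_eq0 bx0 => /eqP.
have := lune_neq0 cptE eps_gt0 fr hv hv' Ab xb (lt_le_trans bx re).
have [be|be] := ltrP 0 (edot (b - x) eta).
  by move=> _; apply/n1/(good_side_le rr1); exists z, a, b.
move=> be0; apply/n2/(good_side_le rr2); exists z, a, b; split=> //; split=> //.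
by rewrite edotNr oppr_gt0 lt_neqAle be andbT; apply/eqP.
Qed.

Lemma good_side_gap e s : orthoframe e v -> (forall r, 0 < r -> good_side e r) -> 0 < s ->
  exists b t, [/\ A b, 0 < edot (b - x) e, enorm (b - x) < s, 0 < t < enorm (b - x) &
    forall p, A p -> enorm (p - x) = t -> edot (p - x) e <= 0].
Proof.
move=> fe good s0; have [hv hv'] := cluster_dirs.
have m0 : 0 < Order.min s (Order.min (eps / 8) (1 / 128)).
  by rewrite !lt_min s0 !divr_gt0.
have [z [a [b [zab zx ab [Ab bx be [c [c' [bc bc' cv cv']]]]]]]] := good _ m0.
move: zx bx cv cv'; set m := Order.min _ _ in m0 * => zx bx cv cv'.
have ms : m <= s by rewrite ge_min lexx.
have me : m <= eps / 8 by rewrite /m !ge_min lexx orbT.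
have m1 : m <= 1 / 128 by rewrite /m !ge_min lexx !orbT.
have zb : enorm (z - b) < eps / 2.
  have [_ [_ fb] _] := zab; have := fb x Ax.
  by have : 0 < eps := eps_gt0; lra.
have bx8 : enorm (b - x) <= eps / 8 by lra.
have cv1 : 1 - 1 / 128 <= edot c v by lra.
have cv2 : edot c' v <= - (1 - 1 / 128) by lra.
have [t t01 ht] := gap cptE eps_gt0 fe Ax hv hv' zab zb bx8 ab be bc cv1 bc' cv2.
by exists b, t; split=> //; lra.
Qed.

Lemma outward_opp xi : outward x xi -> xi = eta \/ xi = - eta.
Proof.
move=> oxi; have [hv hv'] := cluster_dirs.
have [xi1 _] := (outwardP E eps x xi).1 oxi; have [e1 _ ev] := fr.
have h1 := outward_edot cptE eps_gt0 oxi hv.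
have h2 := outward_edot cptE eps_gt0 oxi hv'.
have xv : edot xi v = 0 by rewrite edotNl in h2; rewrite edotC; lra.
have := edot_frame xi xi fr; rewrite xi1 xv mul0r addr0 => /esym q.
have : (edot xi eta - 1) * (edot xi eta + 1) = 0.
  by transitivity (edot xi eta * edot xi eta - 1); [ring|rewrite q subrr].
move/eqP; rewrite mulf_eq0 => /orP[] /eqP k; [left|right]; apply: (frame_inj fr).
- by rewrite e1; lra.
- by rewrite xv ev.
- by rewrite edotNl e1; lra.
- by rewrite edotNl xv ev oppr0.
Qed.

Lemma ext_outward_cluster : ext_outward E eps x = outward x.
Proof.
have [hv hv'] := cluster_dirs; have [e1 _ ev] := fr.
apply/seteqP; split=> xi; first by case.
move=> oxi; split=> //; exists (x + eps *: v).
  by apply/contributorsP => //; exists v.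
rewrite addrC addKr edotZl edotC.
by case: (outward_opp oxi) => ->; rewrite ?edotNl ev ?oppr0 mulr0.
Qed.

Lemma singularity_cluster : singularities E eps x.
Proof.
have [hv hv'] := cluster_dirs; have [_ v1 _] := fr.
exact: (two_dirs_singularity cptE eps_gt0 Ax hv hv' (unit_neqN v1)).
Qed.

Lemma good_side_chain e t : 0 < t -> (forall r, 0 < r -> good_side e r) ->
  chain_in E eps (half_ball t x e) x.
Proof.
move=> t0 good; have [_ v1 _] := fr.
apply: (pinched_chain (e := e) cptE eps_gt0 v1) => r r0.
have [|z [a [b [_ _ _ pb]]]] := good (Order.min r t); first by rewrite lt_min r0.
exists b; first by apply: pinched_le pb; rewrite ge_min lexx.
case: pb => _ bx be _; split=> //; rewrite /eball /=.
by apply: lt_le_trans bx _; rewrite ge_min lexx orbT.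
Qed.

(** With e and - e both outward, contributors of x are orthogonal to e, so they are x + eps v and x
    - eps v. Upper semicontinuity then gives the covering assumed for the passage through the
    lune. *)
Lemma free_side_connected e t : outward x e -> outward x (- e) -> 0 < t ->
  orthoframe e v -> (forall b, ~ pinched E eps x v e t b) ->
  exists2 d, 0 < d & connected (half_ball d x e `\` offset E eps).
Proof.
move=> oe oe' t0 fe npin; have [hv hv'] := cluster_dirs.
have eps0 : 0 < eps := eps_gt0.
pose k := Order.min (eps / 4) (eps * t / 4).
have k0 : 0 < k by rewrite lt_min !divr_gt0// mulr_gt0.
have k1 : k <= eps / 4 by rewrite ge_min lexx.
have k2 : k <= eps * t / 4 by rewrite ge_min lexx orbT.
pose O w : set 'rV[R]_2 := [set y | enorm (y - (x + eps *: w)) < k].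
have oO w : open (O w).
  apply/open_enormP => y yk; exists (k - enorm (y - (x + eps *: w))).
    by rewrite subr_gt0.
  by move=> y' yy'; rewrite /O /=; have := enormB_le y y' (x + eps *: w); lra.
have [||d' d'0 hd] := @near_contributors _ E eps cptE (O v `|` O (- v)) x.
- exact: openU.
- move=> y Ey xy; have [bc ->] := dirs_of cptE eps_gt0 Ax Ey xy.
  set c := _ *: _ in bc *.
  have c0 : edot c e = 0.
    have h1 := outward_edot cptE eps_gt0 oe bc.
    by have := outward_edot cptE eps_gt0 oe' bc; rewrite edotNr; lra.
  have c1 : edot c c = 1 by case: bc.
  have := edot_frame c c fe; rewrite c1 c0 mul0r add0r => /esym q.
  have : (edot c v - 1) * (edot c v + 1) = 0.
    by transitivity (edot c v * edot c v - 1); [ring|rewrite q subrr].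
  have [_ v1 ev] := fe.
  move/eqP; rewrite mulf_eq0 => /orP[] /eqP h; [left|right].
    suff -> : c = v by rewrite /O /= subrr enorm0.
    by apply: (frame_inj fe); rewrite ?c0 ?(edotC v e) ?ev ?v1//; lra.
  suff -> : c = - v by rewrite /O /= subrr enorm0.
  by apply: (frame_inj fe); rewrite ?edotNl ?c0 ?(edotC v e) ?ev ?v1 ?oppr0//; lra.
(* The bound d' serves the covering and eps / 8 the cone; d and k at most eps t / 4 give d + k < eps
   t, which makes blocked points pinched. *)
pose d := Order.min (Order.min d' (eps / 8)) (Order.min t (eps * t / 4)).
have d0 : 0 < d by rewrite !lt_min d'0 t0 !divr_gt0// mulr_gt0.
have d1 : d <= d' by rewrite !ge_min lexx.
have d2 : d <= eps / 8 by rewrite !ge_min lexx orbT.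
have d3 : d <= t by rewrite !ge_min lexx !orbT.
have d4 : d <= eps * t / 4 by rewrite !ge_min lexx !orbT.
have cov z : enorm (z - x) < d -> ~ U z -> covered E eps x v k z \/ covered E eps x (- v) k z.
  move=> zd /(not_outerP cptE eps_gt0)[y Ey zy].
  have [||h] := hd z y _ Ey zy; first by lra.
  - by move=> h; left; exists y; split=> //; apply: ltW.
  - by right; exists y; split=> //; apply: ltW.
exists d => //; apply: (connected_half_ball cptE eps_gt0 fe hv hv' d0 d2 (ltW k0) k1 cov).
apply: (all_radii_open cptE eps_gt0 fe hv hv' d0 d2 (ltW k0) k1 cov t0 oe d3 _ npin).
by have : 0 < eps * t by [rewrite mulr_gt0]; lra.
Qed.

Lemma good_side_chain_singularity e : (e = eta \/ e = - eta) ->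
  (forall r, 0 < r -> good_side e r) -> chain_singularities E eps x.
Proof.
move=> ee good; have [e1 v1 ev] := fr.
have fe : orthoframe e v by case: ee => ->//; apply: orthoframeNl.
split; first by apply/boundary_offsetP.
have sx := singularity_cluster.
(* If - eta is not outward, the two extremal directions coincide with eta and the chain may lie on
   either side, which gives S6. *)
have [oN|oN] := pselect (outward x (- eta)); last first.
  constructor 1; split=> //; exists eta, eta; split=> //.
    rewrite ext_outward_cluster setUid; apply/seteqP; split=> xi; last by move=> ->.
    by move=> oxi; case: (outward_opp oxi) => // xie; case: oN; rewrite -xie.
  apply: (pinched_chain (e := e) cptE eps_gt0 v1) => r r0.
  have [z [a [b [_ _ _ pb]]]] := good r r0; exists b => // bx.
  by case: pb => _ _; rewrite bx subrr edot0l ltxx.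
have oe : outward x e by case: ee => ->.
have oe' : outward x (- e) by case: ee => ->; rewrite ?opprK.
have ext : ext_outward E eps x = [set - e; e].
  rewrite ext_outward_cluster; apply/seteqP; split=> xi; last by case=> ->.
  by move=> /outward_opp; case: ee => ->; rewrite ?opprK; case=> ->; [right|left|left|right].
have chain2 : exists2 t, 0 < t & chain_in E eps (half_ball t x e) x.
  by exists 1 => //; apply: good_side_chain.
have fe' := orthoframeNl fe.
(* The side - e takes the role of the first extremal direction; pinched points on it suffice for S7,
   without double feet. *)
have [h|/existsNP[t /not_implyP[t0 ht]]] :=
    pselect (forall r, 0 < r -> exists b, pinched E eps x v (- e) r b).
  constructor 2; split=> //; exists (- e), e; split=> //.
  exists 1 => //; apply: (pinched_chain (e := - e) cptE eps_gt0 v1) => r r0.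
  have [|b pb] := h (Order.min r 1); first by rewrite lt_min r0 ltr01.
  exists b; first by apply: pinched_le pb; rewrite ge_min lexx.
  case: pb => _ bx be _; split=> //; rewrite /eball /=.
  by apply: lt_le_trans bx _; rewrite ge_min lexx orbT.
constructor 3; split=> //; exists (- e), e; split=> //.
apply: (free_side_connected oe' _ t0 fe'); first by rewrite opprK.
by move=> b pb; apply: ht; exists b.
Qed.

End AtClusterPoint.

Lemma not_positive_reach_chain : ~ positive_reach A -> exists2 x,
  chain_singularities E eps x & forall r, 0 < r -> ~ connected (eball r x `&` A).
Proof.
move=> /not_positive_reach[x [Ax Ux bad]].
have [eta oeta] := ex_outward Ax Ux.
have e1 : edot eta eta = 1 by case/outwardP: oeta.
have fr := orthoframe_rot90 e1; set v := rot90 eta in fr.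
have [hv hv'] := cluster_dirs Ax oeta fr bad.
have [e [ee good]] : exists e, (e = eta \/ e = - eta) /\
    forall r, 0 < r -> good_side x v e r.
  by case: (ex_good_side Ax oeta fr bad) => h; [exists eta|exists (- eta)];
    split=> //; [left|right].
exists x; first exact: (good_side_chain_singularity Ax Ux oeta fr bad ee good).
have fe : orthoframe e v by case: ee => ->//; apply: orthoframeNl.
move=> r r0.
(* The outer blocked radius s2 comes first, below eps; the point b to be cut off is then sought
   inside it, together with its own inner blocked radius s1. *)
have [b2 [s2 [_ _ b2x /andP[s20 s2b] g2]]] := good_side_gap Ax oeta fr bad fe good eps_gt0.
have m0 : 0 < Order.min s2 r by rewrite lt_min s20.
have [b [s1 [Ab be bx s1b g1]]] := good_side_gap Ax oeta fr bad fe good m0.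
move: bx; rewrite lt_min => /andP[bs2 br].
apply: (gaps_disconnected cptE eps_gt0 fe Ax hv hv' Ab be br s1b _ g1 g2).
by rewrite bs2 (lt_trans s2b).
Qed.

End ChainSingularityExistence.

Theorem theorem4 (R : realType) (E : set 'rV[R]_2) (eps : R)
    (cptE : compact E) (eps_gt0 : 0 < eps) :
  [<-> positive_reach (closure (~` offset E eps));
       forall x, boundary (offset E eps) x ->
         exists2 r : R, 0 < r &
           connected (eball r x `&` closure (~` offset E eps));
       forall x, chain_singularities E eps x ->
         exists2 r : R, 0 < r &
           connected (eball r x `&` closure (~` offset E eps))].
Proof.
tfae.
- move=> pr x /boundary_offsetP[Ax _].
  exact: positive_reach_connected (@closed_outer_closure _ E eps) pr Ax.
- by move=> h x [bx _]; apply: h.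
- move=> h; apply: contrapT.
  move=> /(not_positive_reach_chain cptE eps_gt0)[x cx nx].
  by have [r r0 cr] := h x cx; apply: nx cr.
Qed.
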